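(* Suppose the ordinary BP algorithm is $\gamma$-contractive, i.e. there is a constant $0<\gamma<2$ such that $$\|\mathcal{F}_{v\to u}(m)-\mathcal{F}_{v\to u}(m')\|_{L^2}\le\Big(1-\frac{\gamma}{2}\Big)\sqrt{\frac{1}{|\mathcal{N}(v)\setminus\{u\}|}\sum_{w\in\mathcal{N}(v)\setminus\{u\}}\|m_{w\to v}-m'_{w\to v}\|_{L^2}^2}$$ for all directed edges $(v\to u)\in\vec{\mathcal{E}}$ and all feasible messages $m,m'$, and that the SOSMP algorithm is run with step size $\eta^t=1/(\gamma(t+1))$. Suppose in addition that the compatibility functions $\psi_{uv}$ are defined by a symmetric positive semidefinite trace-class kernel with eigenvalues $\{\lambda_j\}$. For $\delta>0$ let $r^*=r^*(\delta;\{\lambda_j\})$ be the smallest positive integer $r$ with $\lambda_r\le\delta$. If we run the SOSMP algorithm with $r^*$ basis coefficients, then it suffices to perform $$T(\delta;\{\lambda_j\})=\mathcal{O}\Big(r^*\Big(\sum_{j=1}^{r^*}\lambda_j^2\Big)(1/\delta)\log(1/\delta)\Big)$$ arithmetic operations per edge in order to obtain a $\delta$-accurate message vector $m$, i.e. one with $\max_{(v\to u)\in\vec{\mathcal{E}}}\mathbb{E}\big[\|m_{v\to u}-m^*_{v\to u}\|_{L^2}^2\big]\le\delta$, where $m^*$ is the BP fixed point.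
   Context: **Model and BP.** $\mathcal{G}=(\mathcal{V},\mathcal{E})$ is a finite undirected graph without self-edges, $\mathcal{N}(v)$ is the set of neighbors of $v$, and $\vec{\mathcal{E}}$ is the set of all directed edges $(v\to u)$ (both orientations of every edge). Each node carries a variable in a state space $\mathcal{X}$ with base measure $\mu$. Node potentials are $\psi_u:\mathcal{X}\to(0,\infty)$ and edge potentials (compatibility functions) are $\psi_{uv}:\mathcal{X}\times\mathcal{X}\to(0,\infty)$; the model is $p(x_1,\dots,x_n)\propto\prod_u\psi_u(x_u)\prod_{(u,v)\in\mathcal{E}}\psi_{uv}(x_u,x_v)$. $\mathcal{M}\subset L^2(\mathcal{X};\mu)$ is the set of probability densities with respect to $\mu$. Messages are densities: a (feasible) collection of messages is $m=\{m_{v\to u},(v\to u)\in\vec{\mathcal{E}}\}\in\mathcal{M}^{|\vec{\mathcal{E}}|}$. The ordinary BP (belief propagation) algorithm iterates the update $\mathcal{F}:\mathcal{M}^{|\vec{\mathcal{E}}|}\to\mathcal{M}^{|\vec{\mathcal{E}}|}$ with components $$[\mathcal{F}_{v\to u}(m)](x)=\kappa\int_{\mathcal{X}}\psi_{uv}(x,y)\psi_v(y)\prod_{w\in\mathcal{N}(v)\setminus\{u\}}m_{w\to v}(y)\,\mu(dy),$$ with $\kappa$ chosen so that the result integrates to 1. A BP fixed point is $m^*\in\mathcal{M}^{|\vec{\mathcal{E}}|}$ with $\mathcal{F}(m^* )=m^*$; the contractivity assumption guarantees its uniqueness. **Kernels.** $\mathcal{X}$ is compact and each $\psi_{uv}$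 is a continuous symmetric positive semidefinite kernel; Mercer's theorem gives $\psi_{uv}(x,y)=\sum_{j\ge1}\lambda_j\phi_j(x)\phi_j(y)$, with eigenvalues $\lambda_1\ge\lambda_2\ge\cdots\ge0$ and eigenfunctions $\{\phi_j\}$ forming an orthonormal basis of $L^2(\mathcal{X};\mu)$ (possible dependence on the edge is suppressed). Trace class means $\sum_j\lambda_j<\infty$. SOSMP uses the basis $\{\phi_j\}$. **SOSMP algorithm** (stochastic orthogonal series message-passing; parameters: basis, number of coefficients $r$, number of samples $k$, step sizes $\eta^t$). Let $\beta_{uv}(y)=\psi_v(y)\int\psi_{uv}(x,y)\mu(dx)$ and $\Gamma_{uv}(x,y)=\psi_{uv}(x,y)\psi_v(y)/\beta_{uv}(y)$. Initialize $a^0_{v\to u;j}=1/r$ for $j=1,\dots,r$. For $t=0,1,2,\ldots$ and each $(v\to u)$: (i) form $\hat m^t_{w\to v}=\big[\sum_{j=1}^r a^t_{w\to v;j}\phi_j\big]_+$ for $w\in\mathcal{N}(v)\setminus\{u\}$, where $[s]_+=\max\{0,s\}$; (ii) draw $k$ i.i.d. samples $Y_1,\dots,Y_k$ from the probability density proportional to $\beta_{uv}(y)\prod_{w\in\mathcal{N}(v)\setminus\{u\}}\hat m^t_{w\to v}(y)$; (iii) set $\widetilde b^{t+1}_{v\to u;j}=\frac1k\sum_{i=1}^k\langle\Gamma_{uv}(\cdot,Y_i),\phi_j\rangle_{L^2}$, $j=1,\dots,r$; (iv) set $a^{t+1}_{v\to u}=(1-\eta^t)a^t_{v\to u}+\eta^t\,\widetilde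 b^{t+1}_{v\to u}$. The message at time $t$ is $m^t_{v\to u}=\sum_{j=1}^r a^t_{v\to u;j}\phi_j$. **Cost model.** The functions $y\mapsto\langle\Gamma_{uv}(\cdot,y),\phi_j\rangle_{L^2}$ are precomputed at a fixed one-time cost that is not counted; each iteration costs $\mathcal{O}(rk)$ arithmetic operations per directed edge, with $k$ treated as a constant, i.e. $\mathcal{O}(r)$. *)

(* Defs.v *)
From HB Require Import structures.
From mathcomp Require Import all_boot all_order all_algebra.
From mathcomp Require Import all_classical all_reals all_analysis.

Set Implicit Arguments.
Unset Strict Implicit.
Unset Printing Implicit Defensive.

Import Order.TTheory GRing.Theory Num.Theory.
Import numFieldNormedType.Exports.

Local Open Scope classical_set_scope.
Local Open Scope ring_scope.

Definition borel (X : ptopologicalType) := g_sigma_algebraType (@open X).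

Section L2.
Context {d : measure_display} {X : measurableType d} {R : realType}.
Variable mu : {measure set X -> \bar R}.

Definition L2norm (f : X -> R) : R := fine ('N[mu]_2%:E[EFin \o f])%E.

Definition inner (f g : X -> R) : R := \int[mu]_x (f x * g x).

(* Elements of L^2 are represented by measurable functions; equality of
   densities is equality almost everywhere. *)
Definition prob_density (f : X -> R) : Prop :=
  [/\ f \in Lfun mu 2%:E, forall x, 0 <= f x & \int[mu]_x f x = 1].

Definition orthonormal_basis (phi : nat -> X -> R) : Prop :=
  [/\ forall j, phi j \in Lfun mu 2%:E,
      forall i j, inner (phi i) (phi j) = (i == j)%:R &
      forall f, f \in Lfun mu 2%:E ->
        (fun n => L2norm (fun x => f x - \sum_(j < n) inner f (phi j) * phi j x))
          @ \oo --> (0 : R)].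

Definition symmetric_kernel (K : X -> X -> R) : Prop :=
  forall x y, K x y = K y x.

Definition psd_kernel (K : X -> X -> R) : Prop :=
  forall n (x : 'I_n -> X) (c : 'I_n -> R),
    0 <= \sum_i \sum_j c i * c j * K (x i) (x j).

(* Indices are shifted by one: lam 0, lam 1, ... are the eigenvalues
   lambda_1 >= lambda_2 >= ... and phi 0, phi 1, ... the eigenfunctions. *)
Definition mercer_system (K : X -> X -> R) (lam : nat -> R)
    (phi : nat -> X -> R) : Prop :=
  [/\ forall j, 0 <= lam j,
      forall j, lam j.+1 <= lam j,
      orthonormal_basis phi,
      forall j x, \int[mu]_y (K x y * phi j y) = lam j * phi j x &
      forall x y, series (fun j => lam j * phi j x * phi j y) @ \oo --> K x y].

Definition trace_class (lam : nat -> R) : Prop := cvgn (series lam).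

End L2.

(* A directed edge v -> u is a pair of arguments v u with adj v u.  Messages are
   indexed as m v u; potentials, eigenvalues and eigenfunctions attached to the
   undirected edge (u,v) are indexed as psiE u v, lam u v, phi u v when used for
   the message v -> u. *)
Section BP.
Context {d : measure_display} {X : measurableType d} {R : realType}.
Variable mu : {measure set X -> \bar R}.
Context {V : finType}.
Variables (adj : rel V) (psiV : V -> X -> R) (psiE : V -> V -> X -> X -> R).

Definition neighbors (v : V) : {set V} := [set w | adj v w].

Definition feasible (m : V -> V -> X -> R) : Prop :=
  forall v u, adj v u -> prob_density mu (m v u).

Definition bp_integrand (m : V -> V -> X -> R) (v u : V) (x y : X) : R :=
  psiE u v x y * psiV v y * \prod_(w in neighbors v :\ u) m w v y.

(* The normalisation constant kappa exists.  This is not automatic on feasible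
   messages: a product of square integrable densities may fail to be
   integrable, or may vanish identically. *)
Definition bp_defined (m : V -> V -> X -> R) (v u : V) : Prop :=
  (0 < \int[mu]_x \int[mu]_y (bp_integrand m v u x y)%:E < +oo)%E.

Definition bp_update (m : V -> V -> X -> R) (v u : V) (x : X) : R :=
  (\int[mu]_x' \int[mu]_y bp_integrand m v u x' y)^-1 *
  \int[mu]_y bp_integrand m v u x y.

Definition bp_fixed_point (m : V -> V -> X -> R) : Prop :=
  feasible m /\
  forall v u, adj v u ->
    bp_defined m v u /\ ae_eq mu setT (bp_update m v u) (m v u).

(* When neighbors v :\ u is empty the right-hand side is 0, in accordance with
   the update being constant. *)
Definition bp_contractive (gamma : R) : Prop :=
  forall v u, adj v u ->
  forall m m', feasible m -> feasible m' ->
    bp_defined m v u -> bp_defined m' v u ->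
  L2norm mu (fun x => bp_update m v u x - bp_update m' v u x) <=
  (1 - gamma / 2) *
  Num.sqrt (#|neighbors v :\ u|%:R^-1 *
    \sum_(w in neighbors v :\ u) L2norm mu (fun x => m w v x - m' w v x) ^+ 2).

Definition beta (u v : V) (y : X) : R :=
  psiV v y * \int[mu]_x psiE u v x y.

Definition Gamma (u v : V) (x y : X) : R :=
  psiE u v x y * psiV v y / beta u v y.

Variables (phi : V -> V -> nat -> X -> R) (r k : nat) (eta : nat -> R).

(* y t v u i is the i-th sample drawn at time t for the directed edge v -> u. *)
Fixpoint sosmp_coef (y : nat -> V -> V -> 'I_k -> X) (t : nat) (v u : V)
    (j : nat) : R :=
  if t is s.+1 then
    (1 - eta s) * sosmp_coef y s v u j +
    eta s * (k%:R^-1 *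
      \sum_(i < k) inner mu (fun x => Gamma u v x (y s v u i)) (phi u v j))
  else r%:R^-1.

Definition sosmp_message (y : nat -> V -> V -> 'I_k -> X) (t : nat) (v u : V)
    (x : X) : R :=
  \sum_(j < r) sosmp_coef y t v u j * phi u v j x.

Definition sampling_weight (y : nat -> V -> V -> 'I_k -> X) (t : nat) (v u : V)
    (z : X) : R :=
  beta u v z *
  \prod_(w in neighbors v :\ u) Num.max 0 (sosmp_message y t w v z).

(* If the weight vanishes almost everywhere it determines no density; the
   samples are then drawn from the fallback distribution nu. *)
Definition sampling_law (nu : probability X R)
    (y : nat -> V -> V -> 'I_k -> X) (t : nat) (v u : V) (A : set X) : R :=
  let Z := \int[mu]_z sampling_weight y t v u z in
  if Z == 0 then fine (nu A)
  else (\int[mu]_(z in A) sampling_weight y t v u z) / Z.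

Context {d' : measure_display} {Omega : measurableType d'}.
Variables (P : probability Omega R) (nu : probability X R).

Definition history (Y : nat -> V -> V -> 'I_k -> Omega -> X) (t : nat) :
    set (set Omega) :=
  <<s [set B | exists s v u i (A : set X),
         [/\ (s < t)%N, adj v u, measurable A & B = Y s v u i @^-1` A]] >>.

Definition sample_path (Y : nat -> V -> V -> 'I_k -> Omega -> X) (omega : Omega) :
    nat -> V -> V -> 'I_k -> X :=
  fun t v u i => Y t v u i omega.

(* The last clause says that, conditionally on the past, the samples drawn at
   time t for all directed edges are independent, those of v -> u having the law
   sampling_law; a conditional law on a product is characterised by its values
   on rectangles.  The second clause requires the sampling weights to have
   finite mass, so that they can be normalised. *)
Definition sosmp_run (Y : nat -> V -> V -> 'I_k -> Omega -> X) : Prop :=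
  [/\ forall t v u i, adj v u -> measurable_fun setT (Y t v u i),
      forall t v u omega, adj v u ->
        mu.-integrable setT (EFin \o sampling_weight (sample_path Y omega) t v u) &
      forall t (B : set Omega) (A : V -> V -> 'I_k -> set X),
        history Y t B -> (forall v u i, measurable (A v u i)) ->
        P (B `&` [set omega | forall v u i, adj v u ->
                                A v u i (Y t v u i omega)]) =
        (\int[P]_(omega in B)
           (\prod_(e : V * V | adj e.1 e.2) \prod_(i < k)
              sampling_law nu (sample_path Y omega) t e.1 e.2 (A e.1 e.2 i))%:E)%E].

Definition accurate (Y : nat -> V -> V -> 'I_k -> Omega -> X)
    (mstar : V -> V -> X -> R) (t : nat) (delta : R) : Prop :=
  forall v u, adj v u ->
    ('E_P[fun omega =>
       (L2norm mu (fun x => sosmp_message (sample_path Y omega) t v u x - mstar v u x)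
         ^+ 2)%R] <= delta%:E)%E.

End BP.

Section Truncation.
Context {R : realType} {V : finType}.
Variables (adj : rel V) (lam : V -> V -> nat -> R).

Definition truncation_level (delta : R) (r : nat) : Prop :=
  (0 < r)%N /\ forall v u, adj v u -> lam u v r.-1 <= delta.

(* The least truncation level; the algorithm uses one number of coefficients
   for all edges, so the level must be admissible for each of them.  The
   default value 1 is irrelevant when the eigenvalues tend to 0. *)
Definition rstar (delta : R) : nat :=
  xget 1%N [set r | truncation_level delta r /\
    forall r', truncation_level delta r' -> (r <= r')%N].

End Truncation.

(* ops r is the number of arithmetic operations performed per directed edge in
   one iteration with r coefficients and k samples. *)
Definition linear_cost (k : nat) (ops : nat -> nat) : Prop :=
  exists c : nat, forall r, (ops r <= c * (r * k))%N.

(* Main.v *)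
Require Import Defs.
From HB Require Import structures.
From mathcomp Require Import all_boot all_order all_algebra.
From mathcomp Require Import all_classical all_reals all_analysis.
From mathcomp Require Import measurable_realfun ring lra.

(* Late iterates are, up to a remnant of order t^(-1/gamma) of the initial
   message, averages of truncated kernel sections, which are nearly normalised and bounded
   below.  A sampled message is therefore close in L^2 to the density obtained by
   normalising its positive part, and contractivity of BP applies to these densities.  The
   squared error d_t^2 of the coefficients, in expectation and maximised over the edges,
   satisfies, with step size 1/(gamma(t+1)),
     d_(t+1)^2 <= (1 - 1/(t+1)) d_t^2 + 2 d_t e_t/(gamma(t+1)) + O(1/(t+1)^2),
   so that d_t^2 = O(log t / t) up to a multiple of the truncation error.  The truncation
   error is at most delta/2 when lambda_r <= delta: the coefficients of a kernel section
   beyond r are controlled by lambda_r times a tail of Mercer's series on the diagonal, and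
   these tails are uniformly small by compactness.  Hence O(log(1/delta)/delta) iterations
   of cost O(r) suffice, and the sum of the squared eigenvalues is bounded below. *)

(** The number of coefficients grows as delta decreases, so every constant must be fixed before r,
    the probability space and the samples. Uniformity in r comes from Bessel's inequality for
    normalised kernel sections and from the initial coefficients 1/r, whose squares sum to 1/r. The
    bound lambda_r <= delta is used without loss: the squared truncation error is at most a constant
    times delta * tau, where tau bounds the Mercer tails and is chosen beforehand, small enough to
    absorb the constants. Truncated messages may be negative and are not normalised, whereas
    contractivity speaks of densities on which the update is defined; and the sampling law has a
    fallback branch. The key to both is that truncated sections are close to full ones uniformly,
    not merely in L^2: their averages are bounded below, and only the remnant can make a message
    negative. The rate rests on (1 - 2 eta) + 2 eta (1 - gamma/2) = 1 - eta gamma, which equals 1 -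
    1/(t+1), and on 1/gamma > 1/2: the remnant is then summable against t^(-1/2) and contributes
    only O(1/t). *)

Set Implicit Arguments.
Unset Strict Implicit.
Unset Printing Implicit Defensive.

Import Order.TTheory GRing.Theory Num.Theory.
Import numFieldNormedType.Exports.

Local Open Scope classical_set_scope.
Local Open Scope ring_scope.

(** * Square integrable functions *)

Section L2theory.
Context {d : measure_display} {T : measurableType d} {R : realType}.
Variable mu : {finite_measure set T -> \bar R}.
Implicit Types (f g h : T -> R).

Local Notation L2 := (Lfun mu 2%:E).
Local Notation intb f := (mu.-integrable setT (EFin \o f)).

Lemma Lfun2_measurable f : f \in L2 -> measurable_fun setT f.
Proof. by rewrite inE => /andP[]; rewrite inE. Qed.

Lemma Lfun2P f : f \in L2 <->
  measurable_fun setT f /\ intb (fun x => f x ^+ 2).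
Proof.
split=> [fL|[mf fi]]; first by split; [exact: Lfun2_measurable | exact: Lfun2_integrable_sqr].
rewrite inE; apply/andP; split; rewrite inE//= /finite_norm unlock poweR_lty//.
move/integrableP: fi => [_]; apply: le_lt_trans.
apply: ge0_le_integral => //.
- by move=> x _; rewrite lee_fin powR_ge0.
- apply/measurable_EFinP.
  by apply: (@measurableT_comp _ _ _ _ _ _ (@powR R ^~ 2)) => //; exact: measurableT_comp.
- by apply: measurableT_comp => //; apply/measurable_EFinP; exact: measurable_funX.
- by move=> x _; rewrite /= lee_fin normrX powR_mulrn.
Qed.

Lemma L2norm_ge0 f : 0 <= L2norm mu f.
Proof. by rewrite /L2norm fine_ge0// Lnorm_ge0. Qed.

(** The theorem speaks of [L2norm], while all estimates are made with [inner]; this is the passage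
    between them. *)
Lemma L2norm_sqr f : f \in L2 -> L2norm mu f ^+ 2 = inner mu f f.
Proof.
move=> /Lfun2P[mf /integrableP[_ fi]].
have fi' : (\int[mu]_x (`|f x| `^ 2)%:E < +oo)%E.
  move: fi; apply: le_lt_trans; apply: ge0_le_integral => //.
  - apply/measurable_EFinP => /=.
    by apply: (@measurableT_comp _ _ _ _ _ _ (@powR R ^~ 2)) => //; exact: measurableT_comp.
  - by apply/measurable_EFinP; apply: measurableT_comp => //; exact: measurable_funX.
  - by move=> x _; rewrite /= lee_fin normrX powR_mulrn.
have i0 : (0 <= \int[mu]_x (`|f x| `^ 2)%:E)%E.
  by apply: integral_ge0 => x _; rewrite lee_fin powR_ge0.
rewrite /L2norm unlock /inner /Rintegral.
have -> : (\int[mu]_x (f x * f x)%:E = \int[mu]_x (`|f x| `^ 2)%:E)%E.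
  by apply: eq_integral => x _; rewrite powR_mulrn// real_normK ?num_real// expr2.
have : (\int[mu]_x (`|f x| `^ 2)%:E \is a fin_num)%E by rewrite ge0_fin_numE.
rewrite /=; move: i0; case: (\int[mu]_x _)%E => //= a a0 _.
by rewrite -powR_mulrn ?powR_ge0// -powRrM mulVf// powRr1.
Qed.

Lemma integrable_mul f g : f \in L2 -> g \in L2 -> intb (fun x => f x * g x).
Proof. by move=> fL gL; apply/Lfun1_integrable; exact: Lfun2_mul_Lfun1. Qed.

Lemma Lfun2_integrable f : f \in L2 -> intb f.
Proof.
by move=> fL; apply/Lfun1_integrable; apply: Lfun_subset12 fL; exact: fin_num_measure.
Qed.

Lemma Lfun2_bounded f (M : R) : measurable_fun setT f ->
  (forall x, `|f x| <= M) -> f \in L2.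
Proof.
move=> mf fM; apply/Lfun2P; split=> //.
apply: (@le_integrable _ _ _ mu _ measurableT _ (EFin \o cst (M ^+ 2))) => //.
- by apply/measurable_EFinP; exact: measurable_funX.
- move=> x _ /=; rewrite lee_fin normrX [leRHS]ger0_norm ?sqr_ge0//.
  by rewrite lerXn2r// nnegrE (le_trans _ (fM x)).
- exact: finite_measure_integrable_cst.
Qed.

Lemma Lfun2D f g : f \in L2 -> g \in L2 -> f + g \in L2.
Proof. by case: (Lfun_addr_closed mu (lee1n 2)) => _; apply. Qed.

Lemma Lfun2Z a f : f \in L2 -> a *: f \in L2.
Proof.
by move=> fL; case: (Lfun_submod_closed mu (lee1n 2)) => L0 /(_ a f 0 fL L0); rewrite addr0.
Qed.

Lemma Lfun2B f g : f \in L2 -> g \in L2 -> f - g \in L2.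
Proof. by move=> fL gL; rewrite -(scaleN1r g) Lfun2D// Lfun2Z. Qed.

Lemma Lfun2_sum (I : Type) (s : seq I) (P : pred I) (F : I -> T -> R) :
  (forall i, F i \in L2) -> \sum_(i <- s | P i) F i \in L2.
Proof.
move=> FL; apply: (big_ind (fun f => f \in L2)) => //; last exact: Lfun2D.
by case: (Lfun_submod_closed mu (lee1n 2)).
Qed.

Lemma innerC f g : inner mu f g = inner mu g f.
Proof. by apply: eq_Rintegral => x _; rewrite mulrC. Qed.

Lemma innerDl f g h : f \in L2 -> g \in L2 -> h \in L2 ->
  inner mu (f + g) h = inner mu f h + inner mu g h.
Proof.
move=> fL gL hL; rewrite -RintegralD//; try exact: integrable_mul.
by apply: eq_Rintegral => x _; rewrite /= mulrDl.
Qed.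

Lemma innerZl a f g : f \in L2 -> g \in L2 ->
  inner mu (a *: f) g = a * inner mu f g.
Proof.
move=> fL gL; rewrite -RintegralZl//; last exact: integrable_mul.
by apply: eq_Rintegral => x _; rewrite /= -mulrA.
Qed.

Lemma innerBl f g h : f \in L2 -> g \in L2 -> h \in L2 ->
  inner mu (f - g) h = inner mu f h - inner mu g h.
Proof.
move=> fL gL hL; rewrite -(scaleN1r g) innerDl ?Lfun2Z// innerZl//.
by rewrite mulN1r.
Qed.

Lemma innerDr f g h : f \in L2 -> g \in L2 -> h \in L2 ->
  inner mu h (f + g) = inner mu h f + inner mu h g.
Proof. by move=> *; rewrite innerC innerDl// innerC (innerC g). Qed.

Lemma innerBr f g h : f \in L2 -> g \in L2 -> h \in L2 ->
  inner mu h (f - g) = inner mu h f - inner mu h g.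
Proof. by move=> *; rewrite innerC innerBl// innerC (innerC g). Qed.

Lemma innerZr a f g : f \in L2 -> g \in L2 ->
  inner mu g (a *: f) = a * inner mu g f.
Proof. by move=> *; rewrite innerC innerZl// innerC. Qed.

Lemma inner0l f : inner mu 0 f = 0.
Proof.
rewrite /inner (_ : (fun x => _) = cst 0) ?Rintegral_cst// ?mul0r//.
by apply/funext => x; rewrite /= mul0r.
Qed.

Lemma inner_suml (I : Type) (s : seq I) (F : I -> T -> R) g :
  (forall i, F i \in L2) -> g \in L2 ->
  inner mu (\sum_(i <- s) F i) g = \sum_(i <- s) inner mu (F i) g.
Proof.
move=> FL gL; elim: s => [|i s IH]; first by rewrite !big_nil inner0l.
by rewrite !big_cons innerDl ?IH// Lfun2_sum.
Qed.

Lemma inner_ge0 f : 0 <= inner mu f f.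
Proof. by apply: Rintegral_ge0 => x _; rewrite -expr2 sqr_ge0. Qed.

Lemma inner_le f g : f \in L2 -> g \in L2 -> (forall x, `|f x| <= `|g x|) ->
  inner mu f f <= inner mu g g.
Proof.
move=> fL gL fg; apply: le_Rintegral => //; try exact: integrable_mul.
move=> x _; rewrite -!expr2 -(real_normK (num_real (f x))).
by rewrite -(real_normK (num_real (g x))) lerXn2r// nnegrE.
Qed.

(** Expand the square of [f - a^-1 *: g] and multiply by [a]. It serves as a triangle inequality
    that is linear in the squared norms, so that expectations can be taken and [a] chosen
    afterwards. *)
Lemma inner_young (a : R) f g : 0 < a -> f \in L2 -> g \in L2 ->
  inner mu (f + g) (f + g) <= (1 + a) * inner mu f f + (1 + a^-1) * inner mu g g.
Proof.
move=> a0 fL gL.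
have sL : f - a^-1 *: g \in L2 by rewrite Lfun2B// Lfun2Z.
have := inner_ge0 (f - a^-1 *: g).
rewrite innerBl ?Lfun2Z// !innerBr ?Lfun2Z// !innerZl ?Lfun2Z//.
rewrite !innerZr ?Lfun2Z// (innerC g f) => H.
rewrite innerDl ?Lfun2D// !innerDr// (innerC g f).
have := ler_wpM2l (ltW a0) H; rewrite mulr0.
set A := inner _ f f; set B := inner _ f g; set C := inner _ g g.
have -> : a * (A - a^-1 * B - (a^-1 * B - a^-1 * (a^-1 * C))) =
  a * A - 2 * B + a^-1 * C by field; rewrite gt_eqF.
move=> {}H; lra.
Qed.

Lemma inner_CS f g : f \in L2 -> g \in L2 ->
  inner mu f g ^+ 2 <= inner mu f f * inner mu g g.
Proof.
move=> fL gL.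
have key (a : R) : 0 <= inner mu f f - 2 * a * inner mu f g + a ^+ 2 * inner mu g g.
  have := inner_ge0 (f - a *: g).
  rewrite innerBl ?Lfun2B ?Lfun2Z// !innerBr ?Lfun2Z// !innerZl ?Lfun2Z//.
  by rewrite !innerZr ?Lfun2Z// (innerC g f); lra.
have := inner_ge0 f; have := inner_ge0 g; move: key.
set A := inner _ f f; set B := inner _ f g; set C := inner _ g g => key C0 A0.
have [C1|/negP] := boolP (C == 0); last first.
  move/negP => C1.
  have {}C1 : 0 < C by rewrite lt_def C1.
  have := key (B / C).
  have -> : A - 2 * (B / C) * B + (B / C) ^+ 2 * C = (A * C - B ^+ 2) / C.
    by field; rewrite gt_eqF.
  by rewrite pmulr_lge0 ?invr_gt0// subr_ge0.
rewrite (eqP C1) mulr0.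
have [->|B0] := eqVneq B 0; first by rewrite expr0n.
(* With [C = 0] the quadratic is affine in [a], and this value of [a] makes it -1. *)
have := key ((A + 1) / (2 * B)).
rewrite (eqP C1) mulr0 addr0.
have -> : A - 2 * ((A + 1) / (2 * B)) * B = -1 by field.
by rewrite oppr_ge0 ler10.
Qed.

(** * Expansions in an orthonormal basis *)

Section orthonormal.
Variable phi : nat -> T -> R.
Hypothesis phiB : orthonormal_basis mu phi.

Lemma basis_Lfun j : phi j \in L2. Proof. by case: phiB. Qed.
Local Notation phiL := basis_Lfun.

Definition comb (r : nat) (a : nat -> R) : T -> R := \sum_(j < r) a j *: phi j.

Lemma combE r a x : comb r a x = \sum_(j < r) a j * phi j x.
Proof. by rewrite /comb fct_sumE. Qed.

Lemma comb_Lfun r a : comb r a \in L2.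
Proof. by apply: Lfun2_sum => i; rewrite Lfun2Z// phiL. Qed.

Lemma combB r a b : comb r a - comb r b = comb r (fun j => a j - b j).
Proof.
by rewrite /comb -sumrB; apply: eq_bigr => i _; rewrite scalerBl.
Qed.

Lemma combD r a b : comb r a + comb r b = comb r (fun j => a j + b j).
Proof.
by rewrite /comb -big_split/=; apply: eq_bigr => i _; rewrite scalerDl.
Qed.

Lemma combZ r c a : c *: comb r a = comb r (fun j => c * a j).
Proof.
by rewrite /comb scaler_sumr; apply: eq_bigr => i _; rewrite scalerA.
Qed.

Lemma inner_comb r a f : f \in L2 ->
  inner mu (comb r a) f = \sum_(j < r) a j * inner mu f (phi j).
Proof.
move=> fL; rewrite inner_suml// => [|i]; last by rewrite Lfun2Z// phiL.
by apply: eq_bigr => i _; rewrite innerZl ?phiL// innerC.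
Qed.

Lemma inner_comb_basis r a (j : 'I_r) : inner mu (comb r a) (phi j) = a j.
Proof.
case: phiB => _ on _; rewrite inner_comb ?phiL// (bigD1 j)//= on eqxx mulr1.
rewrite big1 ?addr0// => i /negbTE ij; rewrite on.
by rewrite eq_sym in ij; rewrite -val_eqE/= in ij; rewrite ij mulr0.
Qed.

Lemma inner_comb2 r a : inner mu (comb r a) (comb r a) = \sum_(j < r) a j ^+ 2.
Proof.
rewrite inner_comb ?comb_Lfun//; apply: eq_bigr => j _.
by rewrite inner_comb_basis expr2.
Qed.

Local Notation coef f := (fun j => inner mu f (phi j)).

(** Pythagoras: the error of the first [r] coefficients, which evolves with time, is separated from
    the tail of [f], which does not. *)
Lemma inner_sub_comb r a f : f \in L2 ->
  inner mu (comb r a - f) (comb r a - f) =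
  \sum_(j < r) (a j - inner mu f (phi j)) ^+ 2 +
  (inner mu f f - \sum_(j < r) inner mu f (phi j) ^+ 2).
Proof.
move=> fL; rewrite innerBl ?Lfun2B ?comb_Lfun// !innerBr ?comb_Lfun//.
rewrite (innerC f (comb r a)) inner_comb2 inner_comb//.
rewrite (_ : \sum_(j < r) (a j - _) ^+ 2 = \sum_(j < r) a j ^+ 2 -
  2 * (\sum_(j < r) a j * inner mu f (phi j)) + \sum_(j < r) inner mu f (phi j) ^+ 2).
  by ring.
by rewrite mulr_sumr -sumrN -!big_split/=; apply: eq_bigr => i _; ring.
Qed.

Lemma inner_sub_proj r f : f \in L2 ->
  inner mu (f - comb r (coef f)) (f - comb r (coef f)) =
  inner mu f f - \sum_(j < r) inner mu f (phi j) ^+ 2.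
Proof.
move=> fL; rewrite -opprB -scaleN1r innerZl ?innerZr ?Lfun2B ?Lfun2Z ?comb_Lfun//.
  rewrite inner_sub_comb// mulrA mulN1r opprK mul1r [X in X + _]big1 ?add0r//.
  by move=> i _; rewrite subrr expr0n.
by rewrite Lfun2B// comb_Lfun.
Qed.

Lemma bessel r f : f \in L2 ->
  \sum_(j < r) inner mu f (phi j) ^+ 2 <= inner mu f f.
Proof. by move=> fL; rewrite -subr_ge0 -inner_sub_proj// inner_ge0. Qed.

(** Completeness enters here: the partial sums of squared coefficients converge to the squared norm,
    so bounds on finite tail sums suffice. *)
Lemma proj_tail r f (e : R) : f \in L2 ->
  (forall N, \sum_(r <= j < N) inner mu f (phi j) ^+ 2 <= e) ->
  inner mu f f - \sum_(j < r) inner mu f (phi j) ^+ 2 <= e.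
Proof.
move=> fL fe; case: phiB => _ _ /(_ f fL) cv.
have {}cv : inner mu f f - \sum_(j < N) inner mu f (phi j) ^+ 2 @[N --> \oo] --> (0 : R).
  have -> : (fun N => inner mu f f - \sum_(j < N) inner mu f (phi j) ^+ 2) =
    (fun N => L2norm mu (fun x => f x - \sum_(j < N) inner mu f (phi j) * phi j x) ^+ 2).
    apply/funext => N; rewrite -inner_sub_proj//.
    have -> : (fun x => f x - \sum_(j < N) inner mu f (phi j) * phi j x) =
       f - comb N (coef f).
      by apply/funext => x; rewrite !fctE combE.
    by rewrite L2norm_sqr ?Lfun2B ?comb_Lfun.
  by rewrite -[X in _ --> X](mulr0 (0 : R)); exact: (cvgM cv cv).
apply/ler_addgt0Pr => eps eps0.
have /cvgr0_norm_lt /(_ eps eps0) [N _ HN] := cv.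
have {HN} := HN (maxn N r) (leq_maxl _ _) => /=.
have rN : (r <= maxn N r)%N by exact: leq_maxr.
move: (maxn N r) rN => M rM /ltr_normlW H.
have := fe M; rewrite -[\sum_(j < M) _](big_mkord xpredT (fun j => inner mu f (phi j) ^+ 2)) in H *.
rewrite (big_cat_nat (leq0n r) rM)/= big_mkord in H.
lra.
Qed.

End orthonormal.
End L2theory.

(** * Mercer kernels on a compact space *)

Section parametric_integrals.
Context {d1 d2 : measure_display} {T1 : measurableType d1}
  {T2 : measurableType d2} {R : realType}.
Variables (m1 : {finite_measure set T1 -> \bar R})
  (m2 : {finite_measure set T2 -> \bar R}).

(** The integral is the [fine] part of a difference of integrals of positive and negative parts,
    each measurable in [x] by Tonelli. Points where it diverges are covered by the same formula. *)
Lemma measurable_param_Rintegral (f : T1 * T2 -> R) (D : set T2) :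
  measurable D -> measurable_fun setT f ->
  measurable_fun setT (fun x => \int[m2]_(y in D) f (x, y)).
Proof.
move=> mD mf.
have -> : (fun x => \int[m2]_(y in D) f (x, y)) =
    (fun x => \int[m2]_y (f (x, y) * \1_D y)).
  apply/funext => x; rewrite Rintegral_mkcond; apply: eq_Rintegral => y _.
  by rewrite patchE indicE; case: (y \in D); rewrite ?mulr1 ?mulr0.
set g := fun z : T1 * T2 => (f z * \1_D z.2)%:E.
have mg : measurable_fun setT g.
  apply/measurable_EFinP; apply: measurable_funM => //.
  apply: (@measurableT_comp _ _ _ _ _ _ (\1_D : T2 -> R) _ snd) => //.
apply: (@measurableT_comp _ _ _ _ _ _ fine) => //.
have -> : (fun x => \int[m2]_y (f (x, y) * \1_D y)%:E)%E =
    (fun x => \int[m2]_y (g^\+ (x, y)) - \int[m2]_y (g^\- (x, y)))%E.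
  apply/funext => x; rewrite [LHS]integralE.
    by congr (_ - _)%E; apply: eq_integral => y _; rewrite ?(funeposE, funenegE).
apply: emeasurable_funB.
- apply: (@measurable_fun_fubini_tonelli_F _ _ _ _ _ m2 (g^\+)%E) => //.
  exact: measurable_funepos.
- apply: (@measurable_fun_fubini_tonelli_F _ _ _ _ _ m2 (g^\-)%E) => //.
  exact: measurable_funeneg.
Qed.

(** The weights are only integrable: in the applications [b] is a node potential times a product of
    messages, for which no bound is available. Boundedness of [H] supplies the domination. *)
Lemma bounded_kernel_Fubini (H : T1 -> T2 -> R) (a : T1 -> R) (b : T2 -> R) (B : R) :
  measurable_fun setT (fun z : T1 * T2 => H z.1 z.2) ->
  (forall x y, `|H x y| <= B) ->
  m1.-integrable setT (EFin \o a) -> m2.-integrable setT (EFin \o b) ->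
  \int[m1]_x (a x * \int[m2]_y (H x y * b y)) =
  \int[m2]_y (b y * \int[m1]_x (H x y * a x)).
Proof.
move=> mH HB ia ib.
have /measurable_EFinP ma := measurable_int _ ia.
have /measurable_EFinP mb := measurable_int _ ib.
pose f z := (a z.1 * (H z.1 z.2 * b z.2))%:E.
have mf : measurable_fun setT f.
  apply/measurable_EFinP; apply: measurable_funM.
    exact: (measurableT_comp ma measurable_fst).
  by apply: measurable_funM => //; exact: (measurableT_comp mb measurable_snd).
have iH1 x : m2.-integrable setT (fun y => (H x y * b y)%:E).
  apply: (@le_integrable _ _ _ m2 _ measurableT _ (fun y => (B * b y)%:E)) => //.
  - apply/measurable_EFinP; apply: measurable_funM => //.
    exact: (measurable_fun_pair2 x mH).
  - move=> y _ /=; rewrite lee_fin !normrM ler_wpM2r//.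
    by rewrite (le_trans (HB x y))// ler_norm.
  - by under eq_fun do rewrite EFinM; exact: integrableZl.
have iH2 y : m1.-integrable setT (fun x => (H x y * a x)%:E).
  apply: (@le_integrable _ _ _ m1 _ measurableT _ (fun x => (B * a x)%:E)) => //.
  - apply/measurable_EFinP; apply: measurable_funM => //.
    exact: (measurable_fun_pair1 y mH).
  - move=> x _ /=; rewrite lee_fin !normrM ler_wpM2r//.
    by rewrite (le_trans (HB x y))// ler_norm.
  - by under eq_fun do rewrite EFinM; exact: integrableZl.
have i_f : (m1 \x m2)%E.-integrable setT f.
  apply/integrable12ltyP => //.
  have nb : (\int[m2]_y (`|b y|)%:E < +oo)%E by case/integrableP : ib.
  have na : (\int[m1]_y (`|a y|)%:E < +oo)%E by case/integrableP : ia.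
  have nb0 : (0 <= \int[m2]_y (`|b y|)%:E)%E by apply: integral_ge0.
  have na0 : (0 <= \int[m1]_y (`|a y|)%:E)%E by apply: integral_ge0.
  have mna : measurable_fun setT (fun x => (`|a x|)%:E).
    by apply/measurable_EFinP; exact: measurableT_comp.
  have mnb : measurable_fun setT (fun x => (`|b x|)%:E).
    by apply/measurable_EFinP; exact: measurableT_comp.
  apply: (@le_lt_trans _ _
      (\int[m1]_x ((`|a x|)%:E * (`|B|%:E * \int[m2]_y (`|b y|)%:E)))%E).
    apply: ge0_le_integral => //.
    + by move=> x _; apply: integral_ge0.
    + apply: (@measurable_fun_fubini_tonelli_F _ _ _ _ _ m2 (abse \o f)) => //.
      exact: measurableT_comp.
    + by move=> z; exact: abse_ge0.
    + by apply: emeasurable_funM.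
    move=> x _.
    have -> : (`|a x|%:E * (`|B|%:E * \int[m2]_y `|b y|%:E) =
        \int[m2]_y (`|a x|%:E * (`|B|%:E * `|b y|%:E)))%E.
      by rewrite ge0_integralZl// 1?ge0_integralZl//; exact: emeasurable_funM.
    apply: ge0_le_integral => //.
    + apply: measurableT_comp => //; exact: (measurable_fun_pair2 x mf).
    + by do 2 apply: emeasurable_funM => //.
    move=> y _; rewrite /f/= -!EFinM lee_fin !normrM ler_wpM2l// ler_wpM2r//.
    by rewrite (le_trans (HB x y))// ler_norm.
  rewrite ge0_integralZr//; last by rewrite mule_ge0.
  by rewrite lte_mul_pinfty// ?ge0_fin_numE// lte_mul_pinfty.
have e1 x : (\int[m2]_y f (x, y) = (a x * \int[m2]_y (H x y * b y))%:E)%E.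
  rewrite EFinM fineK; last exact: integrable_fin_num.
  by rewrite -integralZl//; apply: eq_integral => y _; rewrite /f/= EFinM.
have e2 y : (\int[m1]_x f (x, y) = (b y * \int[m1]_x (H x y * a x))%:E)%E.
  rewrite EFinM fineK; last exact: integrable_fin_num.
  rewrite -integralZl//; apply: eq_integral => x _.
  by rewrite /f/= -EFinM; congr EFin; ring.
have := Fubini i_f.
under eq_integral do rewrite e1.
by under [in X in _ = X -> _]eq_integral do rewrite e2; rewrite /Rintegral => ->.
Qed.

End parametric_integrals.

Section compact_bounds.
Context {R : realType} {X : topologicalType}.
Hypotheses (cX : compact [set: X]) (x0 : X).

Lemma compact_max (f : X -> R) : continuous f -> exists M, forall x, f x <= M.
Proof.
move=> cf; have [||c _ cP] := @compact_EVT_max X R f setT _ cX.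
- by exists x0.
- exact: continuous_subspaceT.
- by exists (f c) => x; apply: cP; rewrite inE.
Qed.

Lemma compact_min (f : X -> R) : continuous f -> exists c, forall x, f c <= f x.
Proof.
move=> cf; have [||c _ cP] := @compact_EVT_min X R f setT _ cX.
- by exists x0.
- exact: continuous_subspaceT.
- by exists c => x; apply: cP; rewrite inE.
Qed.

End compact_bounds.

Section mercer.
Context {R : realType} {X : ptopologicalType}.
Variable mu : {finite_measure set (borel X) -> \bar R}.
Variables (K : borel X -> borel X -> R) (lam : nat -> R) (phi : nat -> borel X -> R).
Hypothesis cX : compact [set: X].
Hypothesis cK : continuous (fun z : X * X => K z.1 z.2).
Hypothesis mK : mercer_system mu K lam phi.

Lemma mercer_lam_ge0 j : 0 <= lam j. Proof. by case: mK. Qed.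

Lemma mercer_lam_le i j : (i <= j)%N -> lam j <= lam i.
Proof.
case: mK => _ + _ _ _ => dec /subnKC <-; elim: (j - i)%N => [|n]; first by rewrite addn0.
by rewrite addnS; apply: le_trans.
Qed.

Lemma mercer_basis : orthonormal_basis mu phi. Proof. by case: mK. Qed.

Lemma mercer_phi_measurable j : measurable_fun setT (phi j).
Proof. by apply: (@Lfun2_measurable _ _ _ mu); exact: (basis_Lfun mercer_basis). Qed.

Lemma mercer_cvg x y : (\sum_(0 <= j < n) lam j * phi j x * phi j y) @[n --> \oo] --> K x y.
Proof. by case: mK => _ _ _ _ /(_ x y). Qed.

(** Continuity gives measurability for the Borel sets of the product space, which may exceed the
    product sigma-algebra when [X] is not second countable. The partial sums of Mercer's series are
    measurable for the latter and converge pointwise. *)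
Lemma mercer_measurable : measurable_fun setT (fun z : borel X * borel X => K z.1 z.2).
Proof.
apply: (@measurable_fun_cvg _ _ _ _
  (fun n z => \sum_(0 <= j < n) lam j * phi j z.1 * phi j z.2)) => [n|z _]; last first.
  exact: mercer_cvg.
apply: measurable_sum => j; apply: measurable_funM; first apply: measurable_funM => //.
- exact: (measurableT_comp (mercer_phi_measurable j) measurable_fst).
- exact: (measurableT_comp (mercer_phi_measurable j) measurable_snd).
Qed.

Lemma mercer_bounded : (forall x y, 0 < K x y) ->
  exists c B : R, [/\ 0 < c, 0 < B & forall x y, c <= K x y <= B].
Proof.
move=> K0; have cXX : compact [set: X * X].
  by rewrite (_ : [set: X * X] = setT `*` setT); [exact: compact_setX|rewrite setXTT].
have [M HM] := compact_max cXX (point, point) cK; have [z0 Hz] := compact_min cXX (point, point) cK.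
exists (K z0.1 z0.2), M; split => //.
- exact: lt_le_trans (K0 _ _) (HM z0).
- by move=> x y; rewrite (Hz (x, y)) (HM (x, y)).
Qed.

(* The right-hand side is the squared distance of x and y in the feature space of K. *)
Lemma mercer_dist r N x y :
  \sum_(r <= j < N) lam j * (phi j x - phi j y) ^+ 2 <= K x x - 2 * K x y + K y y.
Proof.
pose u n := \sum_(0 <= j < n) lam j * (phi j x - phi j y) ^+ 2.
have cu : u @ \oo --> K x x - 2 * K x y + K y y.
  have -> : u = fun n => (\sum_(0 <= j < n) lam j * phi j x * phi j x)
     - 2 * (\sum_(0 <= j < n) lam j * phi j x * phi j y)
     + (\sum_(0 <= j < n) lam j * phi j y * phi j y).
    apply/funext => n; rewrite mulr_sumr -sumrN -!big_split/=.
    by apply: eq_bigr => j _; ring.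
  apply: cvgD; last exact: mercer_cvg.
  apply: cvgB; first exact: mercer_cvg.
  by apply: cvgMr; exact: mercer_cvg.
have du : nondecreasing_seq u.
  apply/nondecreasing_seqP => n; rewrite /u big_nat_recr//= lerDl.
  by rewrite mulr_ge0 ?mercer_lam_ge0 ?sqr_ge0.
have uN := nondecreasing_cvgn_le du (cvgP _ cu) (maxn r N).
rewrite (cvg_lim _ cu)// in uN; apply: le_trans uN.
have [rN|Nr] := leqP r N; last first.
  rewrite big_geq ?(ltnW Nr)//; apply: sumr_ge0 => j _.
  by rewrite mulr_ge0 ?mercer_lam_ge0 ?sqr_ge0.
rewrite /u (big_cat_nat (leq0n r) rN)/= lerDr.
by apply: sumr_ge0 => j _; rewrite mulr_ge0 ?mercer_lam_ge0 ?sqr_ge0.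
Qed.

Lemma mercer_diag_tail x (e : R) : 0 < e ->
  exists r0, forall r N, (r0 <= r)%N -> \sum_(r <= j < N) lam j * phi j x ^+ 2 <= e.
Proof.
move=> e0.
pose u n := \sum_(0 <= j < n) lam j * phi j x ^+ 2.
have cu : u @ \oo --> K x x.
  have -> : u = fun n => (\sum_(0 <= j < n) lam j * phi j x * phi j x).
    by apply/funext => n; apply: eq_bigr => j _; ring.
  exact: mercer_cvg.
have du : nondecreasing_seq u.
  apply/nondecreasing_seqP => n; rewrite /u big_nat_recr//= lerDl.
  by rewrite mulr_ge0 ?mercer_lam_ge0 ?sqr_ge0.
have := cu => /cvgrPdist_le /(_ e e0) [r0 _ Hr0].
exists r0 => r N r0r; have := Hr0 r r0r => /=.
have uN := nondecreasing_cvgn_le du (cvgP _ cu) (maxn r N).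
rewrite (cvg_lim _ cu)// in uN.
move=> /ler_normlW H.
have [rN|Nr] := leqP r N; last by rewrite big_geq ?(ltnW Nr)// ltW.
move: uN H; rewrite (maxn_idPr rN) /u (big_cat_nat (leq0n r) rN)/=; lra.
Qed.

(* By compactness it is enough to control the tails near a point x, where they are bounded
   by twice the tail at x plus twice [mercer_dist]. *)
Lemma mercer_uniform_tail (e : R) : 0 < e ->
  exists r0, forall r N x, (r0 <= r)%N -> \sum_(r <= j < N) lam j * phi j x ^+ 2 <= e.
Proof.
move=> e0.
pose P (r : nat) (x : X) := forall N, \sum_(r <= j < N) lam j * phi j x ^+ 2 <= e.
suff: \forall r \near \oo, [set: X] `<=` P r.
  by move=> [r0 _ H]; exists r0 => r N x r0r; exact: H.
move/compact_near_coveringP : cX; apply => x _.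
have [r0 Hr0] := mercer_diag_tail x (ltac:(by rewrite divr_gt0) : 0 < e / 4).
have e40 : 0 < e / 4 by rewrite divr_gt0.
have kx : (K x x - 2 * K x y + K y y) @[y --> (x : X)] --> K x x - 2 * K x x + K x x.
  have c1 : K x y @[y --> (x : X)] --> K x x.
    apply: (@cvg_comp _ _ _ (fun y : X => (x, y)) (fun z : X * X => K z.1 z.2) _ (nbhs (x, x))).
      by apply: cvg_pair; [exact: cvg_cst|exact: cvg_id].
    exact: (@cK (x, x)).
  have c2 : K y y @[y --> (x : X)] --> K x x.
    apply: (@cvg_comp _ _ _ (fun y : X => (y, y)) (fun z : X * X => K z.1 z.2) _ (nbhs (x, x))).
      by apply: cvg_pair; exact: cvg_id.
    exact: (@cK (x, x)).
  apply: cvgD => //; apply: cvgB; first exact: cvg_cst.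
  by apply: cvgMr.
move/cvgrPdist_le : kx => /(_ _ e40) nx.
exists ([set y : X | `|K x x - 2 * K x x + K x x - (K x x - 2 * K x y + K y y)| <= e / 4], [set r | (r0 <= r)%N]).
  by split => /=; [exact: nx | exists r0].
move=> [y r] [/= + r0r] N; rewrite distrC => /ler_normlW Hy.
have H1 := Hr0 r N r0r; have H2 := mercer_dist r N x y.
apply: (@le_trans _ _ (2 * (\sum_(r <= j < N) lam j * phi j x ^+ 2) +
   2 * (\sum_(r <= j < N) lam j * (phi j x - phi j y) ^+ 2))); last lra.
rewrite !mulr_sumr -big_split/=; apply: ler_sum => j _.
rewrite !(mulrCA 2) -mulrDr ler_wpM2l ?mercer_lam_ge0//.
have := sqr_ge0 (2 * phi j x - phi j y); rewrite !expr2; lra.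
Qed.

(** Off the diagonal, each product [phi j x * phi j y] is at most the mean of the two squares, so
    the diagonal tails control the whole remainder. *)
Lemma mercer_pointwise_tail (e : R) r :
  (forall N x, \sum_(r <= j < N) lam j * phi j x ^+ 2 <= e) ->
  forall x y, `|K x y - \sum_(0 <= j < r) lam j * phi j x * phi j y| <= e.
Proof.
move=> He x y.
apply/ler_addgt0Pr => eps eps0.
have /cvgrPdist_le /(_ eps eps0) [N0 _ HN] := @mercer_cvg x y.
have /= := HN (maxn N0 r) (leq_maxl _ _).
have rN : (r <= maxn N0 r)%N by exact: leq_maxr.
rewrite (big_cat_nat (leq0n r) rN)/=; move: (maxn N0 r) => N H.
have H2 : `|\sum_(r <= j < N) lam j * phi j x * phi j y| <= e.
  have /andP[Hx Hy] : (\sum_(r <= j < N) lam j * phi j x ^+ 2 <= e) &&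
     (\sum_(r <= j < N) lam j * phi j y ^+ 2 <= e) by rewrite !He.
  apply: (le_trans (ler_norm_sum _ _ _)).
  apply: (@le_trans _ _ (2^-1 * (\sum_(r <= j < N) lam j * phi j x ^+ 2) +
     2^-1 * (\sum_(r <= j < N) lam j * phi j y ^+ 2))); last lra.
  rewrite !mulr_sumr -big_split/=; apply: ler_sum => j _.
  rewrite -mulrA normrM ger0_norm ?mercer_lam_ge0// !(mulrCA 2^-1) -mulrDr.
  rewrite ler_wpM2l ?mercer_lam_ge0// ler_norml.
  have := sqr_ge0 (phi j x - phi j y); have := sqr_ge0 (phi j x + phi j y).
  by rewrite !expr2 => ? ?; apply/andP; split; lra.
move: H H2; rewrite !ler_norml => /andP[? ?] /andP[? ?]; apply/andP; split; lra.
Qed.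
End mercer.

(** * Normalised kernels *)

Section weights.
Context {d : measure_display} {T : measurableType d} {R : realType}.
Variable mu : {measure set T -> \bar R}.
Implicit Types (f g h : T -> R).
Local Notation intb f := (mu.-integrable setT (EFin \o f)).

Lemma integrableZ_EFin a f : intb f -> intb (fun x => a * f x).
Proof. by move=> i_f; exact: (integrableZl measurableT a i_f). Qed.

Lemma integrableD_EFin f g : intb f -> intb g -> intb (fun x => f x + g x).
Proof. by move=> i_f ig; exact: (integrableD measurableT i_f ig). Qed.

Lemma integrable_sum_EFin (I : Type) (s : seq I) (F : I -> T -> R) :
  (forall i, intb (F i)) -> intb (fun x => \sum_(i <- s) F i x).
Proof.
move=> iF; have := @integrable_sum _ _ _ mu _ measurableT I s xpredT
  (fun i => EFin \o F i) (fun i _ => iF i).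
by congr (_.-integrable _ _); apply/funext => x; rewrite /= sumEFin.
Qed.

Lemma measurable_funV_gt0 f : measurable_fun setT f -> (forall x, 0 < f x) ->
  measurable_fun setT (fun x => (f x)^-1).
Proof.
move=> mf f0.
rewrite (_ : (fun x => _) = (@powR R ^~ (-1)) \o f); last first.
  by apply/funext => x; rewrite /= powR_inv1// ltW.
exact: measurableT_comp.
Qed.

Lemma integrable_bounded_mul f g (M : R) : measurable_fun setT f ->
  (forall x, `|f x| <= M) -> intb g -> intb (fun x => f x * g x).
Proof.
move=> mf fM ig; have /measurable_EFinP mg := measurable_int _ ig.
apply: (@le_integrable _ _ _ mu _ measurableT _ (fun y => (M * g y)%:E)) => //.
- by apply/measurable_EFinP; exact: measurable_funM.
- move=> x _ /=; rewrite lee_fin !normrM ler_wpM2r//.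
  by rewrite (le_trans (fM x))// ler_norm.
- exact: integrableZ_EFin.
Qed.

Lemma Rintegral_sum (I : Type) (s : seq I) (F : I -> T -> R) :
  (forall i, intb (F i)) ->
  \int[mu]_x (\sum_(i <- s) F i x) = \sum_(i <- s) \int[mu]_x F i x.
Proof.
move=> iF; elim: s => [|i s IH].
  rewrite big_nil; under eq_Rintegral do rewrite big_nil.
  by rewrite /Rintegral integral0.
rewrite big_cons -IH -RintegralD//.
  by apply: eq_Rintegral => x _; rewrite big_cons.
exact: integrable_sum_EFin.
Qed.

(** The variance of [f] under the density [q] is nonnegative. *)
Lemma weighted_jensen_sqr f q (M : R) : measurable_fun setT f ->
  (forall x, `|f x| <= M) -> intb q -> (forall x, 0 <= q x) ->
  \int[mu]_x q x = 1 ->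
  (\int[mu]_x (f x * q x)) ^+ 2 <= \int[mu]_x (f x ^+ 2 * q x).
Proof.
move=> mf fM iq q0 q1; set m := \int[mu]_x (f x * q x).
have i1 : intb (fun x => f x * q x) by exact: integrable_bounded_mul iq.
have i2 : intb (fun x => f x ^+ 2 * q x).
  apply: (@integrable_bounded_mul _ _ (M ^+ 2)) => //; first exact: measurable_funX.
  move=> x; rewrite normrX lerXn2r// nnegrE//.
  by rewrite (le_trans _ (fM x)).
have : 0 <= \int[mu]_x ((f x - m) ^+ 2 * q x).
  by apply: Rintegral_ge0 => x _; rewrite mulr_ge0 ?sqr_ge0.
have -> : \int[mu]_x ((f x - m) ^+ 2 * q x) =
    \int[mu]_x (f x ^+ 2 * q x + ((- (2 * m)) * (f x * q x) + m ^+ 2 * q x)).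
  by apply: eq_Rintegral => x _; ring.
have i3 : intb (fun x => (- (2 * m)) * (f x * q x)).
  exact: integrableZ_EFin.
have i4 : intb (fun x => m ^+ 2 * q x).
  exact: integrableZ_EFin.
rewrite RintegralD//; last first.
  exact: integrableD_EFin.
rewrite RintegralD// !RintegralZl// q1 -/m; lra.
Qed.
End weights.

Section kernel.
Context {R : realType} {X : ptopologicalType}.
Variable mu : {finite_measure set (borel X) -> \bar R}.
Variables (K : borel X -> borel X -> R) (lam : nat -> R) (phi : nat -> borel X -> R).
Hypothesis mK : mercer_system mu K lam phi.
Hypothesis sK : symmetric_kernel K.
Variables (c B : R).
Hypothesis (c0 : 0 < c) (KB : forall x y, c <= K x y <= B).
Local Notation L2 := (Lfun mu 2%:E).
Local Notation M0 := (fine (mu setT)).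
Let phiB := mercer_basis mK.
Let phiL := basis_Lfun phiB.
Let mphi := mercer_phi_measurable mK.

(** For a null measure all inner products vanish, against the normalisation of [phi 0]. *)
Lemma mass_gt0 : 0 < M0.
Proof.
rewrite lt_def fine_ge0// andbT; apply/negP => /eqP M0.
have m0 : mu setT = 0%E by rewrite -[LHS]fineK ?M0// fin_num_measure.
case: phiB => _ /(_ 0%N 0%N) + _; rewrite /inner /Rintegral null_set_integral//.
  by move=> /= /eqP; rewrite eq_sym oner_eq0.
by apply/measurable_EFinP; apply: measurable_funM.
Qed.

Let M00 := mass_gt0.

Lemma B_gt0 : 0 < B.
Proof. by have /andP[/(lt_le_trans c0)] := KB point point; apply: lt_le_trans. Qed.

Let mKl x : measurable_fun setT (K x).
Proof. exact: (measurable_fun_pair2 x (mercer_measurable mK)). Qed.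

Let mKr y : measurable_fun setT (K ^~ y).
Proof. exact: (measurable_fun_pair1 y (mercer_measurable mK)). Qed.

Let KN x y : `|K x y| <= B.
Proof.
by have /andP[h ?] := KB x y; rewrite ger0_norm// (le_trans _ h)// ltW.
Qed.

Let intc a : mu.-integrable setT (EFin \o (cst a : borel X -> R)).
Proof. exact: finite_measure_integrable_cst. Qed.

Let iKr y : mu.-integrable setT (EFin \o (K ^~ y)).
Proof. by apply: Lfun2_integrable; apply: Lfun2_bounded. Qed.

Definition kmass (y : borel X) : R := \int[mu]_x K x y.

Lemma kmass_bounds y : c * M0 <= kmass y <= B * M0.
Proof.
rewrite -!(@Rintegral_cst _ _ _ mu setT)//; apply/andP; split;
  apply: le_Rintegral => //; try exact: intc; move=> x _; by have /andP[] := KB x y.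
Qed.

Let cM0 : 0 < c * M0. Proof. by rewrite mulr_gt0. Qed.

Lemma kmass_gt0 y : 0 < kmass y.
Proof. by have /andP[+ _] := kmass_bounds y; apply: lt_le_trans. Qed.

Lemma kmass_measurable : measurable_fun setT kmass.
Proof.
rewrite (_ : kmass = fun y => \int[mu]_x K y x); last first.
  by apply/funext => y; apply: eq_Rintegral => x _; rewrite sK.
exact: (@measurable_param_Rintegral _ _ (borel X) (borel X) R mu
  (fun z => K z.1 z.2) setT measurableT (mercer_measurable mK)).
Qed.

Lemma kmass_norm y : `|kmass y| <= B * M0.
Proof. by have /andP[_] := kmass_bounds y; rewrite ger0_norm// ltW// kmass_gt0. Qed.

(** This is [Gamma] for one edge: the node potential cancels between its numerator and [beta]. *)
Definition nker (x y : borel X) : R := K x y / kmass y.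

Lemma nker_bounds x y : c / (B * M0) <= nker x y <= B / (c * M0).
Proof.
have /andP[z1 z2] := kmass_bounds y; have /andP[k1 k2] := KB x y.
have B0 := B_gt0; have z0 := kmass_gt0 y.
apply/andP; split.
  apply: ler_pM => //; first exact: ltW.
    by rewrite invr_ge0 ltW// mulr_gt0.
  by rewrite lef_pV2// posrE mulr_gt0.
apply: ler_pM => //; first exact: le_trans (ltW c0) k1.
  by rewrite invr_ge0 ltW.
by rewrite lef_pV2.
Qed.

Lemma nker_Lfun y : (nker ^~ y) \in L2.
Proof.
apply: (@Lfun2_bounded _ _ _ _ _ (B / (c * M0))).
  by apply: measurable_funM.
move=> x; have /andP[h ?] := nker_bounds x y; rewrite ger0_norm//.
by rewrite (le_trans _ h)// divr_ge0 ?mulr_ge0 ?ltW// B_gt0.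
Qed.

Lemma nker_int y : \int[mu]_x nker x y = 1.
Proof. by rewrite RintegralZr// -/(kmass y) divff// gt_eqF// kmass_gt0. Qed.

Definition kcoef (j : nat) (y : borel X) : R := lam j * phi j y / kmass y.

Lemma inner_ker j y : \int[mu]_x (K x y * phi j x) = lam j * phi j y.
Proof.
case: mK => _ _ _ + _ => <-; apply: eq_Rintegral => x _; by rewrite sK.
Qed.

Lemma kcoefE j y : inner mu (nker ^~ y) (phi j) = kcoef j y.
Proof.
rewrite /kcoef -inner_ker -RintegralZr//; last first.
  by apply: integrable_bounded_mul => //; exact: Lfun2_integrable.
by apply: eq_Rintegral => x _; rewrite /nker mulrAC.
Qed.

Lemma kcoef_measurable j : measurable_fun setT (kcoef j).
Proof.
apply: measurable_funM; first exact: measurable_funM.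
exact: measurable_funV_gt0 kmass_measurable kmass_gt0.
Qed.

Definition kbound : R := (B / (c * M0)) ^+ 2 * M0.

Lemma nker_inner_le y : inner mu (nker ^~ y) (nker ^~ y) <= kbound.
Proof.
rewrite /kbound -(@Rintegral_cst _ _ _ mu setT)//; apply: le_Rintegral => //.
- by apply: integrable_mul; exact: nker_Lfun.
- exact: intc.
- move=> x _; have /andP[h1 h2] := nker_bounds x y.
  have n0 : 0 <= nker x y.
    by rewrite (le_trans _ h1)// divr_ge0 ?mulr_ge0 ?ltW// B_gt0.
  by rewrite expr2 ler_pM.
Qed.

(** The right-hand side does not involve [r]; the uniformity of all later constants in the number of
    coefficients rests on this. *)
Lemma kcoef_bessel r y : \sum_(j < r) kcoef j y ^+ 2 <= kbound.
Proof.
apply: (le_trans _ (nker_inner_le y)).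
under eq_bigr do rewrite -kcoefE.
by apply: bessel => //; exact: nker_Lfun.
Qed.

Lemma kcoef_norm j y : `|kcoef j y| <= Num.sqrt kbound.
Proof.
rewrite -sqrtr_sqr ler_sqrt.
  apply: le_trans (kcoef_bessel j.+1 y).
  rewrite big_ord_recr/= lerDr; apply: sumr_ge0 => i _; exact: sqr_ge0.
by rewrite mulr_ge0 ?sqr_ge0 ?ltW.
Qed.

(** Of the two factors [lam j] in the squared coefficient one is bounded by [e], and the other stays
    with [phi j y ^+ 2] to form a Mercer tail. The product [e * t] leaves [t] free to absorb
    constants. *)
Lemma kcoef_tail r (e t : R) : lam r <= e ->
  (forall N x, \sum_(r <= j < N) lam j * phi j x ^+ 2 <= t) ->
  forall N y, \sum_(r <= j < N) kcoef j y ^+ 2 <= e * t / (c * M0) ^+ 2.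
Proof.
move=> le ht N y; have /andP[z1 _] := kmass_bounds y; have z0 := kmass_gt0 y.
have t0 : 0 <= t by apply: le_trans (ht 0%N y); rewrite big_geq.
have e0 : 0 <= e by apply: le_trans le; exact: (mercer_lam_ge0 mK).
apply: (@le_trans _ _ (e / (c * M0) ^+ 2 * \sum_(r <= j < N) lam j * phi j y ^+ 2)).
  rewrite mulr_sumr; apply: ler_sum_nat => j /andP[rj _].
  have lj : lam j <= e by apply: le_trans le; exact: (mercer_lam_le mK).
  have lj0 : 0 <= lam j by exact: (mercer_lam_ge0 mK).
  have -> : kcoef j y ^+ 2 = (lam j / kmass y ^+ 2) * (lam j * phi j y ^+ 2).
    by rewrite /kcoef; field; rewrite gt_eqF.
  apply: ler_wpM2r; first by rewrite mulr_ge0 ?sqr_ge0.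
  apply: ler_pM => //; first by rewrite invr_ge0 sqr_ge0.
  by rewrite lef_pV2 ?posrE ?exprn_gt0// lerXn2r// nnegrE ltW.
by rewrite [leRHS]mulrAC; apply: ler_wpM2l => //; rewrite divr_ge0 ?sqr_ge0.
Qed.

(** Uniform in [x] and [y], where an L^2 estimate would not do: this is what bounds truncated
    sections from below. *)
Lemma nker_pointwise_tail r (t : R) :
  (forall N x, \sum_(r <= j < N) lam j * phi j x ^+ 2 <= t) ->
  forall x y, `|nker x y - comb phi r (kcoef ^~ y) x| <= t / (c * M0).
Proof.
move=> ht x y; have /andP[z1 _] := kmass_bounds y; have z0 := kmass_gt0 y.
have t0 : 0 <= t by apply: le_trans (ht 0%N y); rewrite big_geq.
have -> : nker x y - comb phi r (kcoef ^~ y) x =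
    (K x y - \sum_(0 <= j < r) lam j * phi j x * phi j y) / kmass y.
  rewrite combE mulrBl big_mkord; congr (_ - _).
  by rewrite mulr_suml; apply: eq_bigr => j _; rewrite /kcoef; ring.
rewrite normrM; apply: ler_pM => //; first exact: (mercer_pointwise_tail mK).
by rewrite gtr0_norm ?invr_gt0// lef_pV2// posrE.
Qed.

(** A full section has mass 1, so the defect is the inner product of the truncation error with the
    constant 1, and Cauchy-Schwarz applies. *)
Lemma comb_nker_mass r (e : R) :
  (forall N y, \sum_(r <= j < N) kcoef j y ^+ 2 <= e) ->
  forall y, (\int[mu]_x comb phi r (kcoef ^~ y) x - 1) ^+ 2 <= e * M0.
Proof.
move=> he y.
have cL : comb phi r (kcoef ^~ y) \in L2 by exact: comb_Lfun.
have nL := nker_Lfun y.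
have oneL : (cst 1 : borel X -> R) \in L2 by exact: Lfun_cst.
have -> : \int[mu]_x comb phi r (kcoef ^~ y) x - 1 =
   inner mu (comb phi r (kcoef ^~ y) - (nker ^~ y)) (cst 1).
  rewrite -[X in _ - X = _](nker_int y) innerBl// /inner; congr (_ - _);
  by apply: eq_Rintegral => x _; rewrite /cst mulr1.
apply: (le_trans (inner_CS _ _)) => //; first exact: Lfun2B.
apply: ler_pM; rewrite ?inner_ge0//.
  rewrite inner_sub_comb// [X in X + _]big1 ?add0r; last first.
    by move=> i _; rewrite kcoefE subrr expr0n.
  apply: proj_tail => // N; apply: le_trans (he N y).
  by under eq_bigr do rewrite kcoefE.
rewrite /inner (_ : (fun x => _) = cst 1) ?Rintegral_cst// ?mul1r//.
by apply/funext => x; rewrite /= mulr1.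
Qed.

Section average.
Variable g : borel X -> R.
Hypotheses (mg : measurable_fun setT g) (g0 : forall y, 0 <= g y)
  (ig : mu.-integrable setT (EFin \o g)).
Let I := \int[mu]_y (kmass y * g y).
Hypothesis I0 : 0 < I.

(** The BP update, with [g] the node potential times the incoming messages. Since
    [K x y = nker x y * kmass y], it averages normalised sections under the density proportional to
    [kmass y * g y], which is the law the algorithm samples from. *)
Definition kavg (x : borel X) : R := I^-1 * \int[mu]_y (K x y * g y).

Let izg : mu.-integrable setT (EFin \o (fun y => kmass y * g y)).
Proof.
by apply: integrable_bounded_mul ig; [exact: kmass_measurable|exact: kmass_norm].
Qed.

Lemma kavg_measurable : measurable_fun setT kavg.
Proof.
apply: measurable_funM => //.
have := @measurable_param_Rintegral _ _ (borel X) (borel X) R mu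
  (fun z => K z.1 z.2 * g z.2) setT measurableT.
apply; apply: measurable_funM; first exact: (mercer_measurable mK).
exact: (measurableT_comp mg measurable_snd).
Qed.

Lemma kavg_int : \int[mu]_x \int[mu]_y (K x y * g y) = I.
Proof.
have := @bounded_kernel_Fubini _ _ _ _ R mu mu K (cst 1) g B (mercer_measurable mK)
  KN (intc 1) ig.
under eq_Rintegral do rewrite mul1r.
move=> ->; apply: eq_Rintegral => y _; rewrite mulrC; congr (_ * _).
by apply: eq_Rintegral => x _; rewrite mulr1.
Qed.

(** [K x y] is at most a constant times [kmass y], so the quotient is bounded whatever integrable
    weight [g] is. Hence updates lie in L^2 even when the product of messages is merely
    integrable. *)
Lemma kavg_norm x : `|kavg x| <= B / (c * M0).
Proof.
have ik : mu.-integrable setT (EFin \o (fun y => K x y * g y)).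
  exact: integrable_bounded_mul ig.
rewrite ger0_norm; last first.
  rewrite mulr_ge0 ?invr_ge0 ?(ltW I0)//; apply: Rintegral_ge0 => y _.
  by rewrite mulr_ge0// (le_trans (ltW c0))//; have /andP[] := KB x y.
rewrite /kavg mulrC ler_pdivrMr// -RintegralZl//; apply: le_Rintegral => //.
  exact: integrableZ_EFin.
move=> y _; rewrite mulrA; apply: ler_wpM2r => //.
have /andP[_ kB] := KB x y; have /andP[z1 _] := kmass_bounds y.
by apply: (le_trans kB); rewrite mulrAC ler_pdivlMr// ler_wpM2l// ltW// B_gt0.
Qed.

Lemma kavg_Lfun : kavg \in L2.
Proof. exact: Lfun2_bounded kavg_measurable kavg_norm. Qed.

(** This is the unbiasedness of the algorithm: the mean of [kcoef j] under the sampling density is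
    the coefficient of the BP update. *)
Lemma kavg_coef j :
  inner mu kavg (phi j) = \int[mu]_y (kcoef j y * (I^-1 * (kmass y * g y))).
Proof.
have := @bounded_kernel_Fubini _ _ _ _ R mu mu K (phi j) g B (mercer_measurable mK)
  KN (Lfun2_integrable (phiL j)) ig.
move=> /(congr1 (fun a => I^-1 * a)); rewrite -!RintegralZl//; last first.
- rewrite (_ : (fun x => _) = (fun x => phi j x * (I *: kavg) x)).
    by apply: integrable_mul => //; rewrite Lfun2Z// kavg_Lfun.
  apply/funext => x.
  have -> : (I *: kavg) x = I * (I^-1 * \int[mu]_y (K x y * g y)) by [].
  by rewrite mulVKf// gt_eqF.
- rewrite (_ : (fun x => _) = (fun y => kcoef j y * (kmass y * g y))).
    apply: integrable_bounded_mul izg; [exact: kcoef_measurable|exact: kcoef_norm].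
  by apply/funext => y; rewrite inner_ker /kcoef; field; rewrite gt_eqF// kmass_gt0.
move=> H; transitivity (\int[mu]_x (I^-1 * (phi j x * \int[mu]_y (K x y * g y)))).
  by apply: eq_Rintegral => x _; rewrite /kavg; ring.
rewrite H; apply: eq_Rintegral => y _; rewrite inner_ker /kcoef.
by field; rewrite !gt_eqF// kmass_gt0.
Qed.

(** By Jensen's inequality the squared tail of an average is at most the average of the squared
    tails. *)
Lemma kavg_tail r (e : R) :
  (forall N y, \sum_(r <= j < N) kcoef j y ^+ 2 <= e) ->
  forall N, \sum_(r <= j < N) inner mu kavg (phi j) ^+ 2 <= e.
Proof.
move=> he N; pose q y := I^-1 * (kmass y * g y).
have iq : mu.-integrable setT (EFin \o q).
  exact: integrableZ_EFin.
have q0 y : 0 <= q y by rewrite mulr_ge0 ?invr_ge0 ?(ltW I0)// mulr_ge0// ltW// kmass_gt0.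
have q1 : \int[mu]_y q y = 1 by rewrite RintegralZl// mulVf// gt_eqF.
have ikq j : mu.-integrable setT (EFin \o (fun y => kcoef j y ^+ 2 * q y)).
  apply: (@integrable_bounded_mul _ _ _ _ _ _ (Num.sqrt kbound ^+ 2)) iq.
    by apply: measurable_funX; exact: kcoef_measurable.
  by move=> y; rewrite normrX lerXn2r// ?nnegrE ?sqrtr_ge0// kcoef_norm.
apply: (@le_trans _ _ (\sum_(r <= j < N) \int[mu]_y (kcoef j y ^+ 2 * q y))).
  apply: ler_sum => j _; rewrite kavg_coef.
  apply: (@weighted_jensen_sqr _ _ _ _ _ _ (Num.sqrt kbound)) => //.
    exact: kcoef_measurable.
  exact: kcoef_norm.
rewrite -Rintegral_sum//.
have -> : e = \int[mu]_y (e * q y) by rewrite RintegralZl// q1 mulr1.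
apply: le_Rintegral => //; last by move=> y _; rewrite -mulr_suml ler_wpM2r.
  exact: integrable_sum_EFin.
exact: integrableZ_EFin.
Qed.

End average.
End kernel.

(** * Conditional expectations *)

Definition bounded_measurable {d} {T : measurableType d} {R : realType} (f : T -> R) :=
  measurable_fun setT f /\ exists M, forall x, `|f x| <= M.

Section functional.
Context {d : measure_display} {T : measurableType d} {R : realType}.
Variables (I : (T -> R) -> R) (C : R).
Hypothesis C0 : 0 <= C.
Hypothesis Ilin : forall a f g, bounded_measurable f -> bounded_measurable g ->
  I (fun x => a * f x + g x) = a * I f + I g.
Hypothesis Ibd : forall f M, bounded_measurable f -> (forall x, `|f x| <= M) ->
  `|I f| <= C * M.
Hypothesis Iind : forall A, measurable A -> I \1_A = 0.

Lemma bounded_measurable_indic (A : set T) : measurable A ->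
  bounded_measurable (\1_A : T -> R).
Proof.
move=> mA; split; first exact: measurable_indic.
by exists 1 => x; rewrite indicE; case: (_ \in _); rewrite ?normr1 ?normr0.
Qed.

(* Subtracting half of the upper bound on the set where f exceeds it does not change [I f]. *)
Let halve n f (L : R) : bounded_measurable f -> (forall x, 0 <= f x <= L) ->
  exists2 g, bounded_measurable g /\ (forall x, 0 <= g x <= L / 2 ^+ n) & I g = I f.
Proof.
move=> bf f0; elim: n => [|n [g [bg g0] <-]]; first by exists f; rewrite ?expr0 ?divr1.
set a := L / 2 ^+ n.+1; pose A := g @^-1` `[a, +oo[.
have mA : measurable A by rewrite /A -[_ @^-1` _]setTI; apply: bg.1.
have bA := bounded_measurable_indic mA.
have aE : L / 2 ^+ n = a + a by rewrite /a exprS; field; rewrite expf_neq0.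
exists (fun x => (- a) * \1_A x + g x); last by rewrite Ilin// Iind// mulr0 add0r.
have h x : 0 <= - a * \1_A x + g x <= a.
  have /andP[g1] := g0 x; rewrite aE indicE => g2.
  have [|] := boolP (x \in A).
    rewrite inE /A/= in_itv/= andbT => ag.
    by rewrite mulr1; apply/andP; split; lra.
  rewrite mulr0 add0r g1/= => /negP; rewrite inE /A/= in_itv/= andbT => /negP.
  by rewrite -ltNge => /ltW.
split=> //; split.
  apply: measurable_funD; last exact: bg.1.
  by apply: measurable_funM => //; exact: bA.1.
by exists a => x; have /andP[? ?] := h x; rewrite ger0_norm.
Qed.

(** For nonnegative [f], repeated halving replaces [f] by functions of arbitrarily small supremum
    with the same value of [I], and [I] is bounded for the supremum norm. *)
Lemma functional_eq0 f : bounded_measurable f -> I f = 0.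
Proof.
have pos g (L : R) : bounded_measurable g -> (forall x, 0 <= g x <= L) -> I g = 0.
  move=> bg g0; apply/normr0_eq0/eqP; rewrite eq_le normr_ge0 andbT.
  apply/ler_addgt0Pr => e e0; rewrite add0r.
  have L0 : 0 <= L by have /andP[] := g0 point; exact: le_trans.
  have [n Hn] : exists n, C * L <= e * 2 ^+ n.
    have [m Hm] : exists m : nat, C * L / e <= m%:R.
      by exists (Num.bound (C * L / e)); rewrite ltW// archi_boundP// divr_ge0 ?mulr_ge0// ltW.
    exists m; rewrite [leRHS]mulrC -ler_pdivrMr//; apply: (le_trans Hm).
    by rewrite -natrX ler_nat ltnW// ltn_expl.
  have [h [bh h0] <-] := halve n bg g0.
  apply: (@le_trans _ _ (C * (L / 2 ^+ n))).
    by apply: Ibd => // x; have /andP[? ?] := h0 x; rewrite ger0_norm.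
  by rewrite mulrA ler_pdivrMr// exprn_gt0.
move=> bf; have [M fM] := bf.2.
have b1 : bounded_measurable (\1_setT : T -> R) by exact: bounded_measurable_indic.
(* Adding the constant [M], which [I] ignores, reduces to a nonnegative function. *)
have := Ilin M b1 bf; rewrite Iind// mulr0 add0r => <-.
apply: (pos _ (M + M)).
  split; last first.
    exists (`|M| + M) => x; rewrite (le_trans (ler_normD _ _))// lerD// normrM.
    by rewrite indicE in_setT normr1 mulr1.
  apply: measurable_funD; last exact: bf.1.
  by apply: measurable_funM => //; exact: b1.1.
move=> x; rewrite indicE in_setT mulr1.
by have := fM x; rewrite ler_norml => /andP[? ?]; apply/andP; split; lra.
Qed.

End functional.

Section bounded_measurable_closure.
Context {d : measure_display} {T : measurableType d} {R : realType}.
Implicit Types (f g : T -> R).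

Lemma bounded_measurable_cst (a : R) : bounded_measurable (cst a : T -> R).
Proof. by split=> //; exists `|a|. Qed.

Lemma bounded_measurableM f g :
  bounded_measurable f -> bounded_measurable g -> bounded_measurable (fun x => f x * g x).
Proof.
move=> [mf [M fM]] [mg [N gN]]; split; first exact: measurable_funM.
by exists (M * N) => x; rewrite normrM ler_pM.
Qed.

Lemma bounded_measurableD f g :
  bounded_measurable f -> bounded_measurable g -> bounded_measurable (fun x => f x + g x).
Proof.
move=> [mf [M fM]] [mg [N gN]]; split; first exact: measurable_funD.
by exists (M + N) => x; rewrite (le_trans (ler_normD _ _))// lerD.
Qed.

Lemma bounded_measurableZ a f :
  bounded_measurable f -> bounded_measurable (fun x => a * f x).
Proof. exact: bounded_measurableM (bounded_measurable_cst a). Qed.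

Lemma bounded_measurable_sum (I : Type) (s : seq I) (F : I -> T -> R) :
  (forall i, bounded_measurable (F i)) -> bounded_measurable (fun x => \sum_(i <- s) F i x).
Proof.
move=> bF; elim: s => [|i s IH].
  by under eq_fun do rewrite big_nil; exact: bounded_measurable_cst.
by under eq_fun do rewrite big_cons; exact: bounded_measurableD.
Qed.

Lemma bounded_measurable_integrable (mu : {finite_measure set T -> \bar R}) f :
  bounded_measurable f -> mu.-integrable setT (EFin \o f).
Proof. by move=> [mf [M fM]]; apply: Lfun2_integrable; exact: Lfun2_bounded fM. Qed.

End bounded_measurable_closure.

(** * Conditional expectation from a conditional law given on rectangles *)

Section disintegration.
Context {dO dX : measure_display} {Omega : measurableType dO} {X : measurableType dX}
  {R : realType}.
Variables (P : probability Omega R) (mu : {finite_measure set X -> \bar R}).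
Variable G : set (set Omega).
Hypothesis mG : forall B, G B -> measurable B.
Local Notation Omega' := (g_sigma_algebraType G).

Lemma measurable_generated (B : set Omega) : <<s G >> B -> measurable B.
Proof. by apply: smallest_sub => //; exact: sigma_algebra_measurable. Qed.

Lemma measurable_fun_generated (U : Omega' -> R) :
  measurable_fun setT U -> measurable_fun setT (U : Omega -> R).
Proof. by move=> mU _ A mA; apply: measurable_generated; exact: mU. Qed.

Variables (Y : Omega -> X) (q : Omega' -> X -> R).
Hypothesis mY : measurable_fun setT Y.
Hypothesis mq : measurable_fun setT (fun z : Omega' * X => q z.1 z.2).
Hypothesis q0 : forall w x, 0 <= q w x.
Hypothesis iq : forall w, mu.-integrable setT (EFin \o q w).
Hypothesis q1 : forall w, \int[mu]_x q w x = 1.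
Hypothesis PY : forall B A, <<s G >> B -> measurable A ->
  P (B `&` Y @^-1` A) = (\int[P]_(w in B) (\int[mu]_(x in A) q w x)%:E)%E.

Let cond (g : X -> R) (w : Omega') : R := \int[mu]_x (g x * q w x).

Lemma cond_measurable (g : X -> R) : measurable_fun setT g -> measurable_fun setT (cond g).
Proof.
move=> mg; apply: (@measurable_param_Rintegral _ _ Omega' X R mu
  (fun z => g z.2 * q z.1 z.2) setT measurableT).
by apply: measurable_funM => //; exact: (measurableT_comp mg measurable_snd).
Qed.

Lemma cond_le (g : X -> R) M w : measurable_fun setT g -> (forall x, `|g x| <= M) ->
  `|cond g w| <= M.
Proof.
move=> mg gM; have igq : mu.-integrable setT (EFin \o (fun x => g x * q w x)).
  exact: integrable_bounded_mul (iq w).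
apply: (le_trans (le_normr_Rintegral measurableT igq)).
have -> : M = \int[mu]_x (M * q w x) by rewrite RintegralZl// q1 mulr1.
apply: le_Rintegral => //.
- exact: (integrable_norm igq).
- exact: integrableZ_EFin.
- by move=> x _; rewrite normrM (ger0_norm (q0 _ _)) ler_wpM2r.
Qed.

Let bm_le (f : Omega -> R) M : bounded_measurable f -> (forall x, `|f x| <= M) ->
  `|\int[P]_w f w| <= M.
Proof.
move=> bf fM; have i_f := bounded_measurable_integrable P bf.
apply: (le_trans (le_normr_Rintegral measurableT i_f)).
have -> : M = \int[P]_w (cst M w).
  by rewrite Rintegral_cst//= probability_setT mulr1.
apply: le_Rintegral => //; first exact: (integrable_norm i_f).
exact: finite_measure_integrable_cst.
Qed.

Let bm_gen (U : Omega' -> R) : bounded_measurable U -> bounded_measurable (U : Omega -> R).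
Proof. by move=> [mU bU]; split => //; exact: measurable_fun_generated. Qed.

Let bm_Y (g : X -> R) : bounded_measurable g -> bounded_measurable (g \o Y).
Proof.
by move=> [mg [M gM]]; split; [exact: measurableT_comp|exists M => x; exact: gM].
Qed.

Let bm_cond (g : X -> R) : bounded_measurable g -> bounded_measurable (cond g).
Proof.
by move=> [mg [M gM]]; split; [exact: cond_measurable|exists M => w; exact: cond_le].
Qed.

(** The difference of the two sides is linear and bounded in [U] and in [g] separately, so
    [functional_eq0], used once in each variable, reduces the identity to indicators, where it is
    [PY]. The type [Omega'] is [Omega] with the sigma-algebra of the past. *)
Lemma conditional_expectation (U : Omega' -> R) (g : X -> R) :
  bounded_measurable U -> bounded_measurable g ->
  \int[P]_w (U w * g (Y w)) = \int[P]_w (U w * \int[mu]_x (g x * q w x)).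
Proof.
move=> bU bg; apply/eqP; rewrite -subr_eq0; apply/eqP; move: bU.
pose I1 (g : X -> R) (U : Omega' -> R) :=
  \int[P]_w (U w * g (Y w)) - \int[P]_w (U w * cond g w).
have bI1 g' (U' : Omega' -> R) : bounded_measurable g' -> bounded_measurable U' ->
    bounded_measurable (fun w : Omega => U' w * g' (Y w)) /\
    bounded_measurable ((fun w => U' w * cond g' w) : Omega -> R).
  move=> bg' bU'; split; first exact: (bounded_measurableM (bm_gen bU') (bm_Y bg')).
  by apply: bm_gen; exact: (bounded_measurableM bU' (bm_cond bg')).
have I1le g' (U' : Omega' -> R) M N : bounded_measurable g' -> bounded_measurable U' ->
    (forall x, `|g' x| <= M) -> (forall w, `|U' w| <= N) -> `|I1 g' U'| <= 2 * (N * M).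
  move=> bg' bU' gM UN; have [b1 b2] := bI1 _ _ bg' bU'.
  rewrite (le_trans (ler_normB _ _))// mulr_natl mulr2n lerD//.
    by apply: bm_le => // w; rewrite normrM ler_pM.
  apply: bm_le => // w; rewrite normrM ler_pM//.
  by apply: cond_le => //; exact: bg'.1.
change (bounded_measurable U -> I1 g U = 0).
have {}IU g' : bounded_measurable g' ->
    (forall B, <<s G >> B -> I1 g' \1_B = 0) -> forall U : Omega' -> R, bounded_measurable U -> I1
      g' U = 0.
  move=> bg' IB; have [M gM] := bg'.2.
  apply: (@functional_eq0 _ Omega' R (I1 g') (2 * M)) => //.
  - by rewrite mulr_ge0// (le_trans _ (gM point)).
  - move=> a f h bf bh; have [f1 f2] := bI1 _ _ bg' bf; have [h1 h2] := bI1 _ _ bg' bh.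
    rewrite /I1 mulrBr addrACA -opprD -!RintegralZl//; try exact: bounded_measurable_integrable.
    rewrite -!RintegralD//; try exact: bounded_measurable_integrable; try (apply:
      integrableZ_EFin; exact: bounded_measurable_integrable).
    by congr (_ - _); apply: eq_Rintegral => w _; ring.
  - by move=> f N bf fN; rewrite -mulrA (mulrC M); exact: I1le.
apply: (IU g bg) => // B BG.
have bB : bounded_measurable (\1_B : Omega' -> R) by exact: bounded_measurable_indic.
move: g bg; apply: (@functional_eq0 _ X R (fun g => I1 g \1_B) 2) => //.
- move=> a f h bf bh; have [f1 f2] := bI1 _ _ bf bB; have [h1 h2] := bI1 _ _ bh bB.
  have mif w f' : bounded_measurable f' -> mu.-integrable setT (EFin \o (fun x => f' x * q w x)).
    by move=> [mf' [M fM]]; exact: integrable_bounded_mul (iq w).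
  have ce w : cond (fun x => a * f x + h x) w = a * cond f w + cond h w.
    rewrite /cond -RintegralZl//; last exact: mif.
    rewrite -RintegralD//; [|by apply: integrableZ_EFin; exact: mif|exact: mif].
    by apply: eq_Rintegral => x _; ring.
  rewrite /I1 mulrBr addrACA -opprD -!RintegralZl//; try exact: bounded_measurable_integrable.
  rewrite -!RintegralD//; try exact: bounded_measurable_integrable; try (apply: integrableZ_EFin;
    exact: bounded_measurable_integrable).
  by congr (_ - _); apply: eq_Rintegral => w _; rewrite ?ce; ring.
- move=> f M bf fM; rewrite -[X in 2 * X]mul1r; apply: I1le => // w.
  by rewrite indicE; case: (_ \in _); rewrite ?normr1 ?normr0.
- move=> A mA; apply/eqP; rewrite subr_eq0; apply/eqP.
  rewrite /Rintegral; congr fine.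
  have mB : measurable (B : set Omega) by exact: measurable_generated.
  transitivity (P (B `&` Y @^-1` A)).
    rewrite -[in RHS](setIT (B `&` _)) -integral_indic//; last first.
      by apply: measurableI => //; rewrite -[_ @^-1` _]setTI; exact: mY.
    apply: eq_integral => w _; rewrite !indicE in_setI -natrM mulnb.
    by congr (_%:R%:E); congr (_ && _ : nat).
  rewrite PY// [LHS]integral_mkcond.
  apply: eq_integral => w _.
  rewrite patchE indicE /cond; case: (w \in B); rewrite ?mul1r ?mul0r//.
  congr EFin; rewrite Rintegral_mkcond; apply: eq_Rintegral => x _.
  by rewrite patchE indicE; case: (x \in A); rewrite ?mul1r ?mul0r.
Qed.

End disintegration.

(** * Iterates along one edge *)

Section real_sequences.
Context {R : realType}.

Lemma mean_sqr_le (k : nat) (x : 'I_k -> R) :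
  (k%:R^-1 * \sum_i x i) ^+ 2 <= k%:R^-1 * \sum_i x i ^+ 2.
Proof.
case: k x => [|k] x; first by rewrite invr0 !mul0r expr0n.
set m := k.+1%:R^-1 * _; have k0 : (k.+1%:R : R) != 0 by rewrite pnatr_eq0.
have : 0 <= k.+1%:R^-1 * \sum_i (x i - m) ^+ 2.
  by rewrite mulr_ge0 ?invr_ge0 ?ler0n// sumr_ge0// => i _; rewrite sqr_ge0.
have -> : \sum_i (x i - m) ^+ 2 = \sum_i x i ^+ 2 - 2 * m * \sum_i x i + k.+1%:R * m ^+ 2.
  have -> : k.+1%:R * m ^+ 2 = \sum_(i < k.+1) m ^+ 2 by rewrite sumr_const card_ord mulr_natl.
  rewrite mulr_sumr -sumrN -!big_split/=.
  by apply: eq_bigr => i _; ring.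
have -> : \sum_i x i = k.+1%:R * m by rewrite /m mulVKf.
move=> H; rewrite -subr_ge0; apply: le_trans H _; rewrite le_eqVlt; apply/orP; left.
by apply/eqP; field.
Qed.

Definition step_size (gamma : R) (t : nat) : R := 1 / (gamma * t.+1%:R).

Lemma step_size_gt0 gamma t : 0 < gamma -> 0 < step_size gamma t.
Proof. by move=> g0; rewrite divr_gt0// mulr_gt0. Qed.

(* The step size may exceed 1 for the first few t, during which the iterates are only
   controlled up to a constant factor. *)
Lemma relaxation_bounded (gamma Q : R) : 0 < gamma -> 0 <= Q ->
  exists2 M, 0 <= M & forall A : nat -> R, A 0%N <= 1 -> (forall t, 0 <= A t) ->
    (forall t, A t.+1 <= 2 * (1 - step_size gamma t) ^+ 2 * A t +
       2 * step_size gamma t ^+ 2 * Q) ->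
    (forall t, step_size gamma t <= 1 ->
       A t.+1 <= (1 - step_size gamma t) * A t + step_size gamma t * Q) ->
    forall t, A t <= M.
Proof.
move=> g0 Q0.
pose L : R := 1 + gamma^-1.
have L1 : 1 <= L by rewrite lerDl invr_ge0 ltW.
(* Worst-case growth as long as the step may exceed 1; only its values up to [t1] enter the
   bound. *)
pose S := fix S t := if t is s.+1 then 2 * L ^+ 2 * S s + 2 * L ^+ 2 * Q else 1 : R.
have [t1 Ht1] : exists t1 : nat, gamma^-1 <= t1%:R.
  by exists (Num.bound gamma^-1); rewrite ltW// archi_boundP// invr_ge0 ltW.
have S0 t : 0 <= S t.
  by elim: t => //= t IH; rewrite addr_ge0// mulr_ge0// mulr_ge0// sqr_ge0.
have eta_le t : step_size gamma t <= gamma^-1.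
  rewrite /step_size div1r invfM ler_piMr ?invr_ge0 ?(ltW g0)//.
  by rewrite invf_le1// ler1n.
have etaL t : (1 - step_size gamma t) ^+ 2 <= L ^+ 2 /\ step_size gamma t ^+ 2 <= L ^+ 2.
  have e0 := step_size_gt0 t g0; have e1 := eta_le t.
  split.
    by rewrite -[leRHS](ger0_norm (sqr_ge0 _)) -[leLHS](ger0_norm (sqr_ge0 _)) !normrX lerXn2r//
      ?nnegrE// ler_norml (ger0_norm (le_trans ler01 L1)) /L; apply/andP; split; lra.
  by rewrite lerXn2r// ?nnegrE /L; lra.
have eta1 t : (t1 <= t)%N -> step_size gamma t <= 1.
  move=> t1t; rewrite /step_size ler_pdivrMr ?mulr_gt0// mul1r.
  rewrite -ler_pdivrMl// mulr1 (le_trans Ht1)// ler_nat.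
  by apply: leq_trans t1t _.
exists (\sum_(t < t1.+1) S t + Q).
  by rewrite addr_ge0// sumr_ge0.
move=> A A0 Age A1 A2.
have AS t : A t <= S t.
  elim: t => //= t IH; apply: le_trans (A1 t) _; have [h1 h2] := etaL t.
  have := ler_pM (sqr_ge0 _) (Age t) h1 IH; have := ler_wpM2r Q0 h2; lra.
have Sle t : (t <= t1)%N -> S t <= \sum_(t < t1.+1) S t.
  move=> tt1; rewrite (bigD1 (Ordinal (tt1 : (t < t1.+1)%N)))//= lerDl.
  by rewrite sumr_ge0.
move=> t; have [tt1|/ltnW/subnKC <-] := leqP t t1.
  by apply: le_trans (AS t) _; rewrite ler_wpDr// Sle.
elim: (t - t1)%N => [|n IH].
  by rewrite addn0; apply: le_trans (AS t1) _; rewrite ler_wpDr// Sle.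
rewrite addnS; have e1 := eta1 _ (leq_addr n t1); have e0 := step_size_gt0 (t1 + n) g0.
apply: le_trans (A2 _ e1) _.
have h : 0 <= \sum_(t < t1.+1) S t by rewrite sumr_ge0.
move: h IH; move: (\sum_(_ < _) _) (A (t1 + n)%N) (step_size _ _) e0 e1 => s x e e0 e1 h IH.
have := ler_wpM2l (ltac:(lra) : 0 <= 1 - e) IH; nra.
Qed.

End real_sequences.

(** * Iterates of one edge along a fixed sequence of samples *)

Section edge_path.
Context {R : realType} {X : ptopologicalType}.
Variable mu : {finite_measure set (borel X) -> \bar R}.
Variables (K : borel X -> borel X -> R) (lam : nat -> R) (phi : nat -> borel X -> R).
Hypothesis mK : mercer_system mu K lam phi.
Hypothesis sK : symmetric_kernel K.
Variables (c B : R).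
Hypothesis (c0 : 0 < c) (KB : forall x y, c <= K x y <= B).
Local Notation L2 := (Lfun mu 2%:E).
Local Notation M0 := (fine (mu setT)).
Local Notation kcoef := (kcoef mu K lam phi).
Local Notation nker := (nker mu K).
Local Notation kbound := (kbound mu c B).
Let phiB := mercer_basis mK.
Let phiL := basis_Lfun phiB.
Let M00 : 0 < M0 := mass_gt0 mK.
Let B0 : 0 < B := B_gt0 c0 KB.

Variables (r k : nat) (eta : nat -> R) (y : nat -> 'I_k -> borel X).
Hypotheses (r0 : (0 < r)%N) (k0 : (0 < k)%N).

Definition sample_coef (t j : nat) : R := k%:R^-1 * \sum_(i < k) kcoef j (y t i).

(** An edge reads the other messages only through its samples. Once these are fixed, the edges
    evolve separately, and [sosmp_coef] becomes this recursion. *)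
Fixpoint edge_coef (t j : nat) : R :=
  if t is s.+1 then (1 - eta s) * edge_coef s j + eta s * sample_coef s j else r%:R^-1.

Let kR : (k%:R : R) != 0. Proof. by rewrite pnatr_eq0 -lt0n. Qed.

Lemma sample_coef_sqr t : \sum_(j < r) sample_coef t j ^+ 2 <= kbound.
Proof.
apply: (@le_trans _ _ (\sum_(j < r) k%:R^-1 * \sum_(i < k) kcoef j (y t i) ^+ 2)).
  by apply: ler_sum => j _; exact: mean_sqr_le.
rewrite -mulr_sumr exchange_big/=.
rewrite ler_pdivrMl ?ltr0n// mulr_natl -[X in _ *+ X]card_ord -sumr_const.
by apply: ler_sum => i _; exact: (kcoef_bessel mK sK c0 KB).
Qed.

Lemma comb_sample_coef t x : comb phi r (sample_coef t) x =
  k%:R^-1 * \sum_(i < k) comb phi r (kcoef ^~ (y t i)) x.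
Proof.
rewrite combE; under [in RHS]eq_bigr do rewrite combE.
rewrite exchange_big/= mulr_sumr; apply: eq_bigr => j _.
by rewrite /sample_coef -mulrA mulr_suml.
Qed.

Local Notation lo := (c / (B * M0)).

(** Full sections are at least [lo], truncation costs at most half of it, and averaging over the
    samples preserves the bound. *)
Lemma comb_sample_ge (tau : R) t x :
  (forall N x, \sum_(r <= j < N) lam j * phi j x ^+ 2 <= tau) ->
  tau / (c * M0) <= lo / 2 -> lo / 2 <= comb phi r (sample_coef t) x.
Proof.
move=> ht htau; rewrite comb_sample_coef ler_pdivlMl ?ltr0n//.
rewrite mulr_natl -[X in _ *+ X]card_ord -sumr_const.
apply: ler_sum => i _; have /andP[h _] := nker_bounds mK c0 KB x (y t i).
have := nker_pointwise_tail mK c0 KB ht x (y t i).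
rewrite ler_norml => /andP[h1 h2]; lra.
Qed.

(** Written as an inner product so that linearity and Cauchy-Schwarz apply directly. *)
Definition mass (f : borel X -> R) : R := inner mu f (cst 1).

Lemma massE f : mass f = \int[mu]_x f x.
Proof. by apply: eq_Rintegral => x _; rewrite /cst mulr1. Qed.

Let oneL : (cst 1 : borel X -> R) \in L2. Proof. exact: Lfun_cst. Qed.

Lemma mass_sqr_le f : f \in L2 -> mass f ^+ 2 <= inner mu f f * M0.
Proof.
move=> fL; apply: le_trans (inner_CS fL oneL) _.
apply: ler_wpM2l; first exact: inner_ge0.
rewrite /inner (_ : (fun x => _) = cst 1) ?Rintegral_cst// ?mul1r//.
by apply/funext => x; rewrite /= mulr1.
Qed.

Lemma mass_norm_le f (M : R) : f \in L2 -> inner mu f f <= M ->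
  `|mass f| <= Num.sqrt (M * M0).
Proof.
move=> fL fM; rewrite -sqrtr_sqr ler_sqrt.
  by apply: le_trans (mass_sqr_le fL) _; rewrite ler_wpM2r// ltW.
by rewrite mulr_ge0 ?(ltW M00)// (le_trans _ fM)// inner_ge0.
Qed.

Lemma massD f g : f \in L2 -> g \in L2 -> mass (f + g) = mass f + mass g.
Proof. by move=> *; exact: innerDl. Qed.

Lemma massZ a f : f \in L2 -> mass (a *: f) = a * mass f.
Proof. by move=> *; exact: innerZl. Qed.

Lemma mass_comb a : mass (comb phi r a) = \sum_(j < r) a j * mass (phi j).
Proof.
rewrite /mass inner_comb//; apply: eq_bigr => j _; by rewrite innerC.
Qed.

Lemma mass_comb_sample (e2 : R) t :
  (forall N y, \sum_(r <= j < N) kcoef j y ^+ 2 <= e2) ->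
  `|mass (comb phi r (sample_coef t)) - 1| <= Num.sqrt (e2 * M0).
Proof.
move=> he.
have -> : mass (comb phi r (sample_coef t)) - 1 =
   k%:R^-1 * \sum_(i < k) (mass (comb phi r (kcoef ^~ (y t i))) - 1).
  rewrite sumrB sumr_const card_ord mulrBr -[1 *+ k]mulr_natl mulr1 mulVf//.
  congr (_ - _); rewrite mass_comb; under [in RHS]eq_bigr do rewrite mass_comb.
  rewrite exchange_big/= mulr_sumr; apply: eq_bigr => j _.
  by rewrite /sample_coef -mulrA mulr_suml.
rewrite normrM ger0_norm ?invr_ge0// ler_pdivrMl ?ltr0n//.
rewrite mulr_natl -[X in _ *+ X]card_ord -sumr_const.
apply: le_trans (ler_norm_sum _ _ _) _; apply: ler_sum => i _.
rewrite massE -sqrtr_sqr ler_sqrt; first exact: (comb_nker_mass mK sK c0 KB he).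
rewrite mulr_ge0 ?(ltW M00)//; apply: le_trans (he 0%N (y t i)).
by rewrite big_geq.
Qed.

(** * Messages of one edge once the step size is at most 1 *)

Section late.
Variables (t1 : nat) (Ma tau e2 : R).
Hypothesis eta01 : forall t, (t1 <= t)%N -> 0 <= eta t <= 1.
Hypothesis coefM : forall t, \sum_(j < r) edge_coef t j ^+ 2 <= Ma.
Hypothesis htail : forall N x, \sum_(r <= j < N) lam j * phi j x ^+ 2 <= tau.
Hypothesis htau : tau / (c * M0) <= lo / 2.
Hypothesis he2 : forall N y, \sum_(r <= j < N) kcoef j y ^+ 2 <= e2.
Local Notation s := (Num.sqrt (e2 * M0)).

(* The weight of the message of time t1 in the message of time t: from time t1 on, the
   updates are convex combinations. *)
Definition forget (t : nat) : R := \prod_(t1 <= i < t) (1 - eta i).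

Lemma forget_bounds t : 0 <= forget t <= 1.
Proof.
rewrite /forget big_nat_cond; apply: (big_ind (fun x => 0 <= x <= 1)).
- by rewrite lexx ler01.
- move=> a b /andP[? ?] /andP[? ?]; rewrite mulr_ge0//=.
  by rewrite mulr_ile1.
- move=> i /andP[/andP[/eta01 /andP[? ?] _] _]; apply/andP; split; lra.
Qed.

(** The contribution of the samples drawn from time [t1] on. Their weights add up to [1 - forget],
    so up to this factor it is an average of truncated sections and inherits their lower bound and
    their mass. *)
Fixpoint fresh_coef (n j : nat) : R :=
  if n is n'.+1 then
    (1 - eta (t1 + n')%N) * fresh_coef n' j + eta (t1 + n')%N * sample_coef (t1 + n') j
  else 0.

Lemma forgetS n : forget (t1 + n).+1 = (1 - eta (t1 + n)%N) * forget (t1 + n).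
Proof. by rewrite /forget big_nat_recr ?leq_addr//= mulrC. Qed.

Lemma edge_coef_split n j :
  edge_coef (t1 + n) j = forget (t1 + n) * edge_coef t1 j + fresh_coef n j.
Proof.
elim: n => [|n IH]; first by rewrite addn0 /forget big_geq// mul1r addr0.
by rewrite addnS/= forgetS IH; ring.
Qed.

Lemma fresh_ge n x : (1 - forget (t1 + n)) * (lo / 2) <= comb phi r (fresh_coef n) x.
Proof.
elim: n => [|n IH].
  rewrite addn0 /forget big_geq// subrr mul0r combE big1// => j _.
  by rewrite mul0r.
rewrite addnS forgetS.
have -> : comb phi r (fresh_coef n.+1) = (1 - eta (t1 + n)%N) *: comb phi r (fresh_coef n)
   + eta (t1 + n)%N *: comb phi r (sample_coef (t1 + n)).
  by rewrite !combZ combD.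
have := comb_sample_ge (t1 + n) x htail htau.
have /andP[e0 e1] := eta01 (leq_addr n t1).
change (((1 - eta (t1 + n)%N) *: comb phi r (fresh_coef n)
   + eta (t1 + n)%N *: comb phi r (sample_coef (t1 + n))) x) with
  ((1 - eta (t1 + n)%N) * comb phi r (fresh_coef n) x
   + eta (t1 + n)%N * comb phi r (sample_coef (t1 + n)) x) => h.
have := ler_wpM2l e0 h; have := ler_wpM2l (ltac:(lra) : 0 <= 1 - eta (t1 + n)%N) IH.
lra.
Qed.

Lemma fresh_mass n :
  `|mass (comb phi r (fresh_coef n)) - (1 - forget (t1 + n))| <= (1 - forget (t1 + n)) * s.
Proof.
elim: n => [|n IH].
  rewrite addn0 /forget big_geq// mass_comb big1 => [|j _]; last by rewrite mul0r.
  by rewrite !subrr mul0r normr0.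
rewrite addnS forgetS.
have -> : comb phi r (fresh_coef n.+1) = (1 - eta (t1 + n)%N) *: comb phi r (fresh_coef n)
   + eta (t1 + n)%N *: comb phi r (sample_coef (t1 + n)).
  by rewrite !combZ combD.
rewrite massD ?massZ ?Lfun2Z ?comb_Lfun//.
have h := mass_comb_sample (t1 + n) he2.
have /andP[e0 e1] := eta01 (leq_addr n t1).
move: IH h (ltac:(lra) : 0 <= 1 - eta (t1 + n)%N).
move: (mass _) (mass _) (forget _) (Num.sqrt _) (eta _) e0 e1 => a b f q e e0 e1.
move=> h1 h2 e2'.
have -> : (1 - e) * b + e * a - (1 - (1 - e) * f) = (1 - e) * (b - (1 - f)) + e * (a - 1).
  by ring.
apply: le_trans (ler_normD _ _) _; rewrite !normrM (ger0_norm e0) (ger0_norm e2').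
have := ler_wpM2l e2' h1; have := ler_wpM2l e0 h2; lra.
Qed.

Variable t : nat.
Hypothesis t1t : (t1 <= t)%N.
Local Notation m := (comb phi r (edge_coef t)).
Local Notation m1 := (comb phi r (edge_coef t1)).
Local Notation rho := (forget t).
Local Notation h := (comb phi r (fresh_coef (t - t1))).

Let mE : m = rho *: m1 + h.
Proof.
rewrite combZ combD; congr (comb _ _ _); apply/funext => j.
by rewrite -[in LHS](subnKC t1t) edge_coef_split subnKC.
Qed.

Let mL : m \in L2. Proof. exact: comb_Lfun. Qed.
Let m1L : m1 \in L2. Proof. exact: comb_Lfun. Qed.
Let hL : h \in L2. Proof. exact: comb_Lfun. Qed.

Let mME x : m x = rho * m1 x + h x. Proof. by rewrite mE. Qed.

Let hge x : (1 - rho) * (lo / 2) <= h x.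
Proof. by have := fresh_ge (t - t1) x; rewrite subnKC. Qed.

Let lo0 : 0 < lo. Proof. by rewrite divr_gt0// mulr_gt0. Qed.

Let inm : inner mu m m <= Ma. Proof. by rewrite inner_comb2. Qed.
Let inm1 : inner mu m1 m1 <= Ma. Proof. by rewrite inner_comb2. Qed.

Let Ma0 : 0 <= Ma. Proof. by apply: le_trans (inner_ge0 _ m) inm. Qed.

(** The fresh part is bounded below, so a nonpositive value requires a remnant of at least that
    size. *)
Lemma message_nonpos x : m x <= 0 -> (1 - rho) * (lo / 2) <= rho * `|m1 x|.
Proof.
rewrite mME => hm; have /andP[f0 f1] := forget_bounds t.
apply: le_trans (hge x) _.
have : - (rho * m1 x) <= rho * `|m1 x| by rewrite -mulrN ler_wpM2l// -normrN ler_norm.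
lra.
Qed.

Definition pos_part (f : borel X -> R) (x : borel X) : R := Num.max 0 (f x).

Lemma pos_part_Lfun f : f \in L2 -> pos_part f \in L2.
Proof.
move=> /Lfun2P[mf i_f]; have mp : measurable_fun setT (pos_part f).
  by apply: measurable_maxr.
apply/Lfun2P; split => //.
apply: le_integrable i_f => //; first by apply/measurable_EFinP; exact: measurable_funX.
move=> x _ /=; rewrite lee_fin !normrX lerXn2r ?nnegrE// /pos_part.
by have [] := ltP 0 (f x) => //; rewrite normr0.
Qed.

Let pL : pos_part m \in L2. Proof. exact: pos_part_Lfun. Qed.

(** The fresh part being nonnegative, the negative part of a message is dominated pointwise by the
    remnant. *)
Let neg_le x : `|(pos_part m - m) x| <= `|(rho *: m1) x|.
Proof.
have -> : (pos_part m - m) x = pos_part m x - m x by [].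
have -> : (rho *: m1) x = rho * m1 x by [].
have /andP[f0 f1] := forget_bounds t.
rewrite /pos_part; have [hm|hm] := ltP 0 (m x); first by rewrite subrr normr0.
rewrite sub0r normrN ler0_norm// normrM (ger0_norm f0) mME.
have : 0 <= (1 - rho) * (lo / 2) by rewrite mulr_ge0 ?subr_ge0// ltW// divr_gt0.
have : - (rho * m1 x) <= rho * `|m1 x| by rewrite -mulrN ler_wpM2l// -normrN ler_norm.
have := hge x; lra.
Qed.

Let inner_neg : inner mu (pos_part m - m) (pos_part m - m) <= rho ^+ 2 * Ma.
Proof.
apply: le_trans (inner_le _ _ neg_le) _; rewrite ?Lfun2B ?Lfun2Z//.
rewrite innerZl ?innerZr ?Lfun2Z// mulrA -expr2.
by rewrite ler_wpM2l ?sqr_ge0.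
Qed.

Let inner_pos : inner mu (pos_part m) (pos_part m) <= Ma.
Proof.
apply: le_trans inm; apply: inner_le => // x.
by rewrite /pos_part; have [] := ltP 0 (m x) => //; rewrite normr0.
Qed.

Local Notation q := (Num.sqrt (Ma * M0)).

Lemma pos_part_mass : `|mass (pos_part m) - 1| <= (2 * q + 1) * rho + s.
Proof.
have /andP[f0 f1] := forget_bounds t.
(* The negative part and the remnant contribute at most [rho * q] each, the fresh part deviates by
   at most [s], and the weight [rho] is missing from it. *)
have -> : mass (pos_part m) - 1 = mass (pos_part m - m) + rho * mass m1 +
    (mass h - (1 - rho)) - rho.
  have -> : mass (pos_part m) = mass ((pos_part m - m) + (rho *: m1 + h)).
    by rewrite -mE subrK.
  by rewrite (@massD (pos_part m - m)) ?Lfun2B ?Lfun2D ?Lfun2Z// (@massD (rho *: m1)) ?Lfun2Z//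
    massZ//; ring.
have a1 : `|mass (pos_part m - m)| <= rho * q.
  apply: le_trans (mass_norm_le _ inner_neg) _; first by rewrite Lfun2B.
  by rewrite -mulrA sqrtrM ?sqr_ge0// sqrtr_sqr ger0_norm.
have a2 : `|rho * mass m1| <= rho * q.
  by rewrite normrM (ger0_norm f0) ler_wpM2l// mass_norm_le.
have a3 : `|mass h - (1 - rho)| <= s.
  have := fresh_mass (t - t1); rewrite subnKC// => h1; apply: le_trans h1 _.
  by rewrite ler_piMl ?sqrtr_ge0//; lra.
move: a1 a2 a3; rewrite !ler_norml => /andP[? ?] /andP[? ?] /andP[? ?].
apply/andP; split; lra.
Qed.

Definition normalised : borel X -> R := (mass (pos_part m))^-1 *: pos_part m.

Hypothesis small : (2 * q + 1) * rho + s <= 2^-1.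

Let mp_ge : 2^-1 <= mass (pos_part m).
Proof.
have := le_trans pos_part_mass small; rewrite ler_norml => /andP[? ?]; lra.
Qed.

Lemma pos_part_mass_gt0 : 0 < mass (pos_part m).
Proof. by apply: lt_le_trans mp_ge. Qed.

Lemma normalised_density : prob_density mu normalised.
Proof.
have p0 := pos_part_mass_gt0; split; first by rewrite Lfun2Z.
- move=> x; have -> : normalised x = (mass (pos_part m))^-1 * pos_part m x by [].
  by rewrite mulr_ge0 ?invr_ge0 ?(ltW p0)// le_max lexx.
- by rewrite -massE massZ// mulVf// gt_eqF.
Qed.

(* Contractivity is only assumed on densities, hence this comparison of a message with its
   normalised positive part. *)
Lemma normalised_close :
  inner mu (normalised - m) (normalised - m) <=
  2 * (rho ^+ 2 * Ma) + 8 * ((2 * q + 1) * rho + s) ^+ 2 * Ma.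
Proof.
have p0 := pos_part_mass_gt0; set P := mass (pos_part m) in p0 *.
have -> : normalised - m = (pos_part m - m) + (P^-1 - 1) *: pos_part m.
  by rewrite /normalised -/P scalerBl scale1r [RHS]addrC addrA subrK.
apply: le_trans (inner_young ltr01 _ _) _; rewrite ?Lfun2B ?Lfun2Z//.
rewrite invr1 innerZl ?innerZr ?Lfun2Z// -[1 + 1]/(2 : R).
apply: lerD; first by rewrite ler_wpM2l.
have h1 : (P^-1 - 1) ^+ 2 <= 4 * ((2 * q + 1) * rho + s) ^+ 2.
  have -> : 4 * ((2 * q + 1) * rho + s) ^+ 2 = (2 * ((2 * q + 1) * rho + s)) ^+ 2 by ring.
  rewrite -real_normK ?num_real// lerXn2r ?nnegrE//.
    by rewrite mulr_ge0// (le_trans _ pos_part_mass).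
  have -> : P^-1 - 1 = P^-1 * (1 - P) by field; rewrite gt_eqF.
  rewrite normrM ger0_norm ?invr_ge0 ?(ltW p0)//.
  apply: ler_pM; rewrite ?invr_ge0 ?(ltW p0)//.
    by rewrite -[leRHS]invrK lef_pV2 ?posrE// invr_gt0.
  by rewrite distrC pos_part_mass.
rewrite (mulrA (P^-1 - 1)) -[(P^-1 - 1) * _]expr2 mulrA.
have -> : 8 * ((2 * q + 1) * rho + s) ^+ 2 * Ma = 2 * (4 * ((2 * q + 1) * rho + s) ^+ 2) * Ma by ring.
by have := ler_pM (sqr_ge0 _) (inner_ge0 mu _) h1 inner_pos; lra.
Qed.

End late.
End edge_path.

(** * Messages on the graph *)

Section graph.
Context {R : realType} {X : ptopologicalType}.
Variable mu : {finite_measure set (borel X) -> \bar R}.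
Context {V : finType}.
Variables (adj : rel V) (psiV : V -> borel X -> R) (psiE : V -> V -> borel X -> borel X -> R).
Variables (lam : V -> V -> nat -> R) (phi : V -> V -> nat -> borel X -> R).
Variables (mstar : V -> V -> borel X -> R) (gamma c B : R) (k : nat).
Hypothesis adj_sym : symmetric adj.
Hypothesis psiV_meas : forall u, measurable_fun setT (psiV u).
Hypothesis psiV_gt0 : forall u x, 0 < psiV u x.
Hypothesis c0 : 0 < c.
Hypothesis psiE_bounds : forall v u, adj v u -> forall x y, c <= psiE u v x y <= B.
Hypothesis psiE_symm : forall v u, adj v u -> symmetric_kernel (psiE u v).
Hypothesis psiE_mercer : forall v u, adj v u -> mercer_system mu (psiE u v) (lam u v) (phi u v).
Hypothesis gamma_gt0 : 0 < gamma.
Hypothesis gamma_lt2 : gamma < 2.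
Hypothesis contr : bp_contractive mu adj psiV psiE gamma.
Hypothesis mstarP : bp_fixed_point mu adj psiV psiE mstar.
Hypothesis k_gt0 : (0 < k)%N.

Local Notation L2 := (Lfun mu 2%:E).
Local Notation M0 := (fine (mu setT)).
Local Notation nb v u := (neighbors adj v :\ u).

Lemma nb_adj v u w : w \in nb v u -> adj w v.
Proof. by rewrite !inE => /andP[_]; rewrite adj_sym. Qed.

Definition msg_weight (m : V -> V -> borel X -> R) v u (y : borel X) : R :=
  psiV v y * \prod_(w in nb v u) m w v y.

Section update.
Variables (m : V -> V -> borel X -> R) (v u : V).
Hypothesis vu : adj v u.
Hypothesis mm : forall w, w \in nb v u -> measurable_fun setT (m w v).
Hypothesis m0 : forall w, w \in nb v u -> forall x, 0 <= m w v x.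
Local Notation K := (psiE u v).
Local Notation g := (msg_weight m v u).

Lemma msg_weight_measurable : measurable_fun setT g.
Proof.
apply: measurable_funM => //; rewrite /msg_weight.
under eq_fun do rewrite -big_filter.
by apply: measurable_prod => w; rewrite mem_filter => /andP[wn _]; exact: mm.
Qed.

Lemma msg_weight_ge0 y : 0 <= g y.
Proof. by rewrite mulr_ge0 ?(ltW (psiV_gt0 _ _))// prodr_ge0// => w wn; exact: m0. Qed.

Lemma bp_integrandE x y : bp_integrand adj psiV psiE m v u x y = K x y * g y.
Proof. by rewrite /bp_integrand -mulrA. Qed.

Section integrable.
Hypothesis ig : mu.-integrable setT (EFin \o g).
Hypothesis I0 : 0 < \int[mu]_y (kmass mu K y * g y).

Lemma bp_updateE : bp_update mu adj psiV psiE m v u = kavg mu K g.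
Proof.
apply/funext => x; rewrite /bp_update /kavg.
under [X in X^-1]eq_Rintegral do under eq_Rintegral do rewrite bp_integrandE.
rewrite (kavg_int (psiE_mercer vu) c0 (psiE_bounds vu) ig).
by congr (_ * _); apply: eq_Rintegral => y _; rewrite bp_integrandE.
Qed.

Let iKg x : mu.-integrable setT (EFin \o (fun y => K x y * g y)).
Proof.
have mK := mercer_measurable (psiE_mercer vu).
apply: (@integrable_bounded_mul _ _ _ _ _ _ B) ig; first exact: (measurable_fun_pair2 x mK).
by move=> y; have /andP[h ?] := psiE_bounds vu x y; rewrite ger0_norm// (le_trans _ h)// ltW.
Qed.

Lemma bp_definedP : bp_defined mu adj psiV psiE m v u.
Proof.
have e : (\int[mu]_x \int[mu]_y (bp_integrand adj psiV psiE m v u x y)%:E =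
    (\int[mu]_x \int[mu]_y (K x y * g y))%:E)%E.
  have e1 x : (\int[mu]_y (bp_integrand adj psiV psiE m v u x y)%:E =
      (\int[mu]_y (K x y * g y))%:E)%E.
    rewrite /Rintegral fineK; last exact: integrable_fin_num (iKg x).
    by apply: eq_integral => y _; rewrite bp_integrandE.
  under eq_integral do rewrite e1.
  transitivity ((fine (\int[mu]_x (\int[mu]_y (K x y * g y))%:E))%:E)%E; last by [].
  rewrite fineK//; apply: integrable_fin_num => //.
  rewrite (_ : (fun x => _) = EFin \o ((\int[mu]_y (kmass mu K y * g y)) *: kavg mu K g)).
    apply: Lfun2_integrable; rewrite Lfun2Z//.
    by apply: (kavg_Lfun (psiE_mercer vu) (psiE_symm vu) c0 (psiE_bounds vu)) => //;
      [exact: msg_weight_measurable|exact: msg_weight_ge0].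
  apply/funext => x /=; congr EFin.
  change (\int[mu]_y (K x y * g y) = (\int[mu]_y (kmass mu K y * g y)) * kavg mu K g x).
  by rewrite /kavg mulVKf// gt_eqF.
rewrite /bp_defined e (kavg_int (psiE_mercer vu) c0 (psiE_bounds vu) ig).
by rewrite lte_fin I0 ltry.
Qed.

End integrable.

(** Because [c <= K <= B], the BP integrand is comparable with [g]. An infinite integral of [g]
    would make every inner integral, hence the normalising constant, infinite; a vanishing one would
    make the normalising constant zero. *)
Lemma bp_defined_integrable : bp_defined mu adj psiV psiE m v u ->
  mu.-integrable setT (EFin \o g) /\ 0 < \int[mu]_y (kmass mu K y * g y).
Proof.
move=> /andP[d0 dy].
have mg := msg_weight_measurable; have g0 := msg_weight_ge0.
have mK := mercer_measurable (psiE_mercer vu).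
have M00 := mass_gt0 (psiE_mercer vu).
have mbp x : measurable_fun setT (fun y => (bp_integrand adj psiV psiE m v u x y)%:E).
  rewrite (_ : (fun y => _) = EFin \o (fun y => K x y * g y)).
    apply/measurable_EFinP; apply: measurable_funM => //.
    exact: (measurable_fun_pair2 x mK).
  by apply/funext => z; rewrite bp_integrandE.
have ig : mu.-integrable setT (EFin \o g).
  apply/integrableP; split; first exact/measurable_EFinP.
  rewrite ltNge; apply/negP => gy; move: dy; rewrite ltNge => /negP; apply.
  have {}gy : (\int[mu]_y (g y)%:E = +oo)%E.
    apply/eqP; rewrite -leye_eq; apply: le_trans gy _.
    by under eq_integral do rewrite /= ger0_norm//.
  have iy x : (\int[mu]_y (bp_integrand adj psiV psiE m v u x y)%:E = +oo)%E.
    apply/eqP; rewrite -leye_eq -(gt0_muley (c0 : 0 < c%:E)%E) -gy -ge0_integralZl//; last 3 first.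
    - exact/measurable_EFinP.
    - by move=> y _; rewrite lee_fin.
    - by rewrite lee_fin ltW.
    apply: ge0_le_integral => //.
    - by move=> y _; rewrite mule_ge0// lee_fin// ltW.
    - by apply/measurable_EFinP; exact: measurable_funM.
    - move=> y _; rewrite bp_integrandE lee_fin ler_wpM2r//.
      by have /andP[] := psiE_bounds vu x y.
  under eq_integral do rewrite iy.
  rewrite integral_cst// gt0_mulye//.
  have : (0 < (fine (mu [set: borel X]))%:E)%E by rewrite lte_fin.
  by rewrite fineK// fin_num_measure.
split=> //.
have iz : mu.-integrable setT (EFin \o (fun y => kmass mu K y * g y)).
  apply: integrable_bounded_mul ig; first exact: (kmass_measurable (psiE_mercer vu) (psiE_symm vu)).
  exact: (kmass_norm (psiE_mercer vu) c0 (psiE_bounds vu)).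
rewrite lt_def Rintegral_ge0 ?andbT; last first.
  by move=> y _; rewrite mulr_ge0// ltW// (kmass_gt0 (psiE_mercer vu) c0 (psiE_bounds vu)).
apply/negP => /eqP I0.
have g00 : \int[mu]_y g y = 0.
  apply/eqP; rewrite eq_le Rintegral_ge0// andbT -(pmulr_rle0 _ (mulr_gt0 c0 M00)) -I0.
  rewrite -RintegralZl//; apply: le_Rintegral => //; first exact: integrableZ_EFin.
  move=> y _; rewrite ler_wpM2r//.
  by have /andP[] := kmass_bounds (psiE_mercer vu) c0 (psiE_bounds vu) y.
move: d0; rewrite lt_neqAle => /andP[/negP + _]; apply.
rewrite eq_sym; apply/eqP.
have iy x : (\int[mu]_y (bp_integrand adj psiV psiE m v u x y)%:E = 0)%E.
  apply/eqP; rewrite eq_le; apply/andP; split; last first.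
    apply: integral_ge0 => y _; rewrite bp_integrandE lee_fin mulr_ge0//.
    by have /andP[h _] := psiE_bounds vu x y; rewrite (le_trans _ h)// ltW.
  have -> : 0%E = (\int[mu]_y (B%:E * (g y)%:E))%E.
    rewrite integralZl// -[X in (_ * X)%E]fineK ?integrable_fin_num//.
    by rewrite -/(Rintegral _ _ _) g00 mule0.
  apply: ge0_le_integral => //.
  - move=> y _; rewrite bp_integrandE lee_fin mulr_ge0//.
    by have /andP[h _] := psiE_bounds vu x y; rewrite (le_trans _ h)// ltW.
  - by apply/measurable_EFinP; exact: measurable_funM.
  - move=> y _; rewrite bp_integrandE lee_fin ler_wpM2r//.
    by have /andP[] := psiE_bounds vu x y.
by under eq_integral do rewrite iy; rewrite integral0.
Qed.

End update.

(** The update ignores constant factors of the weight, so it is the same for the positive parts that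
    are sampled from and for their normalisations. *)
Lemma kavg_scale (K : borel X -> borel X -> R) (g : borel X -> R) (s : R) : s != 0 ->
  (forall x, mu.-integrable setT (EFin \o (fun y => K x y * g y))) ->
  mu.-integrable setT (EFin \o (fun y => kmass mu K y * g y)) ->
  kavg mu K (fun y => s * g y) = kavg mu K g.
Proof.
move=> s0 i1 i2; apply/funext => x; rewrite /kavg.
have -> : \int[mu]_y (kmass mu K y * (s * g y)) = s * \int[mu]_y (kmass mu K y * g y).
  by rewrite -RintegralZl//; apply: eq_Rintegral => y _; rewrite mulrCA.
have -> : \int[mu]_y (K x y * (s * g y)) = s * \int[mu]_y (K x y * g y).
  by rewrite -RintegralZl//; apply: eq_Rintegral => y _; rewrite mulrCA.
by rewrite invfM mulrACA mulVf// mul1r.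
Qed.

(** * The BP fixed point and its coefficients *)

Section fixed_point.
Variables (v u : V).
Hypothesis vu : adj v u.

Lemma mstar_density : prob_density mu (mstar v u).
Proof. by case: mstarP => /(_ v u vu). Qed.

Lemma mstar_Lfun : mstar v u \in L2. Proof. by case: mstar_density. Qed.
End fixed_point.

Lemma mstar_meas v u w : w \in nb v u -> measurable_fun setT (mstar w v).
Proof. by move=> /nb_adj /mstar_Lfun; exact: Lfun2_measurable. Qed.

Lemma mstar_ge0 v u w : w \in nb v u -> forall x, 0 <= mstar w v x.
Proof. by move=> /nb_adj /mstar_density []. Qed.

Section fixed_point_coefficients.
Variables (v u : V).
Hypothesis vu : adj v u.
Local Notation K := (psiE u v).
Local Notation g := (msg_weight mstar v u).

Lemma mstar_weight : mu.-integrable setT (EFin \o g) /\ 0 < \int[mu]_y (kmass mu K y * g y).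
Proof.
apply: bp_defined_integrable => //; [exact: mstar_meas|exact: mstar_ge0|].
by case: mstarP => _ /(_ v u vu) [].
Qed.

Lemma inner_ae_eq (f f' h : borel X -> R) : f \in L2 -> f' \in L2 -> h \in L2 ->
  ae_eq mu setT f f' -> inner mu f h = inner mu f' h.
Proof.
move=> fL fL' hL ff; rewrite /inner /Rintegral; congr fine.
have [mf mf' mh] := And3 (Lfun2_measurable fL) (Lfun2_measurable fL') (Lfun2_measurable hL).
apply: ae_eq_integral => //; try by apply/measurable_EFinP; exact: measurable_funM.
by apply: filterS ff => x /= ff xT; rewrite ff.
Qed.

Let fp : ae_eq mu setT (kavg mu K g) (mstar v u).
Proof.
have [ig I0] := mstar_weight; rewrite -bp_updateE//; by case: mstarP => _ /(_ v u vu) [].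
Qed.

Lemma kavg_mstar_Lfun : kavg mu K g \in L2.
Proof.
have [ig I0] := mstar_weight.
apply: (kavg_Lfun (psiE_mercer vu) (psiE_symm vu) c0 (psiE_bounds vu)) => //.
- by apply: msg_weight_measurable; exact: mstar_meas.
- by apply: msg_weight_ge0; exact: mstar_ge0.
Qed.

(** The fixed point equation holds only almost everywhere, which inner products do not see; thus
    tail estimates for averages of sections pass to [mstar]. *)
Lemma mstar_inner h : h \in L2 -> inner mu (kavg mu K g) h = inner mu (mstar v u) h.
Proof. by move=> hL; apply: inner_ae_eq => //; [exact: kavg_mstar_Lfun|exact: mstar_Lfun]. Qed.

Lemma mstar_tail r e2 :
  (forall N y, \sum_(r <= j < N) kcoef mu K (lam u v) (phi u v) j y ^+ 2 <= e2) ->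
  forall N, \sum_(r <= j < N) inner mu (mstar v u) (phi u v j) ^+ 2 <= e2.
Proof.
move=> he N; have [ig I0] := mstar_weight.
under eq_bigr do rewrite -mstar_inner ?(basis_Lfun (mercer_basis (psiE_mercer vu)))//.
apply: (kavg_tail (psiE_mercer vu) (psiE_symm vu) c0 (psiE_bounds vu)) => //.
- by apply: msg_weight_measurable; exact: mstar_meas.
- by apply: msg_weight_ge0; exact: mstar_ge0.
Qed.

End fixed_point_coefficients.

Section path.
Variables (r : nat) (y : nat -> V -> V -> 'I_k -> borel X).
Local Notation eta := (step_size gamma).
Local Notation ecoef v u := (edge_coef mu (psiE u v) (lam u v) (phi u v) r eta (fun s => y s v u)).
Local Notation scoef v u := (sample_coef mu (psiE u v) (lam u v) (phi u v) (fun s => y s v u)).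
Local Notation msg v u t := (comb (phi u v) r (ecoef v u t)).

Lemma sosmp_coefE v u t j : adj v u ->
  sosmp_coef mu psiV psiE phi r eta y t v u j = ecoef v u t j.
Proof.
move=> vu; elim: t => //= t ->; congr (_ + _ * (_ * _)); apply: eq_bigr => i _.
rewrite -(kcoefE (psiE_mercer vu) (psiE_symm vu) c0 (psiE_bounds vu)).
apply: eq_Rintegral => x _; congr (_ * _).
rewrite /Gamma /beta /nker -/(kmass _ _ _); field.
by rewrite !gt_eqF// (kmass_gt0 (psiE_mercer vu) c0 (psiE_bounds vu)).
Qed.

Lemma sosmp_messageE v u t : adj v u ->
  sosmp_message mu psiV psiE phi r eta y t v u = msg v u t.
Proof.
move=> vu; apply/funext => x; rewrite combE; apply: eq_bigr => j _.
by rewrite sosmp_coefE.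
Qed.

Definition pos_msg t v u : borel X -> R := pos_part (msg v u t).

Lemma sampling_weightE v u t z :
  sampling_weight mu adj psiV psiE phi r eta y t v u z =
  kmass mu (psiE u v) z * msg_weight (pos_msg t) v u z.
Proof.
rewrite /sampling_weight /beta /msg_weight -/(kmass _ _ _) [psiV v z * _]mulrC -mulrA.
congr (_ * (_ * _)); apply: eq_bigr => w /nb_adj wv; by rewrite sosmp_messageE.
Qed.

(** * Late messages on the whole graph along a fixed sample path *)

Section late_path.
Variables (t1 : nat) (Ma tau e2 : R).
Hypothesis eta01 : forall t, (t1 <= t)%N -> 0 <= eta t <= 1.
Hypothesis coefM : forall v u, adj v u -> forall t, \sum_(j < r) ecoef v u t j ^+ 2 <= Ma.
Hypothesis htail : forall v u, adj v u -> forall N x,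
  \sum_(r <= j < N) lam u v j * phi u v j x ^+ 2 <= tau.
Hypothesis htau : tau / (c * M0) <= c / (B * M0) / 2.
Hypothesis he2 : forall v u, adj v u -> forall N y,
  \sum_(r <= j < N) kcoef mu (psiE u v) (lam u v) (phi u v) j y ^+ 2 <= e2.
Variable t : nat.
Hypothesis t1t : (t1 <= t)%N.
Local Notation rho := (forget eta t1 t).
Local Notation gap := ((2 * Num.sqrt (Ma * M0) + 1) * rho + Num.sqrt (e2 * M0)).
Local Notation lo := (c / (B * M0)).
Hypothesis small : gap <= 2^-1.
Hypothesis small2 : #|V|%:R * (rho ^+ 2 * Ma) < ((1 - rho) * (lo / 2)) ^+ 2 * M0.
Hypothesis iW : forall v u, adj v u ->
  mu.-integrable setT (EFin \o sampling_weight mu adj psiV psiE phi r eta y t v u).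
Local Notation wt v u := (msg_weight (pos_msg t) v u).

Let msgL v u s : adj v u -> msg v u s \in L2.
Proof. by move=> vu; apply: comb_Lfun; exact: (mercer_basis (psiE_mercer vu)). Qed.

Lemma pos_msg_Lfun v u : adj v u -> pos_msg t v u \in L2.
Proof. by move=> vu; apply: pos_part_Lfun; exact: msgL. Qed.

Lemma pos_msg_ge0 v u x : 0 <= pos_msg t v u x.
Proof. by rewrite le_max lexx. Qed.

Let pos_msg_meas v u w : w \in nb v u -> measurable_fun setT (pos_msg t w v).
Proof. by move=> /nb_adj wv; apply: Lfun2_measurable (pos_msg_Lfun wv). Qed.

Lemma wt_measurable v u : measurable_fun setT (wt v u).
Proof. by apply: msg_weight_measurable => w; exact: pos_msg_meas. Qed.

Lemma wt_ge0 v u x : 0 <= wt v u x.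
Proof. by apply: msg_weight_ge0 => w _ z; exact: pos_msg_ge0. Qed.

Lemma wt_integrable v u : adj v u -> mu.-integrable setT (EFin \o wt v u).
Proof.
move=> vu; have z0 := kmass_gt0 (psiE_mercer vu) c0 (psiE_bounds vu).
have M00 := mass_gt0 (psiE_mercer vu).
rewrite (_ : wt v u = fun z => (kmass mu (psiE u v) z)^-1 *
   sampling_weight mu adj psiV psiE phi r eta y t v u z); last first.
  by apply/funext => z; rewrite sampling_weightE mulKf// gt_eqF.
apply: (@integrable_bounded_mul _ _ _ _ _ _ (c * M0)^-1) (iW vu).
  by apply: measurable_funV_gt0 => //; exact: (kmass_measurable (psiE_mercer vu) (psiE_symm vu)).
move=> z; rewrite gtr0_norm ?invr_gt0// lef_pV2 ?posrE ?mulr_gt0//.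
by have /andP[] := kmass_bounds (psiE_mercer vu) c0 (psiE_bounds vu) z.
Qed.

Lemma wt_kmass_integrable v u : adj v u ->
  mu.-integrable setT (EFin \o (fun z => kmass mu (psiE u v) z * wt v u z)).
Proof.
move=> vu; rewrite (_ : (fun z => _) = sampling_weight mu adj psiV psiE phi r eta y t v u).
  exact: iW.
by apply/funext => z; rewrite sampling_weightE.
Qed.

(* If the sampling weight vanished almost everywhere, some incoming message would be
   nonpositive at almost every point, which forces the remnant of the initial message to
   be bounded away from zero in L^2. *)
Lemma wt_mass_gt0 v u : adj v u -> 0 < \int[mu]_z (kmass mu (psiE u v) z * wt v u z).
Proof.
move=> vu; have z0 := kmass_gt0 (psiE_mercer vu) c0 (psiE_bounds vu).
have w0 z : 0 <= kmass mu (psiE u v) z * wt v u z by rewrite mulr_ge0 ?wt_ge0// ltW.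
have iw := wt_kmass_integrable vu.
rewrite lt_def Rintegral_ge0 ?andbT//; apply/negP => /eqP I0.
have /measurable_EFinP mw := measurable_int _ iw.
have ae0 : ae_eq mu setT (EFin \o (fun z => kmass mu (psiE u v) z * wt v u z)) (cst 0%E).
  apply/ae_eq_integral_abs => //; first exact/measurable_EFinP.
  under eq_integral do rewrite /= ger0_norm//.
  by rewrite -[LHS]fineK ?integrable_fin_num// -/(Rintegral _ _ _) I0.
(* Extended by 0 off the neighbourhood, so that the sum runs over [V]; this is the origin of [#|V|]
   in [small2]. *)
pose F w x := if w \in nb v u then (rho * msg w v t1 x) ^+ 2 else 0.
have iF w : mu.-integrable setT (EFin \o F w).
  have [wn|wn] := boolP (w \in nb v u); last first.
    rewrite (_ : F w = cst 0); first exact: finite_measure_integrable_cst.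
    by apply/funext => x; rewrite /F (negbTE wn).
  have wL := Lfun2Z rho (msgL t1 (nb_adj wn)).
  rewrite (_ : F w = fun x => (rho *: msg w v t1) x * (rho *: msg w v t1) x).
    exact: integrable_mul.
  by apply/funext => x; rewrite /F wn expr2.
have F0 w x : 0 <= F w x by rewrite /F; case: ifP => // _; exact: sqr_ge0.
have key : {ae mu, forall x, setT x -> ((((1 - rho) * (lo / 2)) ^+ 2)%:E <= (\sum_w F w x)%:E)%E}.
  apply: filterS ae0 => x /= /(_ Logic.I) [/eqP].
  rewrite mulf_eq0 (gt_eqF (z0 x))/= mulf_eq0 (gt_eqF (psiV_gt0 _ _))/=.
  move=> /prodf_eq0[w wn /eqP pw] _; have wv := nb_adj wn.
  have mw0 : msg w v t x <= 0 by rewrite leNgt; apply/negP => mp; move: pw;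
    rewrite /pos_msg /pos_part; case: ltP mp => // mp _ me; rewrite me ltxx in mp.
  have h := message_nonpos (psiE_mercer wv) c0 (psiE_bounds wv) k_gt0 eta01
    (htail wv) htau t1t mw0.
  rewrite lee_fin (bigD1 w)//= ler_wpDr ?sumr_ge0// /F wn.
  rewrite -[leRHS]real_normK ?num_real// normrM.
  have /andP[f0 f1] := forget_bounds eta01 t.
  have B0 := B_gt0 c0 (psiE_bounds wv); have M00 := mass_gt0 (psiE_mercer wv).
  rewrite (ger0_norm f0) lerXn2r ?nnegrE ?mulr_ge0 ?subr_ge0//.
  exact: ltW.
by rewrite ltW// invr_gt0 mulr_gt0.
have : (\int[mu]_x (((1 - rho) * (lo / 2)) ^+ 2)%:E <= \int[mu]_x (\sum_w F w x)%:E)%E.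
  apply: ae_ge0_le_integral => //.
  - by move=> x _; rewrite lee_fin sqr_ge0.
  - by move=> x _; rewrite lee_fin sumr_ge0.
  - by have := integrable_sum_EFin (index_enum V) iF => /measurable_int.
have iS := integrable_sum_EFin (index_enum V) iF.
move=> /fine_le; rewrite integrable_fin_num ?integrable_fin_num//; last first.
  exact: finite_measure_integrable_cst.
move=> /(_ isT isT); rewrite -/(Rintegral _ _ _) Rintegral_cst// => h.
move: small2; rewrite ltNge => /negP; apply; apply: le_trans h _.
rewrite -/(Rintegral _ _ _) Rintegral_sum//.
rewrite mulr_natl -sumr_const; apply: ler_sum => w _.
have ra : 0 <= rho ^+ 2 * Ma.
  rewrite mulr_ge0 ?sqr_ge0//; apply: le_trans (coefM vu t).
  by rewrite sumr_ge0// => j _; exact: sqr_ge0.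
have [wn|wn] := boolP (w \in nb v u); last first.
  rewrite (_ : F w = cst 0); first by rewrite Rintegral_cst// mul0r.
  by apply/funext => x; rewrite /F (negbTE wn).
have wv := nb_adj wn.
apply: le_trans (_ : _ <= inner mu (rho *: msg w v t1) (rho *: msg w v t1)) _.
  rewrite le_eqVlt; apply/orP; left; apply/eqP; apply: eq_Rintegral => x _.
  by rewrite /F wn expr2.
rewrite innerZl ?innerZr ?Lfun2Z ?msgL// mulrA -expr2 ler_wpM2l ?sqr_ge0//.
by rewrite (inner_comb2 (mercer_basis (psiE_mercer wv))) coefM.
Qed.

Local Notation nmsg := (fun v u =>
  normalised mu (psiE u v) (lam u v) (phi u v) r eta (fun s => y s v u) t).

Lemma nmsg_feasible : feasible mu adj nmsg.
Proof.
move=> v u vu; exact: (normalised_density (psiE_mercer vu) (psiE_symm vu) c0 (psiE_bounds vu)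
  k_gt0 eta01 (coefM vu) (htail vu) htau (he2 vu) t1t small).
Qed.

Let nmsgL v u : adj v u -> nmsg v u \in L2.
Proof. by case/nmsg_feasible. Qed.

Let nmsg_meas v u w : w \in nb v u -> measurable_fun setT (nmsg w v).
Proof. by move=> /nb_adj wv; apply: Lfun2_measurable (nmsgL wv). Qed.

Let nmsg_ge0 v u w : w \in nb v u -> forall x, 0 <= nmsg w v x.
Proof. by move=> /nb_adj /nmsg_feasible []. Qed.

Lemma nmsg_weight v u : exists2 s, 0 < s & msg_weight nmsg v u = fun z => s * wt v u z.
Proof.
exists (\prod_(w in nb v u) (mass mu (pos_msg t w v))^-1).
  apply: prodr_gt0 => w /nb_adj wv; rewrite invr_gt0.
  exact: (pos_part_mass_gt0 (psiE_mercer wv) (psiE_symm wv) c0 (psiE_bounds wv)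
    k_gt0 eta01 (coefM wv) (htail wv) htau (he2 wv) t1t small).
apply/funext => z; rewrite /msg_weight mulrCA -big_split/=.
by congr (_ * _); apply: eq_bigr => w _.
Qed.

(** Normalising the messages multiplies the weight by a positive constant, which cancels. So the
    mean of the sampled update is the BP update of a feasible collection, and contractivity applies
    to it. *)
Lemma nmsg_update v u : adj v u ->
  bp_defined mu adj psiV psiE nmsg v u /\
  bp_update mu adj psiV psiE nmsg v u = kavg mu (psiE u v) (wt v u).
Proof.
move=> vu; have [s s0 es] := nmsg_weight v u.
have I0 := wt_mass_gt0 vu.
have ig : mu.-integrable setT (EFin \o msg_weight nmsg v u).
  by rewrite es; apply: integrableZ_EFin; exact: wt_integrable.
have In : 0 < \int[mu]_z (kmass mu (psiE u v) z * msg_weight nmsg v u z).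
  rewrite es (_ : \int[mu]_z _ = s * \int[mu]_z (kmass mu (psiE u v) z * wt v u z)).
    by rewrite mulr_gt0.
  rewrite -RintegralZl//; last exact: wt_kmass_integrable.
  by apply: eq_Rintegral => z _; rewrite mulrCA.
split; first by apply: bp_definedP => //; [exact: nmsg_meas|exact: nmsg_ge0].
rewrite bp_updateE// es kavg_scale ?gt_eqF//; last exact: wt_kmass_integrable.
move=> x; have mK := mercer_measurable (psiE_mercer vu).
apply: (@integrable_bounded_mul _ _ _ _ _ _ B) (wt_integrable vu).
  exact: (measurable_fun_pair2 x mK).
by move=> z; have /andP[h ?] := psiE_bounds vu x z; rewrite ger0_norm// (le_trans _ h)// ltW.
Qed.

Definition coef_err s v u j : R := ecoef v u s j - inner mu (mstar v u) (phi u v j).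

Local Notation E2 := (2 * (2 * (rho ^+ 2 * Ma) + 8 * gap ^+ 2 * Ma) + 2 * e2).

(** There are three errors: of the coefficients, of normalising the positive part, and of truncating
    [mstar]. The last two are collected in [E2]. *)
Lemma nmsg_err v u (th : R) : adj v u -> 0 < th ->
  inner mu (nmsg v u - mstar v u) (nmsg v u - mstar v u) <=
  (1 + th) * \sum_(j < r) coef_err t v u j ^+ 2 + (1 + th^-1) * E2.
Proof.
move=> vu th0; have pB := mercer_basis (psiE_mercer vu).
pose pr := comb (phi u v) r (fun j => inner mu (mstar v u) (phi u v j)).
have prL : pr \in L2 by exact: comb_Lfun.
have mL := msgL t vu; have sL := mstar_Lfun vu; have nL := nmsgL vu.
have -> : nmsg v u - mstar v u = (msg v u t - pr) + ((nmsg v u - msg v u t) + (pr - mstar v u)).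
  by apply/funext => x; rewrite !fctE; ring.
apply: le_trans (inner_young th0 (Lfun2B mL prL) (Lfun2D (Lfun2B nL mL) (Lfun2B prL sL))) _.
rewrite combB (inner_comb2 pB) lerD2l ler_wpM2l ?addr_ge0 ?invr_ge0 ?(ltW th0)//.
apply: le_trans (inner_young ltr01 (Lfun2B nL mL) (Lfun2B prL sL)) _.
rewrite invr1 -[1 + 1]/(2 : R); apply: lerD; rewrite ler_wpM2l//.
  exact: (normalised_close (psiE_mercer vu) (psiE_symm vu) c0 (psiE_bounds vu)
    k_gt0 eta01 (coefM vu) (htail vu) htau (he2 vu) t1t small).
rewrite inner_sub_comb// [X in X + _]big1 ?add0r; last by move=> j _; rewrite subrr expr0n.
by apply: proj_tail => // N; apply: mstar_tail => //; exact: he2.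
Qed.

(** Bessel's inequality and contractivity bound the second factor. The estimate holds path by path,
    while the best [la] and [th] depend on bounds in expectation; they are therefore left free. *)
Lemma drift v u (la th : R) : adj v u -> 0 < la -> 0 < th ->
  2 * (\sum_(j < r) coef_err t v u j *
    (inner mu (kavg mu (psiE u v) (wt v u)) (phi u v j) - inner mu (mstar v u) (phi u v j))) <=
  la * \sum_(j < r) coef_err t v u j ^+ 2 +
  la^-1 * ((1 - gamma / 2) ^+ 2 * (#|nb v u|%:R^-1 * \sum_(w in nb v u)
    ((1 + th) * \sum_(j < r) coef_err t w v j ^+ 2 + (1 + th^-1) * E2))).
Proof.
move=> vu la0 th0; have pB := mercer_basis (psiE_mercer vu).
pose b (j : nat) := inner mu (kavg mu (psiE u v) (wt v u)) (phi u v j) -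
  inner mu (mstar v u) (phi u v j).
rewrite -[X in 2 * X]/(\sum_(j < r) coef_err t v u j * b j).
have hb : \sum_(j < r) b j ^+ 2 <= (1 - gamma / 2) ^+ 2 * (#|nb v u|%:R^-1 * \sum_(w in nb v u)
    ((1 + th) * \sum_(j < r) coef_err t w v j ^+ 2 + (1 + th^-1) * E2)).
  have FL := kavg_mstar_Lfun vu; set Fs := kavg _ _ _ in FL.
  have [bd bu] := nmsg_update vu.
  have wL : kavg mu (psiE u v) (wt v u) \in L2.
    apply: (kavg_Lfun (psiE_mercer vu) (psiE_symm vu) c0 (psiE_bounds vu)).
    - exact: wt_measurable.
    - exact: wt_ge0.
    - exact: wt_integrable.
    - exact: wt_mass_gt0.
  have -> : \sum_(j < r) b j ^+ 2 =
      \sum_(j < r) inner mu (kavg mu (psiE u v) (wt v u) - Fs) (phi u v j) ^+ 2.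
    apply: eq_bigr => j _; have pL := basis_Lfun pB j.
    by rewrite innerBl// mstar_inner.
  apply: le_trans (bessel pB _ _) _; first exact: Lfun2B.
  have [mf mfp] := mstarP.
  have := contr vu nmsg_feasible mf bd (mfp _ _ vu).1.
  have [ig I0] := mstar_weight vu.
  rewrite bu (bp_updateE vu ig).
  set S := \sum_(w in _) _ => hc.
  have S0 : 0 <= #|nb v u|%:R^-1 * S.
    by rewrite mulr_ge0 ?invr_ge0// sumr_ge0// => w _; exact: sqr_ge0.
  have k1 : 0 <= 1 - gamma / 2 by rewrite subr_ge0 ler_pdivrMr// mul1r ltW.
  have h2 : inner mu (kavg mu (psiE u v) (wt v u) - Fs) (kavg mu (psiE u v) (wt v u) - Fs) <=
      (1 - gamma / 2) ^+ 2 * (#|nb v u|%:R^-1 * S).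
    rewrite -L2norm_sqr ?Lfun2B// -[X in _ * X](sqr_sqrtr S0) -exprMn lerXn2r ?nnegrE//.
      exact: L2norm_ge0.
    by rewrite mulr_ge0// sqrtr_ge0.
  apply: le_trans h2 _; rewrite ler_wpM2l ?sqr_ge0// ler_wpM2l ?invr_ge0//.
  apply: ler_sum => w /nb_adj wv.
  rewrite (_ : L2norm mu _ ^+ 2 = inner mu (nmsg w v - mstar w v) (nmsg w v - mstar w v)).
    exact: nmsg_err.
  by rewrite -L2norm_sqr// Lfun2B// ?nmsgL// mstar_Lfun.
apply: le_trans (_ : _ <= la * \sum_(j < r) coef_err t v u j ^+ 2 + la^-1 * \sum_(j < r) b j ^+ 2) _.
  rewrite !mulr_sumr -big_split/=; apply: ler_sum => j _.
  have := mulr_ge0 (ltW la0) (sqr_ge0 (coef_err t v u j - la^-1 * b j)).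
  have -> : la * (coef_err t v u j - la^-1 * b j) ^+ 2 =
    la * coef_err t v u j ^+ 2 - 2 * (coef_err t v u j * b j) + la^-1 * b j ^+ 2.
    by field; rewrite gt_eqF.
  lra.
by rewrite lerD2l ler_wpM2l// invr_ge0 ltW.
Qed.

End late_path.

End path.

(** Convexity of the square when the step is at most 1, and [(a + b)^2 <= 2 a^2 + 2 b^2] in general,
    bring each edge under [relaxation_bounded]; the initial sum is 1/r. One [Ma] serves all [r], all
    samples and all edges. *)
Lemma edge_coef_bounded : exists2 Ma, 0 <= Ma & forall r y v u t, (0 < r)%N -> adj v u ->
  \sum_(j < r) edge_coef mu (psiE u v) (lam u v) (phi u v) r (step_size gamma) (k := k)
     (fun s => y s v u) t j ^+ 2 <= Ma.
Proof.
have [[[v0 u0] vu0]|no] := pselect (exists e : V * V, adj e.1 e.2); last first.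
  by exists 0 => // r y v u t _ vu; exfalso; apply: no; exists (v, u).
have Q0 : 0 <= kbound mu c B by rewrite mulr_ge0 ?sqr_ge0// ltW// (mass_gt0 (psiE_mercer vu0)).
have [Ma Ma0 HM] := relaxation_bounded gamma_gt0 Q0.
exists Ma => // r y v u t r0 vu; move: t.
have sc t := sample_coef_sqr (psiE_mercer vu) (psiE_symm vu) c0 (psiE_bounds vu) r (fun s => y s v
  u) k_gt0 t.
apply: HM => [|t|t|t e1] /=.
- rewrite sumr_const card_ord -[X in X *+ _]mulr1 -mulrnAr exprVn.
  rewrite -[r%:R ^+ 2]/(r%:R * r%:R) invfM -mulrA mulVf ?mulr1 ?pnatr_eq0 ?gtn_eqF//.
  by rewrite invf_le1 ?ltr0n// ler1n.
- by rewrite sumr_ge0// => j _; rewrite sqr_ge0.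
- apply: le_trans (_ : _ <= \sum_(j < r) (2 * (1 - step_size gamma t) ^+ 2 * edge_coef mu (psiE u
  v) (lam u v) (phi u v) r (step_size gamma) (fun s => y s v u) t j ^+ 2 + 2 * step_size gamma t
  ^+ 2 * sample_coef mu (psiE u v) (lam u v) (phi u v) (fun s => y s v u) t j ^+ 2)) _.
    apply: ler_sum => j _; set a := (1 - _) * _; set b := step_size _ _ * _.
    have -> : 2 * (1 - step_size gamma t) ^+ 2 * edge_coef mu (psiE u v) (lam u v) (phi u v) r
      (step_size gamma) (fun s => y s v u) t j ^+ 2 = 2 * a ^+ 2 by rewrite /a; ring.
    have -> : 2 * step_size gamma t ^+ 2 * sample_coef mu (psiE u v) (lam u v) (phi u v) (fun s =>
      y s v u) t j ^+ 2 = 2 * b ^+ 2 by rewrite /b; ring.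
    have := sqr_ge0 (a - b); lra.
  by rewrite big_split/= -!mulr_sumr lerD2l ler_wpM2l// mulr_ge0// sqr_ge0.
- apply: le_trans (_ : _ <= \sum_(j < r) ((1 - step_size gamma t) * edge_coef mu (psiE u v) (lam u
  v) (phi u v) r (step_size gamma) (fun s => y s v u) t j ^+ 2 + step_size gamma t * sample_coef
  mu (psiE u v) (lam u v) (phi u v) (fun s => y s v u) t j ^+ 2)) _.
    apply: ler_sum => j _; have := step_size_gt0 t gamma_gt0.
    move: (edge_coef _ _ _ _ _ _ _ _ _) (sample_coef _ _ _ _ _ _ _) (step_size _ _) e1 => a b e e1 e0.
    have := mulr_ge0 (mulr_ge0 (ltW e0) (ltac:(lra) : 0 <= 1 - e)) (sqr_ge0 (a - b)); lra.
  by rewrite big_split/= -!mulr_sumr lerD2l ler_wpM2l// ltW// step_size_gt0.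
Qed.

End graph.

(** * One iteration in mean square *)

(** In the application [s] is the step size and [ka = 1 - g / 2]; the coefficient of [d ^+ 2] arises
    as [(1 - 2 * s) + s * (2 - g)]. *)
Lemma step_combine (R : realFieldType) (s g ka d e x y C : R) :
  s * (1 - s) * (2 * x) <= s * (1 - s) * (2 * ka * d * (d + e)) ->
  (1 - 2 * s) * y <= (1 - 2 * s) * d ^+ 2 ->
  s * (1 - s) * (2 * ka * d * (d + e)) <= s * (2 * ka * d * (d + e)) ->
  s * (2 * ka * (d * e)) <= s * (2 * (d * e)) ->
  s * (2 * ka * d * (d + e)) = s * (2 - g) * d ^+ 2 + s * (2 * ka * (d * e)) ->
  (1 - 2 * s) * y + (2 * s * (1 - s) * x + s ^+ 2 * C) <=
  (1 - s * g) * d ^+ 2 + 2 * s * d * e + s ^+ 2 * C.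
Proof. by move=> h1 h2 h3 h4 h5; lra. Qed.

Section run.
Context {R : realType} {X : ptopologicalType}.
Variable mu : {finite_measure set (borel X) -> \bar R}.
Context {V : finType}.
Variables (adj : rel V) (psiV : V -> borel X -> R) (psiE : V -> V -> borel X -> borel X -> R).
Variables (lam : V -> V -> nat -> R) (phi : V -> V -> nat -> borel X -> R).
Variables (mstar : V -> V -> borel X -> R) (gamma c B : R) (k : nat).
Hypothesis adj_sym : symmetric adj.
Hypothesis psiV_meas : forall u, measurable_fun setT (psiV u).
Hypothesis psiV_gt0 : forall u x, 0 < psiV u x.
Hypothesis c0 : 0 < c.
Hypothesis psiE_bounds : forall v u, adj v u -> forall x y, c <= psiE u v x y <= B.
Hypothesis psiE_symm : forall v u, adj v u -> symmetric_kernel (psiE u v).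
Hypothesis psiE_mercer : forall v u, adj v u -> mercer_system mu (psiE u v) (lam u v) (phi u v).
Hypothesis gamma_gt0 : 0 < gamma.
Hypothesis gamma_lt2 : gamma < 2.
Hypothesis contr : bp_contractive mu adj psiV psiE gamma.
Hypothesis mstarP : bp_fixed_point mu adj psiV psiE mstar.
Hypothesis k_gt0 : (0 < k)%N.

Local Notation M0 := (fine (mu setT)).
Local Notation eta := (step_size gamma).

Context {dO : measure_display} {Omega : measurableType dO}.
Variables (P : probability Omega R) (nu : probability (borel X) R).
Variables (r : nat) (Y : nat -> V -> V -> 'I_k -> Omega -> borel X).
Hypothesis runP : sosmp_run mu adj psiV psiE phi r eta P nu Y.
Local Notation path := (sample_path Y).
Local Notation ecoef w v u :=
  (edge_coef mu (psiE u v) (lam u v) (phi u v) r eta (fun s => path w s v u)).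
Local Notation kc v u := (kcoef mu (psiE u v) (lam u v) (phi u v)).

Definition past (t : nat) : set (set Omega) :=
  [set B | exists s v u i (A : set (borel X)),
         [/\ (s < t)%N, adj v u, measurable A & B = Y s v u i @^-1` A]].

Lemma Y_measurable t v u i : adj v u -> measurable_fun setT (Y t v u i).
Proof. by case: runP => + _ _; apply. Qed.

Lemma past_measurable t D : past t D -> measurable D.
Proof.
move=> [s [v [u [i [A [_ vu mA ->]]]]]]; rewrite -[_ @^-1` _]setTI.
exact: Y_measurable.
Qed.

Local Notation Om t := (g_sigma_algebraType (past t)).

Lemma Y_past t s v u i : (s < t)%N -> adj v u ->
  measurable_fun setT (Y s v u i : Om t -> borel X).
Proof.
move=> st vu _ A mA; rewrite setTI; apply: sub_sigma_algebra.
by exists s, v, u, i, A.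
Qed.

(** Coefficients at time [s] involve only samples drawn strictly before [s], so [s = t] is
    allowed. *)
Lemma ecoef_past t s v u j : (s <= t)%N -> adj v u ->
  measurable_fun setT ((fun w => ecoef w v u s j) : Om t -> R).
Proof.
move=> + vu; elim: s => [_|s IH st]; first exact: measurable_cst.
apply: measurable_funD; apply: measurable_funM => //; first exact: IH (ltnW st).
apply: measurable_funM => //; apply: measurable_sum => i.
apply: (@measurableT_comp _ _ _ _ _ _ (kc v u j)); last exact: Y_past.
exact: (kcoef_measurable (psiE_mercer vu) (psiE_symm vu) c0 (psiE_bounds vu)).
Qed.

Variable (Ma : R).
Hypothesis coefM : forall (y : nat -> V -> V -> 'I_k -> borel X) v u t, adj v u ->
  \sum_(j < r) edge_coef mu (psiE u v) (lam u v) (phi u v) r eta (fun s => y s v u) t j ^+ 2 <= Ma.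

Lemma ecoef_bm t v u (j : 'I_r) : adj v u ->
  bounded_measurable ((fun w => ecoef w v u t j) : Om t -> R).
Proof.
move=> vu; split; first exact: ecoef_past.
exists (Num.sqrt Ma) => w; rewrite -sqrtr_sqr ler_wsqrtr//.
apply: le_trans (coefM (path w) t vu); rewrite (bigD1 j)//= lerDl.
by rewrite sumr_ge0// => i _; exact: sqr_ge0.
Qed.

Local Notation cerr w t v u j :=
  (coef_err mu psiE lam phi mstar gamma r (path w) t v u j).

Lemma coef_err_bm t v u (j : 'I_r) : adj v u ->
  bounded_measurable ((fun w => cerr w t v u j) : Om t -> R).
Proof.
move=> vu; apply: (@bounded_measurableD _ (Om t) R); first exact: ecoef_bm.
exact: bounded_measurable_cst.
Qed.

Definition sq_err t v u (w : Omega) : R := \sum_(j < r) cerr w t v u j ^+ 2.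

Lemma bounded_measurable_past t (U : Om t -> R) :
  bounded_measurable U -> bounded_measurable (U : Omega -> R).
Proof.
move=> [mU bU]; split=> //.
by apply: measurable_fun_generated mU; exact: past_measurable.
Qed.

Lemma sq_err_bm t v u : adj v u -> bounded_measurable (sq_err t v u).
Proof.
move=> vu; apply: (@bounded_measurable_past t); apply: (@bounded_measurable_sum _ (Om t)) => j.
by under eq_fun do rewrite expr2; apply: (@bounded_measurableM _ (Om t)); exact: coef_err_bm.
Qed.

Section step.
Variables (t1 t : nat) (tau e2 : R).
Hypothesis eta01 : forall t, (t1 <= t)%N -> 0 <= eta t <= 1.
Hypothesis htail : forall v u, adj v u -> forall N x,
  \sum_(r <= j < N) lam u v j * phi u v j x ^+ 2 <= tau.
Hypothesis htau : tau / (c * M0) <= c / (B * M0) / 2.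
Hypothesis he2 : forall v u, adj v u -> forall N y,
  \sum_(r <= j < N) kc v u j y ^+ 2 <= e2.
Hypothesis t1t : (t1 <= t)%N.
Local Notation rho := (forget eta t1 t).
Local Notation gap := ((2 * Num.sqrt (Ma * M0) + 1) * rho + Num.sqrt (e2 * M0)).
Local Notation lo := (c / (B * M0)).
Hypothesis small : gap <= 2^-1.
Hypothesis small2 : #|V|%:R * (rho ^+ 2 * Ma) < ((1 - rho) * (lo / 2)) ^+ 2 * M0.

Local Notation wt w v u :=
  (msg_weight adj psiV (pos_msg mu psiE lam phi gamma r (path w) t) v u).
Local Notation zmass w v u := (\int[mu]_z (kmass mu (psiE u v) z * wt w v u z)).

Let iW w v u : adj v u ->
  mu.-integrable setT (EFin \o sampling_weight mu adj psiV psiE phi r eta (path w) t v u).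
Proof. by case: runP => _ + _; apply. Qed.

Let weightE w v u z : adj v u -> sampling_weight mu adj psiV psiE phi r eta (path w) t v u z =
  kmass mu (psiE u v) z * wt w v u z.
Proof.
move=> vu; exact: sampling_weightE adj_sym psiV_gt0 c0 psiE_bounds psiE_symm psiE_mercer _ _ _ _ _ _.
Qed.

Let zmass_gt0 w v u : adj v u -> 0 < zmass w v u.
Proof.
move=> vu.
exact: (wt_mass_gt0 adj_sym psiV_gt0 c0 psiE_bounds psiE_symm psiE_mercer
  k_gt0 eta01 (fun v u vu t => coefM (path w) t vu) htail htau t1t small2 (iW w) vu).
Qed.

Let iZ w v u : adj v u ->
  mu.-integrable setT (EFin \o (fun z => kmass mu (psiE u v) z * wt w v u z)).
Proof.
move=> vu; have := iW w vu.
by congr (_.-integrable _ _); apply/funext => z; rewrite /= weightE.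
Qed.

Definition sampling_density v u (w : Omega) (z : borel X) : R :=
  (zmass w v u)^-1 * (kmass mu (psiE u v) z * wt w v u z).

Let density_measurable v u : adj v u ->
  measurable_fun setT (fun p : Om t * borel X => sampling_density v u p.1 p.2).
Proof.
move=> vu.
have mz : measurable_fun setT (fun p : Om t * borel X => kmass mu (psiE u v) p.2 * wt p.1 v u p.2).
  apply: measurable_funM.
    apply: (@measurableT_comp _ _ _ _ _ _ (kmass mu (psiE u v)) _ snd) => //.
    exact: (kmass_measurable (psiE_mercer vu) (psiE_symm vu)).
  apply: measurable_funM; first exact: measurableT_comp.
  under eq_fun do rewrite -big_filter.
  apply: measurable_prod => w'; rewrite mem_filter => /andP[/(nb_adj adj_sym) wv _].
  rewrite /pos_msg /pos_part; apply: measurable_maxr => //.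
  under eq_fun do rewrite combE.
  apply: measurable_sum => j; apply: measurable_funM.
    apply: (@measurableT_comp _ _ _ _ _ _ ((fun w => ecoef w w' v t j) : Om t -> R) _ fst) => //.
    exact: ecoef_past.
  apply: (@measurableT_comp _ _ _ _ _ _ (phi v w' j) _ snd) => //.
  exact: (mercer_phi_measurable (psiE_mercer wv)).
apply: measurable_funM => //.
apply: (@measurableT_comp _ _ _ _ _ _ ((fun w => (zmass w v u)^-1) : Om t -> R) _ fst) => //.
apply: measurable_funV_gt0; last by move=> w; exact: zmass_gt0.
exact: (@measurable_param_Rintegral _ _ (Om t) (borel X) R mu
  (fun p => kmass mu (psiE u v) p.2 * wt p.1 v u p.2) setT measurableT mz).
Qed.

(** Positivity of the total weight rules out the fallback branch. *)
Lemma sampling_lawE v u w A : adj v u -> measurable A ->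
  sampling_law mu adj psiV psiE phi r eta nu (path w) t v u A =
  \int[mu]_(z in A) sampling_density v u w z.
Proof.
move=> vu mA; rewrite /sampling_law.
have e D : \int[mu]_(z in D) sampling_weight mu adj psiV psiE phi r eta (path w) t v u z =
    \int[mu]_(z in D) (kmass mu (psiE u v) z * wt w v u z).
  by apply: eq_Rintegral => z _; rewrite weightE.
rewrite !e gt_eqF ?zmass_gt0// mulrC RintegralZl//.
exact: (integrableS measurableT mA (@subsetT _ _) (iZ w vu)).
Qed.

Let density_ge0 v u w z : adj v u -> 0 <= sampling_density v u w z.
Proof.
move=> vu; rewrite mulr_ge0 ?invr_ge0 ?(ltW (zmass_gt0 _ _))// mulr_ge0//.
  by rewrite ltW// (kmass_gt0 (psiE_mercer vu) c0 (psiE_bounds vu)).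
by apply: msg_weight_ge0 => // w' _ x; exact: pos_msg_ge0.
Qed.

Let density_int v u w : adj v u -> \int[mu]_z sampling_density v u w z = 1.
Proof. by move=> vu; rewrite RintegralZl ?iZ// mulVf// gt_eqF// zmass_gt0. Qed.

(** The rectangle in the definition of a run is taken to be the whole space in every coordinate but
    one; the other laws then contribute factors 1. *)
Lemma sample_rectangle v u i D A : adj v u -> history adj Y t D -> measurable A ->
  P (D `&` Y t v u i @^-1` A) =
  (\int[P]_(w in D) (\int[mu]_(z in A) sampling_density v u w z)%:E)%E.
Proof.
move=> vu hD mA.
pose A' v' u' i' := if [&& v' == v, u' == u & i' == i] then A else setT.
have mA' v' u' i' : measurable (A' v' u' i') by rewrite /A'; case: ifP.
case: runP => _ _ /(_ t D A' hD mA').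
have -> : [set w | forall v' u' i', adj v' u' -> A' v' u' i' (Y t v' u' i' w)] =
    Y t v u i @^-1` A.
  apply/seteqP; split => w /=.
    by move=> /(_ v u i vu); rewrite /A' !eqxx.
  by move=> h v' u' i' _; rewrite /A'; case: ifP => // /and3P[/eqP-> /eqP-> /eqP->].
move=> ->; apply: eq_integral => w _; congr EFin.
have law1 v' u' : adj v' u' ->
    sampling_law mu adj psiV psiE phi r eta nu (path w) t v' u' setT = 1.
  by move=> vu'; rewrite sampling_lawE// density_int.
rewrite (bigD1 (v, u))//= (bigD1 i)//= /A' !eqxx/= sampling_lawE//.
rewrite big1 ?mulr1 => [|i' /negbTE ->]; last exact: law1.
rewrite big1 ?mulr1// => -[v' u']/= /andP[vu' ne].
rewrite big1// => i' _; rewrite ifF ?law1//.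
by move: ne; rewrite xpair_eqE; case: (v' == v); case: (u' == u).
Qed.

Local Notation bbar w v u j := (inner mu (kavg mu (psiE u v) (wt w v u)) (phi u v j)).

Let kc_bm v u j : adj v u -> bounded_measurable (kc v u j).
Proof.
move=> vu; split.
  exact: (kcoef_measurable (psiE_mercer vu) (psiE_symm vu) c0 (psiE_bounds vu)).
exists (Num.sqrt (kbound mu c B)).
exact: (kcoef_norm (psiE_mercer vu) (psiE_symm vu) c0 (psiE_bounds vu)).
Qed.

Let density_integrable v u w : adj v u ->
  mu.-integrable setT (EFin \o sampling_density v u w).
Proof. by move=> vu; apply: integrableZ_EFin; exact: iZ. Qed.

Let pos_meas w v w' : w' \in neighbors adj v ->
  measurable_fun setT (pos_msg mu psiE lam phi gamma r (path w) t w' v).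
Proof.
rewrite inE adj_sym => wv; apply: (@Lfun2_measurable _ _ _ mu).
by apply: pos_part_Lfun; apply: comb_Lfun; exact: (mercer_basis (psiE_mercer wv)).
Qed.

Lemma bbarE w v u j : adj v u ->
  bbar w v u j = \int[mu]_z (kc v u j z * sampling_density v u w z).
Proof.
move=> vu; rewrite (kavg_coef (psiE_mercer vu) (psiE_symm vu) c0 (psiE_bounds vu))//.
- apply: msg_weight_measurable => // w' w'n.
  by apply: pos_meas; move: w'n; rewrite inE => /andP[].
- by move=> z; apply: msg_weight_ge0 => // w' _ x; exact: pos_msg_ge0.
- have z0 := kmass_gt0 (psiE_mercer vu) c0 (psiE_bounds vu).
  exact: (wt_integrable adj_sym psiV_gt0 c0 psiE_bounds psiE_symm psiE_mercer (iW w) vu).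
- exact: zmass_gt0.
Qed.

Lemma bbar_bm v u j : adj v u -> bounded_measurable ((fun w => bbar w v u j) : Om t -> R).
Proof.
move=> vu; have [mk [M kM]] := kc_bm j vu.
rewrite (_ : (fun w => _) = (fun w => \int[mu]_z (kc v u j z * sampling_density v u w z))).
  split; first exact: (@cond_measurable _ _ Omega (borel X) R mu (past t) (sampling_density v u)
      (density_measurable vu) _ mk).
  exists M => w; apply: (@cond_le _ _ Omega (borel X) R mu (past t) (sampling_density v u)) => //.
  - by move=> w' z; exact: density_ge0.
  - by move=> w'; exact: density_integrable.
  - by move=> w'; exact: density_int.
by apply/funext => w; rewrite bbarE.
Qed.

Lemma sample_expectation v u i (j : 'I_r) : adj v u ->
  \int[P]_w (cerr w t v u j * kc v u j (Y t v u i w)) =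
  \int[P]_w (cerr w t v u j * bbar w v u j).
Proof.
move=> vu.
have e := @conditional_expectation _ _ Omega (borel X) R P mu (past t) (@past_measurable t)
  (Y t v u i) (sampling_density v u) (Y_measurable t i vu) (density_measurable vu)
  (fun w z => density_ge0 w z vu) (fun w => density_integrable w vu) (fun w => density_int w vu)
  (fun D A hD mA => sample_rectangle i vu hD mA) _ (kc v u j) (coef_err_bm t j vu) (kc_bm j vu).
by apply: (etrans e); apply: eq_Rintegral => w _; rewrite bbarE.
Qed.

Local Notation astar v u j := (inner mu (mstar v u) (phi u v j)).
Local Notation scoef w v u :=
  (sample_coef mu (psiE u v) (lam u v) (phi u v) (fun s => path w s v u) t).

Let cerr_bm v u (j : 'I_r) (vu : adj v u) := bounded_measurable_past (coef_err_bm t j vu).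
Let bb_bm v u j (vu : adj v u) := bounded_measurable_past (bbar_bm j vu).

Let kcY_bm v u i j : adj v u -> bounded_measurable (fun w => kc v u j (Y t v u i w)).
Proof.
move=> vu; have [mk [M kM]] := kc_bm j vu; split; last by exists M => w.
by apply: measurableT_comp => //; exact: Y_measurable.
Qed.

Let scoef_bm v u j : adj v u -> bounded_measurable (fun w => scoef w v u j).
Proof.
by move=> vu; apply: bounded_measurableZ; apply: bounded_measurable_sum => i; exact: kcY_bm.
Qed.

(** The current error depends only on the past, so each of the [k] samples may be replaced by its
    conditional mean, the coefficient of the BP update. *)
Lemma drift_expectation v u : adj v u ->
  \int[P]_w (\sum_(j < r) cerr w t v u j * (scoef w v u j - astar v u j)) =
  \int[P]_w (\sum_(j < r) cerr w t v u j * (bbar w v u j - astar v u j)).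
Proof.
move=> vu; have bI := @bounded_measurable_integrable _ Omega R P.
have bM := @bounded_measurableM _ Omega R; have bC a := @bounded_measurable_cst _ Omega R a.
have bN f (a : R) : bounded_measurable f -> bounded_measurable (fun w : Omega => f w - a).
  by move=> bf; apply: (bounded_measurableD bf); exact: bounded_measurable_cst.
rewrite Rintegral_sum; last by move=> j; apply: bI; apply: bM; [exact: cerr_bm|apply: bN; exact:
  scoef_bm].
rewrite Rintegral_sum; last by move=> j; apply: bI; apply: bM; [exact: cerr_bm|apply: bN; exact:
  bb_bm].
apply: eq_bigr => j _.
transitivity (\int[P]_w (cerr w t v u j * scoef w v u j) -
    \int[P]_w (cerr w t v u j * astar v u j)).
  rewrite -RintegralB//; [|by apply: bI; apply: bM; [exact: cerr_bm|exact: scoef_bm]|by apply: bI;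
    apply: bM; [exact: cerr_bm|exact: bC]].
  by apply: eq_Rintegral => w _; rewrite mulrBr.
transitivity (\int[P]_w (cerr w t v u j * bbar w v u j) -
    \int[P]_w (cerr w t v u j * astar v u j)); last first.
  rewrite -RintegralB//; [|by apply: bI; apply: bM; [exact: cerr_bm|exact: bb_bm]|by apply: bI;
    apply: bM; [exact: cerr_bm|exact: bC]].
  by apply: eq_Rintegral => w _; rewrite mulrBr.
congr (_ - _).
transitivity (k%:R^-1 * \sum_(i < k) \int[P]_w (cerr w t v u j * kc v u j (Y t v u i w))).
  rewrite -Rintegral_sum; last by move=> i; apply: bI; apply: bM; [exact: cerr_bm|exact: kcY_bm].
  rewrite -RintegralZl//; last first.
    by apply: bI; apply: bounded_measurable_sum => i; apply: bM; [exact: cerr_bm|exact: kcY_bm].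
  by apply: eq_Rintegral => w _; rewrite /sample_coef mulrCA mulr_sumr.
under eq_bigr do rewrite sample_expectation//.
by rewrite sumr_const card_ord -[X in _ * X]mulr_natl mulKf// pnatr_eq0 -lt0n.
Qed.

Lemma astar_sqr_le v u : adj v u -> \sum_(j < r) astar v u j ^+ 2 <= kbound mu c B.
Proof.
move=> vu; rewrite -(big_mkord xpredT (fun j => astar v u j ^+ 2)).
apply: (mstar_tail adj_sym psiV_meas psiV_gt0 c0 psiE_bounds psiE_symm psiE_mercer mstarP vu) => N z.
rewrite big_mkord.
exact: (kcoef_bessel (psiE_mercer vu) (psiE_symm vu) c0 (psiE_bounds vu)).
Qed.

Let sumB_sqr (a b : nat -> R) :
  \sum_(j < r) (a j - b j) ^+ 2 <= 2 * \sum_(j < r) a j ^+ 2 + 2 * \sum_(j < r) b j ^+ 2.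
Proof.
rewrite !mulr_sumr -big_split/=; apply: ler_sum => j _.
have := sqr_ge0 (a j + b j); lra.
Qed.

Lemma sq_err_le v u w : adj v u -> sq_err t v u w <= 2 * Ma + 2 * kbound mu c B.
Proof.
move=> vu; rewrite /sq_err /coef_err.
apply: le_trans (sumB_sqr (fun j => ecoef w v u t j) (fun j => astar v u j)) _.
by apply: lerD; rewrite ler_wpM2l// ?coefM// astar_sqr_le.
Qed.

Hypothesis eta2 : eta t <= 2^-1.
Local Notation E2 := (2 * (2 * (rho ^+ 2 * Ma) + 8 * gap ^+ 2 * Ma) + 2 * e2).

(** The new error is [1 - eta t] times the old one plus [eta t] times that of the sampled
    coefficients. After squaring, the mean of the cross term is contracted by [1 - gamma / 2] up to
    the bias [e]. That [eta t] is at most 1/2 keeps [1 - 2 * eta t] nonnegative, so that [d ^+ 2]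
    can be inserted. *)
Lemma sq_err_step (d e : R) : 0 < d -> 0 < e -> E2 <= e ^+ 2 ->
  (forall v u, adj v u -> \int[P]_w sq_err t v u w <= d ^+ 2) ->
  forall v u, adj v u -> \int[P]_w sq_err t.+1 v u w <=
    (1 - eta t * gamma) * d ^+ 2 + 2 * eta t * d * e +
    eta t ^+ 2 * (2 * Ma + 6 * kbound mu c B).
Proof.
move=> d0 e0 Ee hd v u vu; have bI := @bounded_measurable_integrable _ Omega R P.
have e00 := step_size_gt0 t gamma_gt0.
pose D w := \sum_(j < r) cerr w t v u j * (scoef w v u j - astar v u j).
pose D' w := \sum_(j < r) cerr w t v u j * (bbar w v u j - astar v u j).
have bN f (a : R) : bounded_measurable f -> bounded_measurable (fun w : Omega => f w - a).
  by move=> bf; apply: (bounded_measurableD bf); exact: bounded_measurable_cst.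
have bD : bounded_measurable D.
  apply: bounded_measurable_sum => j; apply: bounded_measurableM; first exact: cerr_bm.
  by apply: bN; exact: scoef_bm.
have bD' : bounded_measurable D'.
  apply: bounded_measurable_sum => j; apply: bounded_measurableM; first exact: cerr_bm.
  by apply: bN; exact: bb_bm.
set kb := kbound mu c B.
(* The square [(1 - eta t) ^+ 2] is split into [1 - 2 * eta t] and [eta t ^+ 2]. The latter joins
   the sampling term: [2 * Ma + 2 * kb] from the old error and [4 * kb] from the samples. *)
have pw w : sq_err t.+1 v u w <= (1 - 2 * eta t) * sq_err t v u w +
    (2 * eta t * (1 - eta t) * D w + eta t ^+ 2 * (2 * Ma + 6 * kb)).
  have -> : sq_err t.+1 v u w = (1 - eta t) ^+ 2 * sq_err t v u w +
     2 * eta t * (1 - eta t) * D w +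
     eta t ^+ 2 * \sum_(j < r) (scoef w v u j - astar v u j) ^+ 2.
    rewrite /sq_err /D !mulr_sumr -!big_split/=; apply: eq_bigr => j _.
    by rewrite /coef_err/=; ring.
  have h1 := sq_err_le w vu.
  have h2 : \sum_(j < r) (scoef w v u j - astar v u j) ^+ 2 <= 2 * kb + 2 * kb.
    apply: le_trans (sumB_sqr (fun j => scoef w v u j) (fun j => astar v u j)) _.
    apply: lerD; rewrite ler_wpM2l// ?astar_sqr_le//.
    exact: (sample_coef_sqr (psiE_mercer vu) (psiE_symm vu) c0 (psiE_bounds vu)).
  have := ler_wpM2l (sqr_ge0 (eta t)) h1; have := ler_wpM2l (sqr_ge0 (eta t)) h2.
  rewrite -/kb; lra.
have i1 v' u' : adj v' u' -> P.-integrable setT (EFin \o sq_err t v' u').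
  by move=> vu'; apply: bI; exact: sq_err_bm.
have Z0 (a : R) : \int[P]_w (cst a w) = a.
  by rewrite Rintegral_cst//= probability_setT mulr1.
have iC (a : R) : P.-integrable setT (EFin \o (cst a : Omega -> R)).
  by apply: bI; exact: bounded_measurable_cst.
apply: le_trans (_ : _ <= (1 - 2 * eta t) * \int[P]_w sq_err t v u w +
    (2 * eta t * (1 - eta t) * \int[P]_w D w + eta t ^+ 2 * (2 * Ma + 6 * kb))) _.
  rewrite -[X in _ + (_ + X)]Z0 -!RintegralZl//; try exact: bI; try exact: i1.
  have iD1 : P.-integrable setT (EFin \o (fun w => 2 * eta t * (1 - eta t) * D w)).
    by apply: integrableZ_EFin; exact: bI.
  have iD2 : P.-integrable setT (EFin \o (fun w => (1 - 2 * eta t) * sq_err t v u w)).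
    by apply: integrableZ_EFin; exact: i1.
  have iD3 : P.-integrable setT (EFin \o (fun w => 2 * eta t * (1 - eta t) * D w +
      cst (eta t ^+ 2 * (2 * Ma + 6 * kb)) w)).
    exact: integrableD_EFin.
  rewrite -!RintegralD//.
  apply: le_Rintegral => //.
  - by apply: bI; exact: sq_err_bm.
  - exact: integrableD_EFin.
rewrite drift_expectation// -/D'.
set ka := 1 - gamma / 2.
have ka0 : 0 < ka by rewrite subr_gt0 ltr_pdivrMr// mul1r.
have ka1 : ka <= 1 by rewrite gerBl divr_ge0// ltW.
have key : 2 * \int[P]_w D' w <= 2 * ka * d * (d + e).
  (* The minimising values: [th] turns the weighted sum of squares into [(d + e) ^+ 2], and [la]
     then yields [2 * ka * d * (d + e)]. *)
  pose la := ka * (d + e) / d; pose th := e / d.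
  have la0 : 0 < la by rewrite divr_gt0// mulr_gt0// addr_gt0.
  have th0 : 0 < th by rewrite divr_gt0.
  pose n : R := #|neighbors adj v :\ u|%:R.
  pose F w' w := if w' \in neighbors adj v :\ u
    then (1 + th) * sq_err t w' v w + (1 + th^-1) * e ^+ 2 else 0.
  have bF w' : bounded_measurable (F w').
    rewrite /F; have [/(nb_adj adj_sym) wv|_] := boolP (w' \in _); last exact: bounded_measurable_cst.
    apply: bounded_measurableD; last exact: bounded_measurable_cst.
    by apply: bounded_measurableZ; exact: sq_err_bm.
  pose S w := \sum_w' F w' w.
  have bS : bounded_measurable S by apply: bounded_measurable_sum.
  have DA w : 2 * D' w <= la * sq_err t v u w + (la^-1 * ka ^+ 2 * n^-1) * S w.
    have := drift adj_sym psiV_meas psiV_gt0 c0 psiE_bounds psiE_symm psiE_mercer gamma_lt2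
      contr mstarP k_gt0 eta01 (fun v u vu t => coefM (path w) t vu) htail htau he2 t1t
      small small2 (iW w) vu la0 th0.
    rewrite -/(D' w) => /le_trans; apply; rewrite -/(sq_err t v u w) lerD2l.
    have -> : la^-1 * ka ^+ 2 * n^-1 * S w = la^-1 * (ka ^+ 2 * (n^-1 * S w)) by rewrite !mulrA.
    rewrite ler_wpM2l ?invr_ge0 ?(ltW la0)// ler_wpM2l ?sqr_ge0// ler_wpM2l ?invr_ge0//.
    rewrite /S [X in X <= _]big_mkcond/=; apply: ler_sum => w' _; rewrite /F.
    case: ifP => // _; rewrite -/(sq_err t w' v w) lerD2l ler_wpM2l// addr_ge0//.
    by rewrite invr_ge0 ltW.
  have ES : \int[P]_w S w <= n * (d + e) ^+ 2.
    rewrite Rintegral_sum; last by move=> w'; exact: bI.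
    rewrite /n mulr_natl -sumr_const big_mkcond/= [leRHS]big_mkcond/=; apply: ler_sum => w' _.
    rewrite /F; case: ifP => [w'n|_]; last by rewrite Z0.
    have wv := nb_adj adj_sym w'n.
    rewrite RintegralD//; [|by apply: integrableZ_EFin; exact: i1|exact: iC].
    rewrite Z0 RintegralZl//; last exact: i1.
    have -> : (d + e) ^+ 2 = (1 + th) * d ^+ 2 + (1 + th^-1) * e ^+ 2.
      by rewrite /th; field; rewrite !gt_eqF.
    by rewrite lerD2r ler_wpM2l ?hd// addr_ge0// ltW.
  have n0 : 0 <= n by [].
  have ES' : n^-1 * \int[P]_w S w <= (d + e) ^+ 2.
    (* This occurs when [u] is the only neighbour of [v]; the inverse of 0 is then 0. *)
    have [nz|nz] := eqVneq n 0; first by rewrite nz invr0 mul0r sqr_ge0.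
    by rewrite ler_pdivrMl// lt_def nz.
  rewrite -RintegralZl//; last exact: bI.
  apply: le_trans (le_Rintegral measurableT _ _ (fun w _ => DA w)) _.
  - by apply: integrableZ_EFin; exact: bI.
  - by apply: integrableD_EFin; apply: integrableZ_EFin; [exact: i1|exact: bI].
  rewrite RintegralD//; [|by apply: integrableZ_EFin; exact: i1|by apply: integrableZ_EFin; exact:
    bI].
  rewrite !RintegralZl//; try exact: bI; try exact: i1.
  have -> : 2 * ka * d * (d + e) = la * d ^+ 2 + la^-1 * ka ^+ 2 * (d + e) ^+ 2.
    by rewrite /la; field; rewrite !gt_eqF// addr_gt0.
  apply: lerD; first by rewrite ler_wpM2l ?hd// ltW.
  rewrite -(mulrA (la^-1 * ka ^+ 2)); apply: ler_wpM2l => //.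
  by rewrite mulr_ge0 ?sqr_ge0// invr_ge0 ltW.
have ee : 0 <= eta t * (1 - eta t).
  by rewrite mulr_ge0 ?(ltW e00)// subr_ge0 (le_trans eta2)// invf_le1// ler1n.
have h1 := ler_wpM2l ee key.
have h0 : 0 <= 1 - 2 * eta t by rewrite subr_ge0 -ler_pdivlMl// mulr1.
have h2 := ler_wpM2l h0 (hd v u vu).
have h3 : eta t * (1 - eta t) * (2 * ka * d * (d + e)) <= eta t * (2 * ka * d * (d + e)).
  rewrite ler_wpM2r ?mulr_ge0 ?(ltW ka0) ?(ltW d0) ?(ltW (addr_gt0 d0 e0))//.
  by rewrite ler_piMr ?(ltW e00)// gerBl ltW.
have h4 : eta t * (2 * ka * (d * e)) <= eta t * (2 * (d * e)).
  rewrite ler_wpM2l ?(ltW e00)// ler_wpM2r ?mulr_ge0 ?(ltW d0) ?(ltW e0)//.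
  by rewrite ler_piMr.
have h5 : 2 * ka = 2 - gamma by rewrite /ka; field.
have h6 : eta t * (2 * ka * d * (d + e)) = eta t * (2 - gamma) * d ^+ 2 + eta t * (2 * ka * (d * e)).
  by rewrite -h5; ring.
exact: step_combine h1 h2 h3 h4 h6.
Qed.

End step.
End run.

(** * Rates *)

(** Induction step of [forget_sum]: [x] and [y] are the square roots of s and s + 1, [e] is the step
    size, [r] the remnant and [S] the partial sum. *)
Lemma forget_ineq (R : realFieldType) (x y e r q S : R) : 0 < x -> 0 <= r -> 0 <= e ->
  e <= 2^-1 ->  q + 2^-1 <= e * x ^+ 2 -> y <= x + (2 * x)^-1 ->
  (S + r / x) * q + (1 - e) * r * y <= S * q + r * x.
Proof.
move=> x0 r0 e0 e1 e2 yx; rewrite mulrDl -addrA lerD2l.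
have h1 : (1 - e) * r * y <= (1 - e) * r * (x + (2 * x)^-1).
  by apply: ler_wpM2l => //; apply: mulr_ge0 => //; lra.
apply: le_trans (lerD (lexx _) h1) _.
have -> : r * x = r / x * x ^+ 2 by field; rewrite gt_eqF.
have -> : r / x * q + (1 - e) * r * (x + (2 * x)^-1) =
   r / x * (q + (1 - e) * (x ^+ 2 + 2^-1)) by field; rewrite gt_eqF.
apply: ler_wpM2l; first by rewrite divr_ge0// ltW.
lra.
Qed.

(** Induction step of [inv_sqrt_sum], from [y - x = 1 / (x + y)] and [y <= 2 * x]. *)
Lemma sqrt_ineq (R : realFieldType) (x y : R) : 0 < x -> 0 < y -> y ^+ 2 = x ^+ 2 + 1 ->
  1 <= x ^+ 2 -> 4 * x + x^-1 <= 4 * y.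
Proof.
move=> x0 y0 yy x1.
have xy : 0 <= y - x by rewrite subr_ge0 -(@ler_pXn2r _ 2%N) ?nnegrE ?ltW//; lra.
have xy2 : y <= 2 * x.
  by rewrite -(@ler_pXn2r _ 2%N) ?nnegrE ?mulr_ge0 ?ltW// exprMn yy; lra.
rewrite -(ler_pM2r x0) mulrDl mulVf ?gt_eqF//.
have : (y - x) * (y + x) = 1 by rewrite -subr_sqr yy; ring.
nra.
Qed.

Lemma sqrD_le (R : realDomainType) (a b : R) : (a + b) ^+ 2 <= 2 * (a ^+ 2 + b ^+ 2).
Proof. by have := sqr_ge0 (a - b); rewrite sqrrB sqrrD; lra. Qed.

Section rates.
Context {R : realType}.
Variable gamma : R.
Hypotheses (gamma_gt0 : 0 < gamma) (gamma_lt2 : gamma < 2).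
Local Notation eta := (step_size gamma).

Lemma nat_above (x : R) : exists n : nat, x <= n%:R.
Proof.
exists (Num.bound `|x|); rewrite (le_trans (ler_norm x))// ltW//.
by rewrite archi_boundP.
Qed.

Lemma step_sizeE t : eta t * gamma = t.+1%:R^-1.
Proof. by rewrite /step_size div1r invfM mulrAC mulVf ?mul1r// gt_eqF. Qed.

Let p := gamma^-1.
Let p_gt : 2^-1 < p. Proof. by rewrite /p ltf_pV2// posrE. Qed.
Let q := (p - 2^-1) / 2.
Let q0 : 0 < q. Proof. by rewrite divr_gt0// subr_gt0. Qed.

(** The product [eta t * t] tends to 1/gamma > 1/2, and [q] is half of the margin, so the second
    condition holds eventually. The first is the one required by [sq_err_step]. *)
Definition burn_in (t1 : nat) := (0 < t1)%N /\
  forall t, (t1 <= t)%N -> eta t <= 2^-1 /\ q + 2^-1 <= eta t * t%:R.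

Lemma burn_in_exists : exists t1, burn_in t1.
Proof.
(* The first summand ensures [eta t <= 1/2]; the second is the solution of [q * t >= q + 1/2], to
   which the other condition reduces. *)
have [n Hn] := nat_above (2 * p + (p + 2^-1) / (2 * q)).
exists n.+1; split=> // t nt.
have tn : 2 * p + (p + 2^-1) / (2 * q) <= t%:R.
  by rewrite (le_trans Hn)// ler_nat ltnW.
have t1 : t.+1%:R = t%:R + 1 :> R by rewrite -natr1.
have tpos : 0 <= (t%:R : R) by [].
have p0 : 0 < p by rewrite invr_gt0.
have h0 : 0 < (p + 2^-1) / (2 * q) by apply: divr_gt0; [exact: addr_gt0|exact: mulr_gt0].
have etaE : eta t = p / (t%:R + 1) by rewrite /step_size t1 invfM mul1r.
split.
  rewrite etaE ler_pdivrMr; last by lra.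
  lra.
rewrite etaE mulrAC ler_pdivlMr; last by lra.
have : (p + 2^-1) / 2 <= q * t%:R.
  rewrite -ler_pdivrMl//; apply: le_trans tn.
  have -> : q^-1 * ((p + 2^-1) / 2) = (p + 2^-1) / (2 * q) by rewrite mulrC -mulrA -invfM.
  by rewrite lerDr mulr_ge0// ltW.
rewrite /q; lra.
Qed.

Section after_burn_in.
Variable t1 : nat.
Hypothesis t1P : burn_in t1.
Let t1_gt0 : (0 < t1)%N := t1P.1.
Local Notation rho := (forget eta t1).

Lemma burn_in01 t : (t1 <= t)%N -> 0 <= eta t <= 1.
Proof.
move=> /t1P.2 [h _]; rewrite ltW ?step_size_gt0//= (le_trans h)//.
by rewrite invf_le1// ler1n.
Qed.

Let rho01 t : 0 <= rho t <= 1 := forget_bounds burn_in01 t.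

Lemma sqrtS_le (s : nat) : (0 < s)%N ->
  Num.sqrt s.+1%:R <= Num.sqrt s%:R + (2 * Num.sqrt s%:R)^-1 :> R.
Proof.
move=> s0; have x0 : 0 < Num.sqrt s%:R :> R by rewrite sqrtr_gt0 ltr0n.
have xx : Num.sqrt s%:R ^+ 2 = s%:R :> R by rewrite sqr_sqrtr.
rewrite -[leRHS]ger0_norm; last by rewrite addr_ge0 ?invr_ge0 ?mulr_ge0 ?ltW.
rewrite -sqrtr_sqr ler_wsqrtr//; set x := Num.sqrt _ in x0 xx *; rewrite -natr1 -xx.
have -> : (x + (2 * x)^-1) ^+ 2 = x ^+ 2 + 1 + (2 * x)^-1 ^+ 2 by field; rewrite gt_eqF.
by rewrite lerDl sqr_ge0.
Qed.

Lemma forget_step s : (t1 <= s)%N -> rho s.+1 = (1 - eta s) * rho s.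
Proof. by move=> t1s; rewrite /forget big_nat_recr//= mulrC. Qed.

(* [rho s * sqrt s] decreases by at least [q * rho s / sqrt s] because [1 / gamma > 1 / 2]. *)
Lemma forget_sum t : (t1 <= t)%N ->
  \sum_(t1 <= s < t) rho s / Num.sqrt s%:R <= Num.sqrt t1%:R / q.
Proof.
move=> t1t; rewrite ler_pdivlMr//.
suff : (\sum_(t1 <= s < t) rho s / Num.sqrt s%:R) * q + rho t * Num.sqrt t%:R <= Num.sqrt t1%:R.
  apply: le_trans; rewrite lerDl mulr_ge0 ?sqrtr_ge0//.
  by have /andP[] := rho01 t.
rewrite -(subnKC t1t); elim: (t - t1)%N => [|n IH].
  by rewrite addn0 big_geq// mul0r add0r /forget big_geq// mul1r.
apply: le_trans IH; rewrite addnS big_nat_recr ?leq_addr//= forget_step ?leq_addr//.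
have s1 : (t1 <= t1 + n)%N by rewrite leq_addr.
have s0 : (0 < t1 + n)%N by exact: leq_trans t1_gt0 s1.
have := sqrtS_le s0; have [e1 e2] := t1P.2 _ s1.
have e0 := step_size_gt0 (t1 + n) gamma_gt0.
have /andP[r0 _] := rho01 (t1 + n).
have x0 : 0 < Num.sqrt (t1 + n)%:R :> R by rewrite sqrtr_gt0 ltr0n.
have xx : Num.sqrt (t1 + n)%:R ^+ 2 = (t1 + n)%:R :> R by rewrite sqr_sqrtr.
by apply: forget_ineq => //; rewrite ?xx// ltW.
Qed.

Lemma inv_sqrt_sum t : (t1 <= t)%N ->
  \sum_(t1 <= s < t) (Num.sqrt s%:R)^-1 <= 4 * Num.sqrt t%:R :> R.
Proof.
move=> t1t; rewrite -(subnKC t1t); elim: (t - t1)%N => [|n IH].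
  by rewrite addn0 big_geq// mulr_ge0// sqrtr_ge0.
rewrite addnS big_nat_recr ?leq_addr//=.
apply: le_trans (lerD IH (lexx _)) _.
have s0 : (0 < t1 + n)%N by rewrite (leq_trans t1_gt0)// leq_addr.
have x0 : 0 < Num.sqrt (t1 + n)%:R :> R by rewrite sqrtr_gt0 ltr0n.
have xx : Num.sqrt (t1 + n)%:R ^+ 2 = (t1 + n)%:R :> R by rewrite sqr_sqrtr.
have y0 : 0 < Num.sqrt (t1 + n).+1%:R :> R by rewrite sqrtr_gt0 ltr0n.
have yy : Num.sqrt (t1 + n).+1%:R ^+ 2 = (t1 + n)%:R + 1 :> R by rewrite sqr_sqrtr// -natr1.
have x1 : 1 <= (t1 + n)%:R :> R by rewrite ler1n.
by apply: sqrt_ineq; rewrite ?xx.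
Qed.

Lemma harmonic_ln t : (t1 <= t)%N ->
  \sum_(t1 <= s < t) (s.+1%:R)^-1 <= ln t%:R :> R.
Proof.
move=> t1t; rewrite -(subnKC t1t); elim: (t - t1)%N => [|n IH].
  by rewrite addn0 big_geq// ln_ge0// ler1n.
rewrite addnS big_nat_recr ?leq_addr//=.
apply: le_trans (lerD IH (lexx _)) _.
have s0 : (0 < t1 + n)%N by rewrite (leq_trans t1_gt0)// leq_addr.
have x0 : 0 < (t1 + n)%:R :> R by rewrite ltr0n.
have y0 : 0 < (t1 + n).+1%:R :> R by rewrite ltr0n.
rewrite -lerBrDl -ln_div// ?posrE//.
have : ln ((t1 + n)%:R / (t1 + n).+1%:R) <= (t1 + n)%:R / (t1 + n).+1%:R - 1 :> R.
  by rewrite -[X in ln X](subrKC 1) le_ln1Dx// ltrBrDl subrr divr_gt0.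
rewrite ln_div ?posrE// ln_div ?posrE//.
have -> : (t1 + n)%:R / (t1 + n).+1%:R - 1 = - ((t1 + n).+1%:R)^-1 :> R.
  have e : (t1 + n).+1%:R = (t1 + n)%:R + 1 :> R by rewrite natr1.
  by rewrite e in y0 *; field; rewrite gt_eqF.
by rewrite -[leLHS]opprB lerNr opprK => /(fun h => h).
Qed.


(** The remnant is nonincreasing, so each term of the sum in [forget_sum] is at least
    [rho t / sqrt t]. There are at least t/2 of them once [4 * t1 <= t], hence [rho t * sqrt t] is
    bounded. *)
Lemma forget_small (x : R) : 0 < x -> exists2 t2, (t1 <= t2)%N &
  forall t, (t2 <= t)%N -> rho t <= x.
Proof.
move=> x0; set C := Num.sqrt t1%:R / q.
have C0 : 0 <= C by rewrite divr_ge0 ?sqrtr_ge0// ltW.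
have [n Hn] := nat_above ((2 * C / x) ^+ 2).
exists (n.+1 + 4 * t1)%N; first by rewrite (leq_trans _ (leq_addl _ _))// leq_pmull.
move=> t tn.
have t1t : (t1 <= t)%N.
  by rewrite (leq_trans _ tn)// (leq_trans _ (leq_addl _ _))// leq_pmull.
have anti s : (t1 <= s < t)%N -> rho t <= rho s.
  move=> /andP[s1 st]; rewrite -(subnKC (ltnW st)).
  elim: (t - s)%N => [|m IH]; first by rewrite addn0.
  apply: le_trans IH; rewrite addnS forget_step; last by rewrite (leq_trans s1)// leq_addr.
  have /andP[r0 _] := rho01 (s + m).
  by rewrite ler_piMl// gerBl ltW// step_size_gt0.
have t0 : (0 < t)%N by exact: leq_trans t1_gt0 t1t.
have h : \sum_(t1 <= s < t) rho t / Num.sqrt t%:R <= C.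
  apply: le_trans (forget_sum t1t); apply: ler_sum_nat => s /andP[s1 st].
  have s0 : 0 < Num.sqrt s%:R :> R by rewrite sqrtr_gt0 ltr0n (leq_trans t1_gt0).
  have /andP[r0 _] := rho01 t.
  apply: ler_pM => //; rewrite ?invr_ge0 ?sqrtr_ge0// ?anti ?s1//.
  by rewrite lef_pV2 ?posrE// ?sqrtr_gt0 ?ltr0n// ler_wsqrtr// ler_nat ltnW.
have x1 : 0 < Num.sqrt t%:R :> R by rewrite sqrtr_gt0 ltr0n.
have xx : Num.sqrt t%:R ^+ 2 = t%:R :> R by rewrite sqr_sqrtr.
have Ct : 2 * C / x <= Num.sqrt t%:R.
  have Cx : 0 <= 2 * C / x by apply: divr_ge0 (ltW x0); exact: mulr_ge0.
  rewrite -[2 * C / x](ger0_norm Cx) -sqrtr_sqr ler_wsqrtr//.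
  by rewrite (le_trans Hn)// ler_nat (leq_trans _ tn)// (leq_trans _ (leq_addr _ _)).
have h' : rho t / Num.sqrt t%:R * (t%:R / 2) <= C.
  apply: le_trans h; rewrite sumr_const_nat -[leRHS]mulr_natr; apply: ler_wpM2l.
    by have /andP[r0 _] := rho01 t; rewrite divr_ge0 ?sqrtr_ge0.
  rewrite natrB// ler_pdivrMr// mulrBl.
  have : (4 * t1)%:R <= t%:R :> R by rewrite ler_nat (leq_trans _ tn)// leq_addl.
  rewrite natrM; have : 0 <= t1%:R :> R by []; lra.
have {}h' : rho t * Num.sqrt t%:R <= 2 * C.
  apply: le_trans (_ : 2 * (rho t / Num.sqrt t%:R * (t%:R / 2)) <= _); last by rewrite ler_wpM2l.
  by rewrite -[X in _ * (X / 2)]xx le_eqVlt; apply/orP; left; apply/eqP; field; rewrite gt_eqF.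
rewrite -(ler_pM2r x1) (le_trans h')//.
by rewrite [leRHS]mulrC -ler_pdivrMr.
Qed.

(** Moving [h] under the square root only enlarges the cross term, so a variance increment can be
    booked apart from the biases. *)
Lemma grow_sqrt (g h E a : R) : 0 <= g -> 0 <= h -> 0 <= E -> 0 <= a ->
  (Num.sqrt g + E + a) ^+ 2 + h <= (Num.sqrt (g + h) + (E + a)) ^+ 2.
Proof.
move=> g0 h0 E0 a0.
have sg : Num.sqrt g ^+ 2 = g by rewrite sqr_sqrtr.
have sgh : Num.sqrt (g + h) ^+ 2 = g + h by rewrite sqr_sqrtr// addr_ge0.
have le : Num.sqrt g <= Num.sqrt (g + h) by rewrite ler_wsqrtr// lerDl.
rewrite -addrA !(sqrrD _ (E + a)) sg sgh.
have := ler_wpM2r (addr_ge0 E0 a0) le; lra.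
Qed.

(** * Solution of the recursion, for a monotone family [Q t D] of error bounds D at time t *)

Section recursion.
Variables (Q : nat -> R -> Prop) (t2 : nat) (D0 C Cr s : R).
Hypothesis t12 : (t1 <= t2)%N.
Hypotheses (D0_gt0 : 0 < D0) (C0 : 0 <= C) (Cr0 : 0 <= Cr) (s0 : 0 < s).
Hypothesis Q_mono : forall t D D', D <= D' -> Q t D -> Q t D'.
Hypothesis Q_init : Q t2 D0.
Hypothesis Q_step : forall t d, (t2 <= t)%N -> 0 < d -> Q t (d ^+ 2) ->
  Q t.+1 ((1 - eta t * gamma) * d ^+ 2 + 2 * eta t * d * (Cr * rho t + s) + eta t ^+ 2 * C).

Let G t := D0 * t2%:R + C / gamma ^+ 2 * \sum_(t1 <= i < t) (i.+1%:R)^-1.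
Let E t := gamma^-1 * \sum_(t1 <= i < t) (Cr * rho i + s) / Num.sqrt i%:R.

Let t2_gt0 : 0 < t2%:R :> R. Proof. by rewrite ltr0n (leq_trans t1_gt0). Qed.
Let G0 t : 0 < G t.
Proof. by rewrite ltr_pwDl ?mulr_gt0// mulr_ge0 ?divr_ge0 ?sqr_ge0// sumr_ge0. Qed.
Let e0 t : 0 < Cr * rho t + s.
Proof. by rewrite ltr_wpDl// mulr_ge0//; case/andP: (rho01 t). Qed.
Let E0 t : 0 <= E t.
Proof.
rewrite mulr_ge0 ?invr_ge0 ?(ltW gamma_gt0)// sumr_ge0// => i _.
by rewrite divr_ge0 ?sqrtr_ge0// ltW.
Qed.

(* G accumulates the variances and E the biases; the square root turns the cross term of
   the recursion into an addition. *)
Lemma recursion_invariant t : (t2 <= t)%N -> Q t ((Num.sqrt (G t) + E t) ^+ 2 / t%:R).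
Proof.
move=> t2t; rewrite -(subnKC t2t); elim: (t - t2)%N => [|n IH].
  rewrite addn0; apply: Q_mono Q_init; rewrite ler_pdivlMr//.
  apply: (@le_trans _ _ (Num.sqrt (G t2) ^+ 2)).
    rewrite sqr_sqrtr ?(ltW (G0 _))// lerDl.
    by rewrite mulr_ge0 ?divr_ge0 ?sqr_ge0// sumr_ge0.
  by rewrite lerXn2r ?nnegrE ?addr_ge0 ?sqrtr_ge0// lerDl.
rewrite addnS; set m := (t2 + n)%N in IH *.
have t2m : (t2 <= m)%N by rewrite leq_addr.
have t1m : (t1 <= m)%N by exact: leq_trans t12 t2m.
have m0 : 0 < m%:R :> R by rewrite ltr0n (leq_trans t1_gt0).
have x0 : 0 < Num.sqrt m%:R :> R by rewrite sqrtr_gt0.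
have xx : Num.sqrt m%:R ^+ 2 = m%:R :> R by rewrite sqr_sqrtr// ltW.
have y0 : 0 < Num.sqrt (G m) + E m by rewrite ltr_pwDl// sqrtr_gt0.
have := @Q_step m ((Num.sqrt (G m) + E m) / Num.sqrt m%:R) t2m (divr_gt0 y0 x0).
rewrite expr_div_n xx => /(_ IH); apply: Q_mono.
have ES : E m.+1 = E m + gamma^-1 * ((Cr * rho m + s) / Num.sqrt m%:R).
  by rewrite /E big_nat_recr//= mulrDr.
have GS : G m.+1 = G m + C / gamma ^+ 2 * (m.+1%:R)^-1.
  by rewrite /G big_nat_recr//= mulrDr addrA.
have a0 : 0 <= gamma^-1 * ((Cr * rho m + s) / Num.sqrt m%:R).
  by rewrite mulr_ge0 ?invr_ge0 ?(ltW gamma_gt0)// divr_ge0 ?sqrtr_ge0// ltW.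
have b0 : 0 <= C / gamma ^+ 2 * (m.+1%:R)^-1 by rewrite mulr_ge0// divr_ge0// sqr_ge0.
have := grow_sqrt (ltW (G0 m)) b0 (E0 m) a0; rewrite -GS -ES => h.
apply: le_trans (ler_wpM2r _ h); last by rewrite invr_ge0.
have mS : m.+1%:R = m%:R + 1 :> R by rewrite -natr1.
have etaE : eta m = gamma^-1 / m.+1%:R by rewrite /step_size invfM mul1r.
rewrite step_sizeE etaE mS.
move: (Num.sqrt (G m) + E m) (Cr * rho m + s) y0 (e0 m) => y e y_ e_.
move: (Num.sqrt m%:R) x0 xx => x x0 <-.
have x1 : 0 < x ^+ 2 + 1 by rewrite ltr_wpDl// sqr_ge0.
rewrite -subr_ge0.
(* What remains is the square of the increment of [E]. *)
have -> : ((y + gamma^-1 * (e / x)) ^+ 2 + C / gamma ^+ 2 / (x ^+ 2 + 1)) / (x ^+ 2 + 1) -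
  ((1 - (x ^+ 2 + 1)^-1) * (y ^+ 2 / x ^+ 2) +
   2 * (gamma^-1 / (x ^+ 2 + 1)) * (y / x) * e + (gamma^-1 / (x ^+ 2 + 1)) ^+ 2 * C) =
  (gamma^-1 * (e / x)) ^+ 2 / (x ^+ 2 + 1).
  by field; rewrite !gt_eqF.
by rewrite divr_ge0 ?sqr_ge0// ltW.
Qed.

(** Variance is separated from bias by [sqrD_le], and within the bias the remnant from the constant
    [s]. The remnant has a bounded sum by [forget_sum] and costs O(1/t); the constant part sums to
    order [s * sqrt t], which leaves a term that does not decay. *)
Lemma recursion_rate t : (t2 <= t)%N ->
  Q t ((2 * D0 * t2%:R + 4 * (Cr * Num.sqrt t1%:R / (gamma * q)) ^+ 2 +
        2 * C / gamma ^+ 2 * ln t%:R) / t%:R + 64 * s ^+ 2 / gamma ^+ 2).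
Proof.
move=> t2t; apply: Q_mono (recursion_invariant t2t).
have t1t : (t1 <= t)%N by exact: leq_trans t12 t2t.
have t0 : 0 < t%:R :> R by rewrite ltr0n (leq_trans t1_gt0).
have x0 : 0 < Num.sqrt t%:R :> R by rewrite sqrtr_gt0.
have xx : Num.sqrt t%:R ^+ 2 = t%:R :> R by rewrite sqr_sqrtr// ltW.
have h1 : Num.sqrt (G t) ^+ 2 <= D0 * t2%:R + C / gamma ^+ 2 * ln t%:R.
  rewrite sqr_sqrtr ?(ltW (G0 _))// lerD2l ler_wpM2l ?divr_ge0 ?sqr_ge0//.
  exact: harmonic_ln.
have h2 : E t <= Cr * Num.sqrt t1%:R / (gamma * q) + gamma^-1 * (s * (4 * Num.sqrt t%:R)).
  have -> : Cr * Num.sqrt t1%:R / (gamma * q) = gamma^-1 * (Cr * (Num.sqrt t1%:R / q)).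
    by rewrite invfM mulrCA !mulrA mulrC !mulrA.
  rewrite -mulrDr ler_wpM2l ?invr_ge0 ?(ltW gamma_gt0)//.
  under eq_bigr do rewrite mulrDl -mulrA.
  rewrite big_split/= -!mulr_sumr; apply: lerD.
    by rewrite ler_wpM2l// forget_sum.
  by rewrite ler_wpM2l ?(ltW s0)// inv_sqrt_sum.
set g := Num.sqrt (G t) in h1 *; set E1 := Cr * _ / _ in h2 *.
have E10 : 0 <= E1 by rewrite divr_ge0 ?(mulr_ge0 Cr0) ?sqrtr_ge0// ltW// mulr_gt0.
have h3 : E t ^+ 2 <= 2 * E1 ^+ 2 + 32 * s ^+ 2 / gamma ^+ 2 * t%:R.
  apply: le_trans (_ : (E1 + gamma^-1 * (s * (4 * Num.sqrt t%:R))) ^+ 2 <= _).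
    rewrite lerXn2r ?nnegrE// addr_ge0// mulr_ge0 ?invr_ge0 ?(ltW gamma_gt0)//.
    by rewrite !mulr_ge0 ?sqrtr_ge0// ltW.
  have -> : 32 * s ^+ 2 / gamma ^+ 2 * t%:R = 2 * (gamma^-1 * (s * (4 * Num.sqrt t%:R))) ^+ 2.
    by rewrite -[X in _ / _ * X]xx; field; rewrite gt_eqF.
  by rewrite -mulrDr; exact: sqrD_le.
rewrite ler_pdivrMr// mulrDl divfK ?gt_eqF//.
apply: le_trans (_ : 2 * g ^+ 2 + 2 * E t ^+ 2 <= _).
  by rewrite -mulrDr; exact: sqrD_le.
have := ler_wpM2l (ler0n R 2) h1; have := ler_wpM2l (ler0n R 2) h3.
move: (g ^+ 2) (E t ^+ 2) (E1 ^+ 2) => a b b1 i1 i2.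
apply: le_trans (lerD i2 i1) _.
rewrite le_eqVlt; apply/orP; left; apply/eqP; ring.
Qed.

End recursion.
End after_burn_in.
End rates.

(** * Convergence *)

(** Brings [E2] to the form [e ^+ 2], with [e] a multiple of the remnant plus a constant of order
    [sqrt e2], as the recursion requires. *)
Lemma bias_bound (R : realType) (rho q Ma M0 e2 : R) :
  0 <= rho -> 0 <= q -> 0 <= Ma -> 0 <= M0 -> 0 <= e2 ->
  2 * (2 * (rho ^+ 2 * Ma) + 8 * (q * rho + Num.sqrt (e2 * M0)) ^+ 2 * Ma) + 2 * e2 <=
  (Num.sqrt (4 * Ma + 32 * q ^+ 2 * Ma) * rho + Num.sqrt (e2 * (32 * Ma * M0 + 2))) ^+ 2.
Proof.
move=> r0 q0 A0 m0 e0.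
apply: le_trans (_ : (Num.sqrt (4 * Ma + 32 * q ^+ 2 * Ma) * rho) ^+ 2 +
  Num.sqrt (e2 * (32 * Ma * M0 + 2)) ^+ 2 <= _); last first.
  by rewrite sqrrD lerD2r lerDl mulrn_wge0// !mulr_ge0// sqrtr_ge0.
rewrite exprMn !sqr_sqrtr; last 2 first.
- by rewrite addr_ge0 ?mulr_ge0 ?sqr_ge0.
- by rewrite mulr_ge0// addr_ge0// !mulr_ge0.
have h := sqrD_le (q * rho) (Num.sqrt (e2 * M0)).
rewrite sqr_sqrtr ?mulr_ge0// exprMn in h.
have {}h := ler_wpM2r A0 (ler_wpM2l (ler0n R 8) h).
apply: le_trans (_ : 2 * (2 * (rho ^+ 2 * Ma) + 8 * (2 * (q ^+ 2 * rho ^+ 2 + e2 * M0)) * Ma) + 2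
  * e2 <= _).
  by rewrite lerD2r ler_wpM2l// lerD2l.
by rewrite le_eqVlt; apply/orP; left; apply/eqP; ring.
Qed.

(** Supplies [small2]: the left-hand side is quadratic in the remnant, while the right-hand side is
    bounded below as soon as [rho] is at most 1/2. *)
Lemma fallback_excluded (R : realFieldType) (n rho Ma lo M0 : R) : 0 <= n -> 0 <= Ma -> 0 < lo ->
  0 < M0 -> 0 <= rho -> rho <= 2^-1 -> rho <= (lo / 4) ^+ 2 * M0 / (n * Ma + 1) ->
  n * (rho ^+ 2 * Ma) < ((1 - rho) * (lo / 2)) ^+ 2 * M0.
Proof.
move=> n0 A0 l0 m0 r0 r1 r2.
have nA : 0 <= n * Ma by exact: mulr_ge0.
rewrite ler_pdivlMr ?ltr_wpDl// in r2.
have [->|rn0] := eqVneq rho 0.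
  by rewrite expr0n/= mul0r mulr0 subr0 mul1r mulr_gt0// exprn_gt0// divr_gt0.
have rp : 0 < rho by rewrite lt_def rn0.
have h1 : (lo / 4) ^+ 2 <= ((1 - rho) * (lo / 2)) ^+ 2.
  have r4 : 0 <= 1 - rho by lra.
  rewrite lerXn2r ?nnegrE ?(mulr_ge0 r4) ?divr_ge0 ?(ltW l0)//.
  have -> : lo / 4 = 2^-1 * (lo / 2) by field.
  by apply: ler_wpM2r; [rewrite divr_ge0 ?(ltW l0)|lra].
apply: lt_le_trans (ler_wpM2r (ltW m0) h1).
apply: lt_le_trans r2.
have -> : n * (rho ^+ 2 * Ma) = rho * (rho * (n * Ma)) by ring.
rewrite ltr_pM2l//; have := ler_wpM2r nA r1; lra.
Qed.

Section convergence.
Context {R : realType} {X : ptopologicalType}.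
Variable mu : {finite_measure set (borel X) -> \bar R}.
Context {V : finType}.
Variables (adj : rel V) (psiV : V -> borel X -> R) (psiE : V -> V -> borel X -> borel X -> R).
Variables (lam : V -> V -> nat -> R) (phi : V -> V -> nat -> borel X -> R).
Variables (mstar : V -> V -> borel X -> R) (gamma c B : R) (k : nat).
Hypothesis adj_sym : symmetric adj.
Hypothesis psiV_meas : forall u, measurable_fun setT (psiV u).
Hypothesis psiV_gt0 : forall u x, 0 < psiV u x.
Hypothesis c0 : 0 < c.
Hypothesis psiE_bounds : forall v u, adj v u -> forall x y, c <= psiE u v x y <= B.
Hypothesis psiE_symm : forall v u, adj v u -> symmetric_kernel (psiE u v).
Hypothesis psiE_mercer : forall v u, adj v u -> mercer_system mu (psiE u v) (lam u v) (phi u v).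
Hypothesis gamma_gt0 : 0 < gamma.
Hypothesis gamma_lt2 : gamma < 2.
Hypothesis contr : bp_contractive mu adj psiV psiE gamma.
Hypothesis mstarP : bp_fixed_point mu adj psiV psiE mstar.
Hypothesis k_gt0 : (0 < k)%N.

Local Notation M0 := (fine (mu setT)).
Local Notation eta := (step_size gamma).
Local Notation lo := (c / (B * M0)).

(** The constants precede [r], the probability space and the samples, because [r] will depend on
    delta. The term [K3 * e2] is the bias due to truncation and does not decrease with [t]. *)
Lemma coef_rate : exists t2 (K1 K2 K3 e0 : R), [/\ 0 <= K2, 0 <= K3, 0 < e0 &
  forall (dO : measure_display) (Omega : measurableType dO)
    (P : probability Omega R) (nu : probability (borel X) R)
    (r : nat) (Y : nat -> V -> V -> 'I_k -> Omega -> borel X) (tau e2 : R),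
  (0 < r)%N -> sosmp_run mu adj psiV psiE phi r eta P nu Y ->
  (forall v u, adj v u -> forall N x, \sum_(r <= j < N) lam u v j * phi u v j x ^+ 2 <= tau) ->
  tau / (c * M0) <= lo / 2 ->
  (forall v u, adj v u -> forall N y,
    \sum_(r <= j < N) kcoef mu (psiE u v) (lam u v) (phi u v) j y ^+ 2 <= e2) ->
  0 < e2 -> e2 <= e0 ->
  forall t v u, (t2 <= t)%N -> adj v u ->
  bounded_measurable (sq_err mu psiE lam phi mstar gamma r Y t v u) /\
  \int[P]_w sq_err mu psiE lam phi mstar gamma r Y t v u w <=
    (K1 + K2 * ln t%:R) / t%:R + K3 * e2].
Proof.
have [[[v0 u0] /= vu0]|no] := pselect (exists e : V * V, adj e.1 e.2); last first.
  exists 0%N, 0, 0, 0, 1; split => // dO Omega P nu r Y tau e2 _ _ _ _ _ _ _ t v u _ vu.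
  by exfalso; apply: no; exists (v, u).
have M00 := mass_gt0 (psiE_mercer vu0).
have B0 := B_gt0 c0 (psiE_bounds vu0).
have [Ma Ma0 HM] := edge_coef_bounded c0 psiE_bounds psiE_symm psiE_mercer gamma_gt0 k_gt0.
have [t1 t1P] := burn_in_exists gamma_gt0 gamma_lt2.
have eta01 := burn_in01 gamma_gt0 t1P.
pose q := 2 * Num.sqrt (Ma * M0) + 1.
have q0 : 0 < q by rewrite ltr_wpDl// mulr_ge0// sqrtr_ge0.
have h0 : 0 < (lo / 4) ^+ 2 * M0 by rewrite mulr_gt0// exprn_gt0// !divr_gt0// mulr_gt0.
have n0 : 0 < #|V|%:R * Ma + 1 by rewrite ltr_wpDl// mulr_ge0.
(* The bound by [(4 * q)^-1], together with [sm] below, gives [gap <= 1/2]; the other two are those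
   asked for by [fallback_excluded]. *)
pose x := Num.min 2^-1 (Num.min (4 * q)^-1 ((lo / 4) ^+ 2 * M0 / (#|V|%:R * Ma + 1))).
have x0 : 0 < x by rewrite !lt_min !invr_gt0 ltr0n/= mulr_gt0//= divr_gt0.
have [t2 t12 Ht2] := forget_small gamma_gt0 gamma_lt2 t1P x0.
have Q0 : 0 <= kbound mu c B by rewrite mulr_ge0 ?sqr_ge0// ltW.
pose C := 2 * Ma + 6 * kbound mu c B.
have C0 : 0 <= C by apply: addr_ge0; exact: mulr_ge0.
(* The bound of [sq_err_le], available at [t2] for every sample path, with 1 added for
   positivity. *)
pose D0 := 2 * Ma + 2 * kbound mu c B + 1.
have D00 : 0 < D0 by rewrite ltr_wpDl//; apply: addr_ge0; exact: mulr_ge0.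
pose Cr := Num.sqrt (4 * Ma + 32 * q ^+ 2 * Ma).
pose S := 32 * Ma * M0 + 2.
have S0 : 0 < S by rewrite ltr_wpDl// !mulr_ge0// ltW.
exists t2, (2 * D0 * t2%:R + 4 * (Cr * Num.sqrt t1%:R / (gamma * ((gamma^-1 - 2^-1) / 2))) ^+ 2),
  (2 * C / gamma ^+ 2), (64 * S / gamma ^+ 2), (16^-1 / M0); split.
- by rewrite divr_ge0 ?sqr_ge0// mulr_ge0.
- by rewrite divr_ge0 ?sqr_ge0// mulr_ge0// ltW.
- by rewrite divr_gt0.
move=> dO Omega P nu r Y tau e2 r0 runP htail htau he2 e20 e2e t v u t2t vu.
have coefM y v' u' s := @HM r y v' u' s r0.
have bm s v' u' vu' := sq_err_bm mstar c0 psiE_bounds psiE_symm psiE_mercer runP coefM s vu'.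
split; first exact: bm.
pose Q s D := forall v u, adj v u -> \int[P]_w sq_err mu psiE lam phi mstar gamma r Y s v u w <= D.
suff : Q t ((2 * D0 * t2%:R + 4 * (Cr * Num.sqrt t1%:R / (gamma * ((gamma^-1 - 2^-1) / 2))) ^+ 2 +
   2 * C / gamma ^+ 2 * ln t%:R) / t%:R + 64 * Num.sqrt (e2 * S) ^+ 2 / gamma ^+ 2).
  move=> /(_ v u vu); rewrite sqr_sqrtr; last by rewrite mulr_ge0// ltW.
  have -> // : 64 * (e2 * S) / gamma ^+ 2 = 64 * S / gamma ^+ 2 * e2 by ring.
apply: (recursion_rate gamma_gt0 gamma_lt2 t1P t12 D00 C0) t2t.
- exact: sqrtr_ge0.
- by rewrite sqrtr_gt0 mulr_gt0.
- by move=> s D D' DD' QD v' u' vu'; apply: le_trans DD'; exact: QD.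
- move=> v' u' vu'.
  have -> : D0 = \int[P]_w D0 by rewrite Rintegral_cst//= probability_setT mulr1.
  apply: le_Rintegral => //.
  + by apply: bounded_measurable_integrable; exact: bm.
  + by apply: bounded_measurable_integrable; exact: bounded_measurable_cst.
  move=> w _; apply: (le_trans (sq_err_le adj_sym psiV_meas psiV_gt0 c0 psiE_bounds psiE_symm
    psiE_mercer mstarP Y coefM t2 w vu')).
  by rewrite lerDl.
move=> s d t2s d0 Qd.
have t1s : (t1 <= s)%N by exact: leq_trans t12 t2s.
have /andP[r00 r01] := forget_bounds eta01 s.
have rx := Ht2 s t2s.
have [rx1 rx2 rx3] : [/\ forget eta t1 s <= 2^-1, forget eta t1 s <= (4 * q)^-1 &
    forget eta t1 s <= (lo / 4) ^+ 2 * M0 / (#|V|%:R * Ma + 1)].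
  by move: rx; rewrite !le_min => /and3P[].
have sm : Num.sqrt (e2 * M0) <= 4^-1.
  rewrite -[leRHS]ger0_norm// -sqrtr_sqr ler_wsqrtr//.
  have -> : (4^-1 : R) ^+ 2 = 16^-1 / M0 * M0 by field; rewrite gt_eqF.
  by rewrite ler_wpM2r// ltW.
have qr : q * forget eta t1 s <= 4^-1.
  have -> : (4^-1 : R) = q * (4 * q)^-1 by field; rewrite gt_eqF.
  by rewrite ler_wpM2l// ltW.
apply: (sq_err_step adj_sym psiV_meas psiV_gt0 c0 psiE_bounds psiE_symm psiE_mercer gamma_gt0
  gamma_lt2 contr mstarP k_gt0 runP coefM eta01 htail htau he2 t1s) => //.
- by apply: le_trans (lerD qr sm) _; lra.
- by apply: (fallback_excluded _ Ma0 _ M00 r00 rx1 rx3); rewrite ?divr_gt0 ?mulr_gt0.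
- by have [] := t1P.2 s t1s.
- by rewrite ltr_wpDl ?mulr_ge0 ?sqrtr_ge0// sqrtr_gt0 mulr_gt0.
- exact: bias_bound r00 (ltW q0) Ma0 (ltW M00) (ltW e20).
Qed.

(** By Pythagoras the error of a message is that of its coefficients plus the tail of [mstar], a
    deterministic constant. *)
Lemma message_error (dO : measure_display) (Omega : measurableType dO)
    (P : probability Omega R) (r : nat) (Y : nat -> V -> V -> 'I_k -> Omega -> borel X) (e2 D : R)
      t v u :
  (forall N y, \sum_(r <= j < N) kcoef mu (psiE u v) (lam u v) (phi u v) j y ^+ 2 <= e2) ->
  adj v u -> bounded_measurable (sq_err mu psiE lam phi mstar gamma r Y t v u) ->
  \int[P]_w sq_err mu psiE lam phi mstar gamma r Y t v u w <= D ->
  ('E_P[fun omega => (L2norm mu (fun x =>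
     sosmp_message mu psiV psiE phi r eta (sample_path Y omega) t v u x - mstar v u x) ^+ 2)%R]
    <= (D + e2)%:E)%E.
Proof.
move=> he2 vu bm ED.
have phiB := mercer_basis (psiE_mercer vu).
have mL := mstar_Lfun mstarP vu.
pose h := inner mu (mstar v u) (mstar v u) - \sum_(j < r) inner mu (mstar v u) (phi u v j) ^+ 2.
have h2 : h <= e2.
  apply: proj_tail => // N.
  exact: (mstar_tail adj_sym psiV_meas psiV_gt0 c0 psiE_bounds psiE_symm psiE_mercer mstarP vu he2).
have e : (fun omega => (L2norm mu (fun x =>
     sosmp_message mu psiV psiE phi r eta (sample_path Y omega) t v u x - mstar v u x) ^+ 2)%R) =
   (fun w => sq_err mu psiE lam phi mstar gamma r Y t v u w + h).
  apply/funext => w.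
  rewrite (sosmp_messageE gamma psiV_gt0 c0 psiE_bounds psiE_symm psiE_mercer)//.
  rewrite L2norm_sqr; last by apply: Lfun2B => //; exact: comb_Lfun.
  by rewrite -(inner_sub_comb phiB).
rewrite e unlock.
have bi : bounded_measurable (fun w => sq_err mu psiE lam phi mstar gamma r Y t v u w + h).
  by apply: bounded_measurableD => //; exact: bounded_measurable_cst.
have ii := bounded_measurable_integrable P bi.
rewrite -(fineK (integrable_fin_num measurableT ii)) lee_fin.
rewrite -[leLHS]/(\int[P]_w (sq_err mu psiE lam phi mstar gamma r Y t v u w + h)).
rewrite RintegralD//; [|exact: bounded_measurable_integrable|].
  by rewrite Rintegral_cst//= probability_setT mulr1 lerD.
by apply: bounded_measurable_integrable; exact: bounded_measurable_cst.
Qed.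

End convergence.

(** * Complexity *)

Lemma ln_inv_near (R : realType) (A : R) : \forall delta \near 0^'+, A <= ln (1 / delta).
Proof.
have e0 : 0 < expR (- A) by exact: expR_gt0.
near=> delta.
have d0 : 0 < delta by near: delta; exact: nbhs_right_gt.
rewrite div1r lnV ?posrE// lerNr -[leRHS]expRK ler_ln ?posrE//.
by near: delta; exact: nbhs_right_le.
Unshelve. all: by end_near. Qed.

(** Put L = ln (1/delta) and x = s L / delta; then ln x = ln s + ln L + L <= s + 2 L, and the lower
    bounds on s and L dominate the constants. It holds for every larger [x] too, so accuracy
    persists at later times. *)
Lemma iteration_count (R : realType) (K1 K2 delta x : R) : 0 <= K1 -> 0 <= K2 ->
  0 < delta -> 1 <= ln (1 / delta) -> 8 * K2 <= ln (1 / delta) ->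
  (8 * (K1 + K2) + 1) / delta * ln (1 / delta) <= x ->
  (K1 + K2 * ln x) / x <= delta / 2.
Proof.
move=> K10 K20 d0; set L := ln _ => L1 L2 hx.
have L0 : 0 < L by exact: lt_le_trans L1.
pose s := x * delta / L.
have sC : 8 * (K1 + K2) + 1 <= s.
  rewrite /s ler_pdivlMr// -ler_pdivrMr//.
  by move: hx; rewrite mulrAC.
have s0 : 0 < s by apply: lt_le_trans sC; rewrite ltr_wpDl// mulr_ge0// addr_ge0.
have xE : x = s * (L * (1 / delta)) by rewrite /s; field; rewrite !gt_eqF.
have d1 : 0 < 1 / delta by rewrite divr_gt0.
have lnx : ln x <= s + 2 * L.
  have Ld : 0 < L * (1 / delta) by exact: mulr_gt0.
  rewrite xE (lnM s0 Ld) (lnM L0 d1) -/L.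
  have := ln_sublinear s0; have := ln_sublinear L0; lra.
have x0 : 0 < x by rewrite xE; apply: mulr_gt0 => //; exact: mulr_gt0.
rewrite ler_pdivrMr//.
have -> : delta / 2 * x = s * L / 2 by rewrite xE; field; rewrite gt_eqF.
apply: le_trans (_ : K1 + K2 * (s + 2 * L) <= _).
  by rewrite lerD2l ler_wpM2l.
have h1 : K1 <= s * L / 8.
  apply: le_trans (_ : s / 8 <= _); first by lra.
  by rewrite ler_wpM2r// ler_peMr// ltW.
have h2 : K2 * s <= s * L / 8.
  by rewrite mulrC -mulrA ler_wpM2l ?(ltW s0)//; lra.
have h3 : K2 * (2 * L) <= s * L / 4.
  have : K2 * 8 <= s by lra.
  by move=> /(ler_wpM2r (ltW L0)); lra.
lra.
Qed.

(** As [L / delta] is at least 1, the successor taken after truncation is absorbed by [C + 1]; the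
    factor [S] is inserted at the price of [1 / l]. *)
Lemma cost_bound (R : realType) (C delta L l S : R) (w k r o : nat) :
  0 < C -> 0 < delta -> delta <= 1 -> 1 <= L -> 0 < l -> l <= S -> (o <= w * (r * k))%N ->
  `|((Num.truncn (C / delta * L)).+1 * o)%:R| <=
  ((C + 1) * (w * k)%:R / l + 1) * `|r%:R * S * (1 / delta) * L|.
Proof.
move=> C0 d0 d1 L1 l0 lS ow.
have L0 : 0 < L by exact: lt_le_trans L1.
have Ld : 1 <= L / delta by rewrite ler_pdivlMr// mul1r (le_trans d1).
have Ld0 : 0 < L / delta by exact: lt_le_trans Ld.
have TL : (Num.truncn (C / delta * L)).+1%:R <= (C + 1) * (L / delta).
  have e : C / delta * L = C * (L / delta) by rewrite mulrAC mulrA.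
  rewrite -natr1 mulrDl mul1r lerD// e truncn_le//.
  by rewrite mulr_ge0// ltW.
have S0 : 0 < S by exact: lt_le_trans lS.
have rS0 : 0 <= r%:R * (L / delta) by rewrite mulr_ge0// ltW.
rewrite ger0_norm// ger0_norm; last by rewrite !mulr_ge0 ?invr_ge0// ltW.
apply: le_trans (_ : (C + 1) * (L / delta) * (w * (r * k))%:R <= _).
  by rewrite natrM ler_pM// ler_nat.
have -> : (C + 1) * (L / delta) * (w * (r * k))%:R =
    (C + 1) * (w * k)%:R * (r%:R * (L / delta)) by rewrite !natrM; ring.
have -> : r%:R * S * (1 / delta) * L = S * (r%:R * (L / delta)) by ring.
rewrite [leRHS]mulrA ler_wpM2r// [leRHS]mulrDl mul1r.
apply: le_trans (_ : (C + 1) * (w * k)%:R / l * S <= _); last by rewrite lerDl ltW.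
rewrite mulrAC ler_pdivlMr// ler_wpM2l// mulr_ge0// addr_ge0// ltW//.
Qed.

(** Otherwise all eigenvalues, and with them Mercer's series, would vanish. This bounds the sum of
    squared eigenvalues away from 0. *)
Lemma mercer_lam0_gt0 (R : realType) (X : ptopologicalType)
    (mu : {finite_measure set (borel X) -> \bar R}) (K : borel X -> borel X -> R) lam phi :
  mercer_system mu K lam phi -> 0 < K point point -> 0 < lam 0%N.
Proof.
move=> mK K0; rewrite lt_def (mercer_lam_ge0 mK) andbT; apply/negP => /eqP lz.
have z j : lam j = 0.
  by apply/eqP; rewrite eq_le (mercer_lam_ge0 mK) andbT -lz (mercer_lam_le mK).
case: mK => _ _ _ _ /(_ point point).
rewrite (_ : series _ = cst 0); last first.
  by apply/funext => m; rewrite /series/=; apply: big1 => j _; rewrite z !mul0r.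
by move=> /(cvg_lim (@Rhausdorff R)); rewrite lim_cst// => e; rewrite -e ltxx in K0.
Qed.

(** * Truncation levels on a finite graph *)

Section finite_graph.
Context {V : finType}.
Variable adj : rel V.

Lemma edges_near (Pr : V -> V -> nat -> Prop) :
  (forall v u, adj v u -> \forall n \near \oo, Pr v u n) ->
  \forall n \near \oo, forall v u, adj v u -> Pr v u n.
Proof.
move=> H.
have : \forall n \near \oo, forall e : V * V, adj e.1 e.2 -> Pr e.1 e.2 n.
  apply: filter_forall => -[v u] /=; have [vu|nvu] := boolP (adj v u).
    by apply: filterS (H v u vu).
  by near=> n.
by apply: filterS => n h v u; exact: (h (v, u)).
Unshelve. all: by end_near. Qed.

Context {R : realType} (lam : V -> V -> nat -> R).
Hypothesis lam_ge0 : forall v u j, adj v u -> 0 <= lam u v j.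
Hypothesis lam_le : forall v u i j, adj v u -> (i <= j)%N -> lam u v j <= lam u v i.
Hypothesis lam_trace : forall v u, adj v u -> trace_class (lam u v).

(** The eigenvalues of a trace-class kernel tend to 0, simultaneously on the finitely many edges, so
    a truncation level exists and [rstar] does not take its default value. *)
Lemma rstarP (delta : R) : 0 < delta ->
  (0 < rstar adj lam delta)%N /\
  forall v u, adj v u -> lam u v (rstar adj lam delta).-1 <= delta.
Proof.
move=> d0.
have : \forall n \near \oo, forall v u, adj v u -> lam u v n <= delta.
  apply: edges_near => v u vu.
  have := cvg_series_cvg_0 (lam_trace vu) => /cvgrPdist_le/(_ _ d0).
  by apply: filterS => n; rewrite sub0r normrN; apply: le_trans; exact: ler_norm.
move=> [n _ Hn].
have ex : exists n, `[< truncation_level adj lam delta n >].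
  (* The level is [n.+1] because lambda_r has index [r.-1]. *)
  by exists n.+1; apply/asboolP; split=> // v u vu; exact: (Hn n (leqnn n)).
case: (@xgetPex _ 1%N [set r | truncation_level adj lam delta r /\
    forall r', truncation_level adj lam delta r' -> (r <= r')%N]).
  exists (ex_minn ex); case: ex_minnP => m /asboolP mP mmin; split=> // r' r'P.
  by apply: mmin; exact/asboolP.
by move=> [? ?] _; split.
Qed.

(* Small delta lie below the finitely many positive eigenvalues of index at most R0. *)
Lemma rstar_near R0 : \forall delta \near 0^'+,
  forall v u, adj v u -> (R0 <= rstar adj lam delta)%N \/
    forall j, (rstar adj lam delta <= j)%N -> lam u v j = 0.
Proof.
have : \forall delta \near 0^'+, forall e : V * V * 'I_R0.+1, adj e.1.1 e.1.2 ->
    0 < lam e.1.2 e.1.1 e.2 -> delta < lam e.1.2 e.1.1 e.2.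
  apply: filter_forall => -[[v u] j] /=.
  have [l0|l0] := ltP 0 (lam u v j); last by near=> delta.
  near=> delta => _ _; near: delta; exact: nbhs_right_lt.
move=> H; near=> delta => v u vu.
have d0 : 0 < delta by near: delta; exact: nbhs_right_gt.
have [r0 /(_ v u vu) hr] := rstarP d0.
have [|rR] := leqP R0 (rstar adj lam delta); first by left.
right=> j rj; apply/eqP; rewrite eq_le lam_ge0// andbT leNgt; apply/negP => lj.
have r1 : ((rstar adj lam delta).-1 < R0.+1)%N by rewrite ltnS (leq_trans (leq_pred _))// ltnW.
have h : forall e : V * V * 'I_R0.+1, adj e.1.1 e.1.2 ->
    0 < lam e.1.2 e.1.1 e.2 -> delta < lam e.1.2 e.1.1 e.2 by near: delta.
have := h ((v, u), Ordinal r1) vu => /= {}h.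
have l1 : 0 < lam u v (rstar adj lam delta).-1.
  by apply: lt_le_trans lj _; apply: lam_le => //; rewrite (leq_trans (leq_pred _)).
by have := lt_le_trans (h l1) hr; rewrite ltxx.
Unshelve. all: by end_near. Qed.

End finite_graph.

Theorem theorem3 (R : realType) (X : ptopologicalType)
  (mu : {finite_measure set (borel X) -> \bar R})
  (V : finType) (adj : rel V)
  (psiV : V -> borel X -> R) (psiE : V -> V -> borel X -> borel X -> R)
  (lam : V -> V -> nat -> R) (phi : V -> V -> nat -> borel X -> R)
  (mstar : V -> V -> borel X -> R)
  (gamma : R) (k : nat) (ops : nat -> nat)
  (compactX : compact [set: X])
  (adj_sym : symmetric adj) (adj_irr : irreflexive adj)
  (psiV_meas : forall u, measurable_fun setT (psiV u))
  (psiV_gt0 : forall u x, 0 < psiV u x)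
  (psiE_gt0 : forall v u x y, adj v u -> 0 < psiE u v x y)
  (psiE_sym : forall v u x y, adj v u -> psiE u v x y = psiE v u y x)
  (psiE_cont : forall v u, adj v u ->
     continuous (fun z : X * X => psiE u v z.1 z.2))
  (psiE_symm : forall v u, adj v u -> symmetric_kernel (psiE u v))
  (psiE_psd : forall v u, adj v u -> psd_kernel (psiE u v))
  (psiE_mercer : forall v u, adj v u ->
     mercer_system mu (psiE u v) (lam u v) (phi u v))
  (psiE_trace : forall v u, adj v u -> trace_class (lam u v))
  (gamma_gt0 : 0 < gamma) (gamma_lt2 : gamma < 2)
  (contr : bp_contractive mu adj psiV psiE gamma)
  (mstarP : bp_fixed_point mu adj psiV psiE mstar)
  (k_gt0 : (0 < k)%N) (opsP : linear_cost k ops) :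
  exists T : R -> nat,
    (forall v u, adj v u ->
       (fun delta => (T delta * ops (rstar adj lam delta))%:R : R^o)
       =O_ (0^'+)
       (fun delta => (rstar adj lam delta)%:R *
          (\sum_(j < rstar adj lam delta) lam u v j ^+ 2) *
          (1 / delta) * ln (1 / delta) : R^o)) /\
    (\forall delta \near 0^'+,
       forall (dO : measure_display) (Omega : measurableType dO)
         (P : probability Omega R) (nu : probability (borel X) R)
         (Y : nat -> V -> V -> 'I_k -> Omega -> borel X),
       sosmp_run mu adj psiV psiE phi (rstar adj lam delta)
         (fun t => 1 / (gamma * t.+1%:R)) P nu Y ->
       forall t, (T delta <= t)%N ->
       accurate mu adj psiV psiE phi (rstar adj lam delta)
         (fun t => 1 / (gamma * t.+1%:R)) P Y mstar t delta).

Proof.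
have [[[v0 u0] /= vu0]|no] := pselect (exists e : V * V, adj e.1 e.2); last first.
  exists (fun=> 0%N); split=> [v u vu|]; first by exfalso; apply: no; exists (v, u).
  by near=> delta => dO Omega P nu Y _ t _ v u vu; exfalso; apply: no; exists (v, u).
(* A single number provides both bounds, so that [edges_near] makes them common to all edges. *)
have [n Hn] : exists n : nat, forall v u, adj v u -> forall x y,
    n.+1%:R^-1 <= psiE u v x y <= n.+1%:R.
  have [] : \forall n \near \oo, forall v u, adj v u -> forall x y,
      (n.+1%:R^-1 <= psiE u v x y <= n.+1%:R)%R.
    apply: edges_near => v u vu.
    have [c [B [c0 B0 KB]]] := mercer_bounded compactX (@psiE_cont v u vu)
      (fun x y => @psiE_gt0 v u x y vu).
    have [a Ha] := nat_above c^-1; have [b Hb] := nat_above B.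
    exists (maxn a b) => // n; rewrite /= geq_max => /andP[an bn] x y.
    have /andP[h1 h2] := KB x y; apply/andP; split.
      apply: le_trans h1; rewrite -[leRHS]invrK lef_pV2 ?posrE ?invr_gt0//.
      by rewrite (le_trans Ha)// ler_nat ltnW.
    by rewrite (le_trans h2)// (le_trans Hb)// ler_nat ltnW.
  by move=> n _ Hn; exists n => v u vu x y; exact: (Hn n (leqnn n)).
pose c : R := n.+1%:R^-1; pose B : R := n.+1%:R.
have c0 : 0 < c by rewrite invr_gt0.
have psiE_bounds v u : adj v u -> forall x y, c <= psiE u v x y <= B by exact: Hn.
have M0_gt0 := mass_gt0 (psiE_mercer _ _ vu0).
set M0 := fine _ in M0_gt0.
have [t2 [K1 [K2 [K3 [e0 [K20 K30 e00 rate]]]]]] := coef_rate adj_sym psiV_meas psiV_gt0 c0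
  psiE_bounds psiE_symm psiE_mercer gamma_gt0 gamma_lt2 contr mstarP k_gt0.
have l0 : 0 < c / (B * M0) / 2 by rewrite !divr_gt0// mulr_gt0.
have cM : 0 < c * M0 by exact: mulr_gt0.
(* The first bound preserves half of the lower bound of the sections. The second yields
   [(K3 + 1) * e2 <= delta / 2] below, where the summand 1 accounts for the tail of [mstar]. *)
pose tau := Num.min (c / (B * M0) / 2 * (c * M0)) ((c * M0) ^+ 2 / (2 * (K3 + 1))).
have tau0 : 0 < tau.
  rewrite lt_min mulr_gt0//= divr_gt0 ?exprn_gt0// mulr_gt0// ltr_wpDl//.
have [R0 _ HR0] : \forall r0 \near \oo, forall v u, adj v u -> forall r N x, (r0 <= r)%N ->
    \sum_(r <= j < N) lam u v j * phi u v j x ^+ 2 <= tau.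
  apply: edges_near => v u vu.
  have [r0 Hr0] := mercer_uniform_tail compactX (@psiE_cont v u vu) (psiE_mercer _ _ vu) tau0.
  by exists r0 => // r1 /= r01 r N x r1r; apply: Hr0; exact: leq_trans r01 r1r.
have lam_ge0 v u j (vu : adj v u) := mercer_lam_ge0 (psiE_mercer _ _ vu) j.
have lam_le v u i j (vu : adj v u) := @mercer_lam_le _ _ _ _ _ _ (psiE_mercer _ _ vu) i j.
(* The constant of [iteration_count]; the sign of [K1] is not recorded, hence the absolute value. *)
pose C := 8 * (`|K1| + K2) + 1.
have C0 : 0 < C by rewrite ltr_wpDl// mulr_ge0// addr_ge0.
pose T (delta : R) := (Num.truncn (C / delta * ln (1 / delta))).+1.
exists T; split.
  move=> v u vu; have [w opsw] := opsP.
  have l0' := mercer_lam0_gt0 (psiE_mercer _ _ vu) (psiE_gt0 v u point point vu).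
  (* The added 1 keeps the constant positive when [w] is 0. *)
  apply/eqO_exP; exists ((C + 1) * (w * k)%:R / lam u v 0%N ^+ 2 + 1).
    by rewrite ltr_wpDl// divr_ge0 ?sqr_ge0// mulr_ge0// addr_ge0// ltW.
  near=> delta.
  have d0 : 0 < delta by near: delta; exact: nbhs_right_gt.
  have [r0 _] := rstarP psiE_trace d0.
  apply: cost_bound => //.
  - by near: delta; exact: nbhs_right_le.
  - by near: delta; exact: ln_inv_near.
  - by rewrite exprn_gt0.
  rewrite (bigD1 (Ordinal r0))//= lerDl sumr_ge0// => j _; exact: sqr_ge0.
near=> delta => dO Omega P nu Y runP t Tt v u vu.
have d0 : 0 < delta by near: delta; exact: nbhs_right_gt.
have L1 : 1 <= ln (1 / delta) by near: delta; exact: ln_inv_near.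
have L2 : 8 * K2 <= ln (1 / delta) by near: delta; exact: ln_inv_near.
have [r0 rle] := rstarP psiE_trace d0.
set r := rstar adj lam delta in runP r0 rle *.
have tail v' u' : adj v' u' -> forall N x,
    \sum_(r <= j < N) lam u' v' j * phi u' v' j x ^+ 2 <= tau.
  move=> vu' N x.
  have H : forall v u, adj v u -> (R0 <= rstar adj lam delta)%N \/
    forall j, (rstar adj lam delta <= j)%N -> lam u v j = 0.
    by near: delta; exact: rstar_near lam_ge0 lam_le psiE_trace R0.
  case: (H v' u' vu') => [Rr|z]; first exact: HR0 (leqnn R0) _ _ vu' _ _ _ Rr.
  by rewrite big_nat_cond big1 ?(ltW tau0)// => j /andP[/andP[rj _] _]; rewrite z// mul0r.
pose e2 := delta * tau / (c * M0) ^+ 2.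
have e20 : 0 < e2 by rewrite divr_gt0 ?exprn_gt0// mulr_gt0.
have ktail v' u' : adj v' u' -> forall N y,
    \sum_(r <= j < N) kcoef mu (psiE u' v') (lam u' v') (phi u' v') j y ^+ 2 <= e2.
  move=> vu'; apply: (kcoef_tail (psiE_mercer _ _ vu') c0 (psiE_bounds _ _ vu')); last exact: tail.
  (* [rle] bounds the eigenvalue of index [r.-1], the last one kept; the first one neglected has
     index [r] and is no larger. *)
  by apply: le_trans (rle _ _ vu'); exact: mercer_lam_le (psiE_mercer _ _ vu') _ _ (leq_pred _).
have taule : tau / (c * M0) <= c / (B * M0) / 2.
  by rewrite ler_pdivrMr// ge_min lexx.
have e2e : e2 <= e0.
  rewrite /e2 -mulrA -ler_pdivlMr ?divr_gt0 ?exprn_gt0//; near: delta.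
  by apply: nbhs_right_le; rewrite !divr_gt0 ?exprn_gt0.
have tx : C / delta * ln (1 / delta) <= t%:R.
  by rewrite (le_trans (ltW (truncnS_gt _)))// ler_nat.
have t2t : (t2 <= t)%N.
  rewrite -(ler_nat R) (le_trans _ tx)//.
  have h1 : t2%:R <= ln (1 / delta) by near: delta; exact: ln_inv_near.
  apply: le_trans h1 _; rewrite ler_peMl ?(le_trans ler01 L1)//.
  have h2 : delta <= 1 by near: delta; exact: nbhs_right_le.
  rewrite ler_pdivlMr// mul1r (le_trans h2)// lerDr mulr_ge0// addr_ge0//.
have [bm h] := rate _ _ _ _ _ _ _ _ r0 runP tail taule ktail e20 e2e t v u t2t vu.
apply: le_trans (message_error adj_sym psiV_meas psiV_gt0 c0 psiE_bounds psiE_symm psiE_mercer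
  mstarP (ktail v u vu) vu bm h) _.
rewrite lee_fin.
have h3 : (K1 + K2 * ln t%:R) / t%:R <= delta / 2.
  apply: le_trans (iteration_count (normr_ge0 K1) K20 d0 L1 L2 tx).
  by rewrite ler_wpM2r ?invr_ge0// lerD2r ler_norm.
have h4 : (K3 + 1) * e2 <= delta / 2.
  have K31 : 0 < K3 + 1 by rewrite ltr_wpDl.
  have -> : delta / 2 = (K3 + 1) * (delta * ((c * M0) ^+ 2 / (2 * (K3 + 1))) / (c * M0) ^+ 2).
    by field; rewrite !gt_eqF.
  rewrite ler_wpM2l ?(ltW K31)// ler_wpM2r ?invr_ge0 ?sqr_ge0// ler_wpM2l ?(ltW d0)//.
  by rewrite ge_min lexx orbT.
lra.
Unshelve. all: by end_near. Qed.
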